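(* Let $\varepsilon>0$, $\delta\in(0,1)$, and suppose $Q^\star\in\mathcal{F}$. Suppose further that for all $h\in[H]$, $\pi\in\Pi$, $t\in[T]$ and $\pi^{(1)},\dots,\pi^{(t)}\in\Pi$ there exists $w^{\pi;\pi^{(1:t)}}_h\in\mathcal{W}_h$ with $$\sup_{\tilde\pi\in\Pi}\Big\|\frac{d^\pi_h}{d^{\pi^{(1:t)}}_h}-w^{\pi;\pi^{(1:t)}}_h\Big\|_{1,d^{\tilde\pi}_h}\le\varepsilon_{\mathrm{app}},$$ where $T$ is GLOW's iteration parameter and $\varepsilon_{\mathrm{app}}\le\varepsilon/(18H)$. Then GLOW run on $\mathcal{F},\mathcal{W}$ with $T=\widetilde\Theta\big((H^2C_{\mathsf{cov}}/\varepsilon^2)\log(|\mathcal{F}||\mathcal{W}|/\delta)\big)$, $K=1$, $\gamma=\sqrt{C_{\mathsf{cov}}/(T\log(|\mathcal{F}||\mathcal{W}|/\delta))}$ returns an $\varepsilon$-suboptimal policy $\widehat\pi$ with probability at least $1-\delta$ after collecting $N=\widetilde O\big(\frac{H^2C_{\mathsf{cov}}}{\varepsilon^2}\log(|\mathcal{F}||\mathcal{W}|/\delta)\big)$ trajectories. In addition, for any $T\in\mathbb{N}$, with the same choice of $K$ and $\gamma$, the algorithm enjoys the regret bound $$\sum_{t=1}^TJ(\pi^\star)-J(\pi^{(t)})=\widetilde O\Big(H\sqrt{C_{\mathsf{cov}}T\log(|\mathcal{F}||\mathcal{W}|/\delta)}+HT\varepsilon_{\mathrm{app}}\Big).$$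
   Context: Episodic MDP with countable $\mathcal{X},\mathcal{A}$, horizon $H$, rewards with $\sum_hr_h\in[0,1]$ a.s.; a policy $\pi=(\pi_h)$, $\pi_h:\mathcal{X}\to\Delta(\mathcal{A})$; $J(\pi)=\mathbb{E}^\pi[\sum_hr_h]$; $d^\pi_h(x,a)=\mathbb{P}^\pi[x_h=x,a_h=a]$; $d^{\pi^{(1:t)}}_h=\frac1t\sum_{i\le t}d^{\pi^{(i)}}_h$; $Q^\star$ optimal Q-function, $\pi^\star$ optimal policy. For $u:\mathcal{X}\times\mathcal{A}\to\mathbb{R}$ and distribution $\rho$, $\|u\|_{1,\rho}=\mathbb{E}_{(x,a)\sim\rho}|u(x,a)|$. Conventions $x/0=+\infty$ ($x>0$), $0/0=1$. $\mathcal{F}$: finite class of $f=(f_h)$, $f_h:\mathcal{X}\times\mathcal{A}\to[0,1]$; $\pi_f$ greedy, $\Pi=\{\pi_f:f\in\mathcal{F}\}$. $\mathcal{W}$: finite class of $w=(w_h)$, $w_h:\mathcal{X}\times\mathcal{A}\to[0,\infty]$, $\mathcal{W}_h=\{w_h\}$. $\mathrm{clip}_\gamma[w]=\min\{w,\gamma\}$. $C_{\mathsf{cov}}=\inf_{\mu_1..\mu_H}\sup_{\pi\in\Pi,h}\|d^\pi_h/\mu_h\|_\infty$. ''$\varepsilon$-suboptimal'' means $\mathbb{E}_{\widehat\pi}[J(\pi^\star)-J(\widehat\pi)]\le\varepsilon$. GLOW (input $\mathcal{F},\mathcal{W},T,K,\gamma\in[0,1]$): $\gamma^{(t)}=\gamma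 t$, $\alpha^{(t)}=8/\gamma^{(t)}$, $\beta^{(t)}=\frac{36\gamma^{(t)}}{K(t-1)}\log(6|\mathcal{F}||\mathcal{W}|TH/\delta)$, $\mathcal{D}^{(1)}_h=\emptyset$. For $t=1..T$: $\mathcal{F}^{(t)}=\{f\in\mathcal{F}:\forall h,\sup_{w\in\mathcal{W}_h}\widehat{\mathbb{E}}_{\mathcal{D}^{(t)}_h}[(f_h(x,a)-r-\max_{a'}f_{h+1}(x',a'))\tilde w(x,a)-\alpha^{(t)}\tilde w(x,a)^2]\le\beta^{(t)}\}$ with $\tilde w=\mathrm{clip}_{\gamma^{(t)}}[w]$ and $\widehat{\mathbb{E}}$ the empirical average over stored tuples $(x,a,r,x')$; $f^{(t)}=\arg\max_{f\in\mathcal{F}^{(t)}}\widehat{\mathbb{E}}_{x_1\in\mathcal{D}^{(t)}_1}[f_1(x_1,\pi_f(x_1))]$, $\pi^{(t)}=\pi_{f^{(t)}}$; run $\pi^{(t)}$ for $K$ trajectories and append tuples $(x_h,a_h,r_h,x_{h+1})$ to form $\mathcal{D}^{(t+1)}_h$. Output $\widehat\pi=\mathrm{Unif}(\pi^{(1)},\dots,\pi^{(T)})$. $\widetilde O,\widetilde\Theta$ hide polylogarithmic factors. *)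

(* Defs.v *)
From HB Require Import structures.
From mathcomp Require Import all_boot all_order all_algebra.
From mathcomp Require Import all_classical all_reals all_analysis.
Set Implicit Arguments. Unset Strict Implicit. Unset Printing Implicit Defensive.
Import Order.TTheory GRing.Theory Num.Theory.
Local Open Scope classical_set_scope.
Local Open Scope ring_scope.

(* Steps are indexed 0 .. H-1 (the paper's 1 .. H).                         *)
(*  rew h x a x'      : law of r_h given x_h = x, a_h = a, x_{h+1} = x'     *)
(*  (this disintegration represents an arbitrary joint law of (r_h, x_{h+1}) *)
(*  given (x_h, a_h), since X is countable).                                *)
Record mdp (R : realType) (X A : countType) := MDP {
  horizon : nat;
  init : X -> R;
  trans : nat -> X -> A -> X -> R;
  rew : nat -> X -> A -> X -> probability R R }.

Section MDP.
Variables (R : realType) (X A : countType) (M : mdp R X A).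
Local Notation H := (horizon M).

Definition tup := (X * A * R * X)%type.
Definition traj := seq tup.

Definition policy := nat -> X -> A -> R.

Definition is_policy (pi : policy) : Prop :=
  (forall h x a, 0 <= pi h x a) /\
  (forall h x, \esum_(a in [set: A]) (pi h x a)%:E = 1%E).

Definition detpol (g : nat -> X -> A) : policy :=
  fun h x a => if a == g h x then 1 else 0.

(* E^pi[ g(trajectory) ] for nonnegative g, by nested sums / integrals *)
Fixpoint trajE (pi : policy) (g : traj -> \bar R) (n h : nat) (x : X)
    (pref : traj) : \bar R :=
  match n with
  | 0 => g pref
  | n'.+1 =>
      \esum_(a in [set: A]) ((pi h x a)%:E *
        \esum_(x' in [set: X]) ((trans M h x a x')%:E *
          \int[rew M h x a x']_(r in setT)
             trajE pi g n' h.+1 x' (rcons pref (x, a, r, x'))))%E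
  end.

Definition Eexp (pi : policy) (g : traj -> \bar R) : \bar R :=
  (\esum_(x in [set: X]) ((init M x)%:E * trajE pi g H 0 x [::]))%E.

Definition sumrew (t : traj) : R := \sum_(z <- t) z.1.2.

Definition Jval (pi : policy) : R :=
  fine (Eexp pi (fun t => (Num.max (sumrew t) 0)%:E)) -
  fine (Eexp pi (fun t => (Num.max (- sumrew t) 0)%:E)).

Definition Jstar : R :=
  fine (ereal_sup [set (Jval pi)%:E | pi in [set pi | is_policy pi]]).

Definition stepAt (h : nat) (t : traj) : option tup := nth None (map Some t) h.

Definition occ (pi : policy) (h : nat) (xa : X * A) : R :=
  fine (Eexp pi (fun t =>
    (if stepAt h t is Some z then z.1.1 == xa else false)%:R%:E)).

Definition is_dist (T : choiceType) (p : T -> R) : Prop :=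
  (forall x, 0 <= p x) /\ \esum_(x in [set: T]) (p x)%:E = 1%E.

Definition wf_mdp : Prop :=
  is_dist (init M) /\
  (forall h x a, is_dist (trans M h x a)) /\
  (forall pi, is_policy pi ->
     Eexp pi (fun t => (~~ ((0 <= sumrew t) && (sumrew t <= 1)))%:R%:E) = 0%E).

Definition stepE (h : nat) (x : X) (a : A) (g : R -> X -> \bar R) : \bar R :=
  (\esum_(x' in [set: X]) ((trans M h x a x')%:E *
      \int[rew M h x a x']_(r in setT) g r x'))%E.

Definition stepS (h : nat) (x : X) (a : A) (g : R -> X -> R) : R :=
  fine (stepE h x a (fun r x' => (Num.max (g r x') 0)%:E)) -
  fine (stepE h x a (fun r x' => (Num.max (- g r x') 0)%:E)).

(* Qrec n = Q^*_{H-n} *)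
Fixpoint Qrec (n : nat) : X -> A -> R :=
  match n with
  | 0 => fun _ _ => 0
  | n'.+1 => fun x a =>
      stepS (H - n'.+1) x a (fun r x' =>
        r + (if n' is 0 then 0
             else fine (ereal_sup [set (Qrec n' x' b)%:E | b in [set: A]])))
  end.

Definition Qstar (h : nat) : X -> A -> R := Qrec (H - h).

Definition ratio (a b : R) : \bar R :=
  if b == 0 then (if a == 0 then 1%E else +oo%E) else (a / b)%:E.

(* | u - v | on [0, +oo], with |+oo - +oo| = 0 *)
Definition edist (u v : \bar R) : \bar R :=
  if u == v then 0%E else `|(u - v)%E|%E.

Definition normL1 (rho : X * A -> R) (u : X * A -> \bar R) : \bar R :=
  (\esum_(xa in [set: X * A]) ((rho xa)%:E * u xa))%E.

(* Classes: F indexed by a finite type I (F injective on steps 0..H-1),      *)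
(* W indexed by a finite type J; g i is a greedy policy for F i.           *)
Section Classes.
Variables (I J : finType) (F : I -> nat -> X -> A -> R)
  (g : I -> nat -> X -> A) (W : J -> nat -> X -> A -> \bar R).

Definition Fclass_ok : Prop :=
  (forall i h x a, (h < H)%N -> 0 <= F i h x a <= 1) /\
  (forall i i', (forall h x a, (h < H)%N -> F i h x a = F i' h x a) -> i = i').

Definition Wclass_ok : Prop :=
  (forall j h x a, (h < H)%N -> (0 <= W j h x a)%E) /\
  (forall j j', (forall h x a, (h < H)%N -> W j h x a = W j' h x a) -> j = j').

Definition greedy_ok : Prop :=
  forall i h x a, (h < H)%N -> F i h x a <= F i h x (g i h x).

Definition Qstar_in_F : Prop :=
  exists iQ, forall h x a, (h < H)%N -> F iQ h x a = Qstar h x a.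

Definition piF (i : I) : policy := detpol (g i).

Definition Ccov : \bar R :=
  ereal_inf [set C | exists mu : nat -> X * A -> R,
     (forall h, (h < H)%N -> is_dist (mu h)) /\
     C = ereal_sup [set e | exists i h xa,
            (h < H)%N /\ e = ratio (occ (piF i) h xa) (mu h xa)]].

Definition mixocc (s : seq I) (h : nat) (xa : X * A) : R :=
  (\sum_(i <- s) occ (piF i) h xa) / (size s)%:R.

Definition W_realizable (T : nat) (eps_app : R) : Prop :=
  forall h, (h < H)%N -> forall (i : I) (s : seq I),
    (0 < size s <= T)%N ->
    exists j : J, forall i' : I,
      (normL1 (occ (piF i') h)
        (fun xa => edist (ratio (occ (piF i) h xa) (mixocc s h xa))
                         (W j h xa.1 xa.2)) <= eps_app%:E)%E.

Variables (T K : nat) (gamma delta : R) (idef : I).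

Definition data (h : nat) (hist : seq traj) : seq tup := pmap (stepAt h) hist.

Definition emp (D : seq tup) (phi : tup -> R) : R :=
  (\sum_(z <- D) phi z) / (size D)%:R.

Definition gam (t : nat) : R := gamma * t%:R.
Definition alph (t : nat) : R := 8 / gam t.
Definition bet (t : nat) : R :=
  36 * gam t / (K * (t - 1))%:R *
  ln (6 * #|I|%:R * #|J|%:R * T%:R * H%:R / delta).

Definition nextv (i : I) (h : nat) (x' : X) : R :=
  if (h.+1 < H)%N then F i h.+1 x' (g i h.+1 x') else 0.

Definition loss (t : nat) (i : I) (j : J) (h : nat) (D : seq tup) : R :=
  emp D (fun z =>
    let w := fine (Order.min (W j h z.1.1.1 z.1.1.2) (gam t)%:E) in
    (F i h z.1.1.1 z.1.1.2 - z.1.2 - nextv i h z.2) * w - alph t * w ^+ 2).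

Definition inVS (t : nat) (hist : seq traj) (i : I) : bool :=
  [forall h : 'I_H, forall j : J, loss t i j h (data h hist) <= bet t].

Definition val1 (hist : seq traj) (i : I) : R :=
  emp (data 0 hist) (fun z => F i 0 z.1.1.1 (g i 0 z.1.1.1)).

(* f^(t) (argmax with a deterministic tie-break; idef if F^(t) is empty) *)
Definition choose (t : nat) (hist : seq traj) : I :=
  if [pick i | inVS t hist i] is Some i0
  then [arg max_(i > i0 | inVS t hist i) val1 hist i]%O
  else idef.

(* policy used to collect the n-th trajectory (0-based): round n/K + 1 *)
Definition glow_pol (n : nat) (hist : seq traj) : policy :=
  piF (choose (n %/ K).+1 (take (n %/ K * K) hist)).

Fixpoint run (m : nat) (hist : seq traj) (good : seq traj -> bool) : \bar R :=
  match m with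
  | 0 => (good hist)%:R%:E
  | m'.+1 => Eexp (glow_pol (size hist) hist)
                  (fun t => run m' (rcons hist t) good)
  end.

Definition glow_prob (good : seq traj -> bool) : \bar R := run (T * K) [::] good.

Definition chosen (t : nat) (hist : seq traj) : I :=
  choose t (take ((t - 1) * K) hist).

Definition regret (hist : seq traj) : R :=
  \sum_(1 <= t < T.+1) (Jstar - Jval (piF (chosen t hist))).

End Classes.
End MDP.

(* Main.v *)
(* Everything reduces to a high-probability event for exponential
   supermartingales.  With respect to the last trajectory only, the exponential of
   a deviation minus its compensator has expectation at most 1; a weighted sum of
   such processes over rounds, steps and indices is a supermartingale.  As the
   lower integral is monotone, integrating one trajectory at a time requires no
   measurability of the history-dependent choices of the algorithm.

   The assumption only bounds the sum of the rewards, but by the Bellman equation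
   for Qstar (which is in the class, hence in [0, 1]) every reward met with
   positive probability is bounded by 3 almost surely: a path with positive
   probability along which the total leaves [0, 1] is excluded.

   On the good event Qstar stays in every version space, whence optimism, and the
   regret of a round is bounded by the Bellman errors of the chosen function under
   its own occupancy d.  The change of measure from d to the past mixture D is
   pointwise: it costs the clipped ratio min(d/D, gam), which is replaced by the
   realizing weight, plus the novelty min(d/(gam D), 1) on the current occupancy.
   The novelties sum up to at most C (2 + 4/gamma log (T + 1)) for any covering
   measure, by the elliptic potential argument.  If the class is a singleton, or
   the horizon or the number of rounds is 0, the regret is trivially at most 0. *)

Require Import Defs.
From HB Require Import structures.
From mathcomp Require Import all_boot all_order all_algebra.
From mathcomp Require Import all_classical all_reals all_analysis measurable_realfun.
From mathcomp Require Import ring lra zify.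
Import Order.TTheory GRing.Theory Num.Theory.
Local Open Scope classical_set_scope.
Local Open Scope ring_scope.
Set Implicit Arguments. Unset Strict Implicit. Unset Printing Implicit Defensive.

(** The version space test is read in two directions with the same penalty. For [Qstar] the Bellman
    error vanishes, the penalty is pure negative drift, and it pays for the variance in the
    exponential bound. For an accepted function the sign is reversed and the variance adds to the
    penalty, so the change of measure has to absorb both. A second, slower rate keeps this addition
    small, at the price of a larger multiple of [log_term]. The union bound ranges over fixed
    functions, weights and rounds; the choices of the algorithm enter only through the policy
    played, a function of the history. At states that are never reached, conditional expectations
    may be infinite and Bellman errors unbounded. Bounds on them are stated on the support of an
    occupancy, and inequalities between mixtures are proved pointwise before being summed. The
    clipping threshold grows like gamma t while the past mixture averages over t - 1 rounds. The two
    factors cancel in the novelty, which is then of order d / (gamma S) with S the sum of the past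
    occupancies; hence a sum logarithmic in T. *)

(** * Unordered sums of nonnegative extended reals *)

Section Esum.
Context {R : realType}.
Local Open Scope ereal_scope.

Lemma esumZl (T : choiceType) (S : set T) (k : R) (a : T -> \bar R) :
  (0 <= k)%R -> (forall i, 0 <= a i) ->
  \esum_(i in S) (k%:E * a i) = k%:E * \esum_(i in S) a i.
Proof.
move=> k0 a0; rewrite /esum -ereal_supZl//; last first.
  by apply/set0P; exists (\sum_(i \in set0) a i); exists set0 => //; exact: fsets_set0.
congr ereal_sup; rewrite image_comp; apply: eq_imagel => X _ /=.
by rewrite ge0_mule_fsumr.
Qed.

Lemma esumZr (T : choiceType) (S : set T) (k : \bar R) (a : T -> \bar R) :
  0 <= k -> (forall i, 0 <= a i) ->
  \esum_(i in S) (a i * k) = (\esum_(i in S) a i) * k.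
Proof.
move=> k0 a0; under eq_esum do rewrite muleC.
rewrite [RHS]muleC; case: k k0 => [k k0|_|//]; first exact: esumZl.
(* For an infinite factor, either all terms vanish or one positive term already makes both sides
   infinite. *)
have [/(_ _ _)/esym a00|] := pselect (forall i, S i -> a i = 0).
  by rewrite !esum1 ?mule0// => i Si; rewrite -a00 ?mule0.
move=> /existsNP[i /not_implyP[Si ai]].
have ai0 : 0 < a i by rewrite lt_neqAle a0 eq_sym andbT; exact/eqP.
have s0 : 0 < \esum_(i in S) a i.
  apply: (lt_le_trans ai0); apply: esum_ge; exists [set i].
    by split; [exact: finite_set1|move=> _ ->].
  by rewrite fsbig_set1.
rewrite gt0_mulye//; apply/eqP; rewrite -leye_eq; apply: esum_ge; exists [set i].
  by split; [exact: finite_set1|move=> _ ->].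
by rewrite fsbig_set1 gt0_mulye.
Qed.

Lemma esum_swap (S T : choiceType) (a : S -> T -> \bar R) :
  (forall i j, 0 <= a i j) ->
  \esum_(i in [set: S]) \esum_(j in [set: T]) a i j =
  \esum_(j in [set: T]) \esum_(i in [set: S]) a i j.
Proof.
move=> a0; rewrite !esum_esum//.
rewrite (reindex_esum ([set: T] `*`` (fun=> [set: S])) _ (fun x => (x.2, x.1)))//.
split => [//|[i j] [i' j'] _ _ [-> ->]//|[i j] _].
by exists (j, i).
Qed.

Lemma esum_pair (S T : choiceType) (a : S * T -> \bar R) :
  (forall z, 0 <= a z) ->
  \esum_(z in [set: S * T]) a z =
  \esum_(i in [set: S]) \esum_(j in [set: T]) a (i, j).
Proof.
move=> a0; rewrite (esum_esum (a := fun i j => a (i, j)))//.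
have -> : [set: S] `*`` (fun=> [set: T]) = setT by apply/seteqP; split.
by apply: eq_esum => -[].
Qed.

Lemma esum_single (T : choiceType) (a : T -> \bar R) t :
  (forall i, 0 <= a i) -> (forall i, i != t -> a i = 0) ->
  \esum_(i in [set: T]) a i = a t.
Proof.
move=> a0 at0; rewrite -(esum_set1 (a0 t)) [RHS]esum_mkcond; apply: eq_esum => i _.
case: ifPn => //; rewrite notin_setE /= => it; apply: at0; exact/eqP.
Qed.

Lemma esum_ge_term (T : choiceType) (a : T -> \bar R) t :
  (forall i, 0 <= a i) -> a t <= \esum_(i in [set: T]) a i.
Proof.
move=> a0; apply: esum_ge; exists [set t]; first by split => //; exact: finite_set1.
by rewrite fsbig_set1.
Qed.

Lemma esum_countable (T : countType) (a : T -> \bar R) : (forall t, 0 <= a t) ->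
  \esum_(t in [set: T]) a t =
  \sum_(n <oo) if pickle_inv n is Some t then a t else 0.
Proof.
move=> a0; have b0 n : 0 <= if @pickle_inv T n is Some t then a t else 0.
  by case: (pickle_inv n).
rewrite nneseries_esumT//.
have -> : \esum_(t in [set: T]) a t =
    \esum_(t in [set: T]) if pickle_inv (pickle t) is Some t then a t else 0.
  by apply: eq_esum => t _; rewrite pickleK_inv.
rewrite -(esum_image setT pickle (fun n => if @pickle_inv T n is Some t then a t else 0)); last first.
  by move=> s t _ _ e; apply: (pcan_inj (@pickleK T)).
rewrite esum_mkcond; apply: eq_esum => n _; case: ifPn => //; rewrite notin_setE => nT.
case E : (pickle_inv n) => [t|]//; exfalso; apply: nT; exists t => //.
by have := @pickle_invK T n; rewrite /oapp/= E.
Qed.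

Lemma measurable_fun_esum (T : countType) d (O : measurableType d) (a : T -> O -> \bar R) :
  (forall t o, 0 <= a t o) -> (forall t, measurable_fun setT (a t)) ->
  measurable_fun setT (fun o => \esum_(t in [set: T]) a t o).
Proof.
move=> a0 ma.
rewrite (_ : (fun _ => _) = fun o => \sum_(n <oo | n \in xpredT)
    if pickle_inv n is Some t then a t o else 0); last first.
  by apply/funext => o; rewrite esum_countable.
apply: ge0_emeasurable_sum => [k o _ _|k _]; first by case: (pickle_inv k).
by case: (pickle_inv k) => // *; exact: measurable_cst.
Qed.

End Esum.

(* The integral of a nonnegative function is defined as a supremum over simple
   functions, so monotonicity holds without any measurability. *)
Lemma ge0_le_integral_nomeas d (T : measurableType d) (R : realType)
  (mu : {measure set T -> \bar R}) (f g : T -> \bar R) :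
  (forall x, 0 <= f x)%E -> (forall x, f x <= g x)%E ->
  (\int[mu]_(x in setT) f x <= \int[mu]_(x in setT) g x)%E.
Proof.
move=> f0 fg; rewrite !ge0_integralTE//; last by move=> x; exact: le_trans (fg x).
apply: ereal_sup_le => _ [h hf <-]; exists h => // x; exact: le_trans (fg x).
Qed.

(** * Signed expectations *)

Section Expectation.
Context {R : realType} {T : Type}.
Implicit Types (u v : T -> R).

(* [E] acts on nonnegative functions and only sees the points of [P]; [Ms] is
   the class of admissible (measurable) functions. *)
Record is_expectation (E : (T -> \bar R) -> \bar R) (Ms : (T -> R) -> Prop)
    (P : T -> Prop) : Prop := {
  Ms_cst : forall c, Ms (fun=> c);
  Ms_add : forall u v, Ms u -> Ms v -> Ms (fun t => u t + v t);
  Ms_scale : forall c u, Ms u -> Ms (fun t => c * u t);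
  Ms_pos : forall u, Ms u -> Ms (fun t => Num.max (u t) 0);
  exp_le : forall u v, Ms u -> Ms v -> (forall t, 0 <= u t) ->
     (forall t, 0 <= v t) -> (forall t, P t -> u t <= v t) ->
     (E (fun t => (u t)%:E) <= E (fun t => (v t)%:E))%E;
  exp_add : forall u v, Ms u -> Ms v -> (forall t, 0 <= u t) ->
     (forall t, 0 <= v t) ->
     (E (fun t => (u t + v t)%:E) = E (fun t => (u t)%:E) + E (fun t => (v t)%:E))%E;
  exp_scale : forall c u, Ms u -> (forall t, 0 <= u t) -> 0 <= c ->
     (E (fun t => (c * u t)%:E) = c%:E * E (fun t => (u t)%:E))%E;
  exp_one : E (fun=> 1%:E) = 1%E }.

Definition sE (E : (T -> \bar R) -> \bar R) u : R :=
  fine (E (fun t => (Num.max (u t) 0)%:E)) - fine (E (fun t => (Num.max (- u t) 0)%:E)).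

Section Theory.
Variables (E : (T -> \bar R) -> \bar R) (Ms : (T -> R) -> Prop) (P : T -> Prop).
Hypothesis HE : is_expectation E Ms P.

Definition bounded_on u := Ms u /\ exists B, forall t, P t -> `|u t| <= B.

Lemma exp_cst c : 0 <= c -> E (fun=> c%:E) = c%:E.
Proof.
move=> c0; rewrite -[RHS]mule1 -(exp_one HE) -(exp_scale HE)//; last exact: (Ms_cst HE).
by congr E; apply/funext => t /=; rewrite mulr1.
Qed.

Lemma exp_fin u B : Ms u -> (forall t, 0 <= u t) -> (forall t, P t -> u t <= B) ->
  E (fun t => (u t)%:E) \is a fin_num.
Proof.
move=> mu u0 uB; rewrite ge0_fin_numE; last first.
  rewrite -[X in (X <= _)%E](_ : E (fun=> 0%:E) = 0%E); last by rewrite exp_cst.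
  by apply: (exp_le HE) => //; exact: (Ms_cst HE).
apply: (@le_lt_trans _ _ (`|B|)%:E); last exact: ltry.
rewrite -exp_cst//; apply: (exp_le HE) => // [|t /uB]; first exact: (Ms_cst HE).
by move=> /le_trans; apply; exact: ler_norm.
Qed.

Lemma exp_fin_ge0 u : (forall t, 0 <= u t) -> bounded_on u ->
  E (fun t => (u t)%:E) \is a fin_num.
Proof.
move=> u0 [mu [B uB]]; apply: (@exp_fin _ B) => // t /uB; apply: le_trans.
exact: ler_norm.
Qed.

(** One step of the union bound: the weights are the current values of the processes, the functions
    their next multiplicative factors. *)
Lemma exp_sum_le (I : Type) (r : seq I) (c : I -> R) (w : I -> T -> R) :
  (forall i, 0 <= c i) -> (forall i, Ms (w i)) -> (forall i t, 0 <= w i t) ->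
  (forall i, E (fun t => (w i t)%:E) <= 1)%E ->
  Ms (fun t => \sum_(i <- r) c i * w i t) /\
  (E (fun t => (\sum_(i <- r) c i * w i t)%:E) <= (\sum_(i <- r) c i)%:E)%E.
Proof.
move=> c0 mw w0 w1; elim: r => [|i r [IHm IH]].
  split; first by under eq_fun do rewrite big_nil; exact: (Ms_cst HE).
  by rewrite big_nil; under eq_fun do rewrite big_nil; rewrite exp_cst.
have mi : Ms (fun t => c i * w i t) by apply: (Ms_scale HE).
split; first by under eq_fun do rewrite big_cons; exact: (Ms_add HE).
rewrite big_cons EFinD (_ : (fun t => _) = (fun t => (c i * w i t + \sum_(j <- r) c j * w j t)%:E)).
  have s0 t : 0 <= \sum_(j <- r) c j * w j t by apply: sumr_ge0 => j _; rewrite mulr_ge0.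
  have i0 t : 0 <= c i * w i t by rewrite mulr_ge0.
  rewrite (exp_add HE mi IHm i0 s0) (exp_scale HE)// leeD//.
  by rewrite -[leRHS]mule1 lee_wpmul2l// lee_fin.
by apply/funext => t; rewrite big_cons.
Qed.

Lemma bounded_on_cst c : bounded_on (fun=> c).
Proof. by split; [exact: (Ms_cst HE)|exists `|c|]. Qed.

Lemma bounded_onD u v : bounded_on u -> bounded_on v -> bounded_on (fun t => u t + v t).
Proof.
move=> [mu [B uB]] [mv [D vD]]; split; first exact: (Ms_add HE).
exists (B + D) => t Pt; apply: (le_trans (ler_normD _ _)).
by apply: lerD; [exact: uB|exact: vD].
Qed.

Lemma bounded_onZ c u : bounded_on u -> bounded_on (fun t => c * u t).
Proof.
move=> [mu [B uB]]; split; first exact: (Ms_scale HE).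
exists (`|c| * B) => t Pt; rewrite normrM; apply: ler_wpM2l => //; exact: uB.
Qed.

Lemma bounded_onN u : bounded_on u -> bounded_on (fun t => - u t).
Proof.
by move=> /(bounded_onZ (-1)); congr bounded_on; apply/funext => t; rewrite mulN1r.
Qed.

Lemma bounded_on_pos u : bounded_on u -> bounded_on (fun t => Num.max (u t) 0).
Proof.
move=> [mu [B uB]]; split; first exact: (Ms_pos HE).
exists `|B| => t /uB uBt.
have [_|u0] := leP (u t) 0; first by rewrite normr0.
by apply: (le_trans uBt); exact: ler_norm.
Qed.

Let maxE (x : R) : x = Num.max x 0 - Num.max (- x) 0.
Proof. by have [|] := leP x 0; have [|] := leP (- x) 0; lra. Qed.

(** The signed expectation does not depend on how [u] is split: [Num.max (u t) 0 + b t] and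
    [Num.max (- u t) 0 + a t] agree pointwise, and finiteness allows subtraction. Linearity follows
    from this. *)
Lemma sE_diff u a b : (forall t, 0 <= a t) -> (forall t, 0 <= b t) ->
  bounded_on a -> bounded_on b -> (forall t, u t = a t - b t) -> Ms u ->
  sE E u = fine (E (fun t => (a t)%:E)) - fine (E (fun t => (b t)%:E)).
Proof.
move=> a0 b0 ba bb uab mu.
have bu : bounded_on u.
  have := bounded_onD ba (bounded_onN bb); congr bounded_on; apply/funext => t; exact/esym/uab.
have pa := bounded_on_pos bu; have pb := bounded_on_pos (bounded_onN bu).
have e : E (fun t => (Num.max (u t) 0 + b t)%:E) = E (fun t => (Num.max (- u t) 0 + a t)%:E).
  by congr E; apply/funext => t; congr EFin; have := maxE (u t); rewrite {1}uab; lra.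
have max0 (x : R) : 0 <= Num.max x 0 by rewrite le_max lexx orbT.
rewrite !(exp_add HE) in e; [|by case: pb|by case: ba|by []|by []|by case: pa|by case: bb|by []|by []].
move: e; rewrite /sE.
have /fineK := exp_fin_ge0 (fun t => max0 (u t)) pa; move=> <-.
have /fineK := exp_fin_ge0 (fun t => max0 (- u t)) pb; move=> <-.
have /fineK := exp_fin_ge0 a0 ba; move=> <-.
have /fineK := exp_fin_ge0 b0 bb; move=> <-.
by rewrite -!EFinD => -[] /=; lra.
Qed.

Lemma sE_nneg u : (forall t, 0 <= u t) -> bounded_on u ->
  E (fun t => (u t)%:E) = (sE E u)%:E.
Proof.
move=> u0 bu; rewrite (@sE_diff u u (fun=> 0))//.
- by rewrite exp_cst//= subr0 fineK// exp_fin_ge0.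
- exact: bounded_on_cst.
- by move=> t; rewrite subr0.
- by case: bu.
Qed.

Lemma sE_cst c : sE E (fun=> c) = c.
Proof.
rewrite /sE !exp_cst//= ?le_max ?lexx ?orbT//.
Qed.

Lemma sED u v : bounded_on u -> bounded_on v ->
  sE E (fun t => u t + v t) = sE E u + sE E v.
Proof.
move=> bu bv; have max0 (x : R) : 0 <= Num.max x 0 by rewrite le_max lexx orbT.
have [pu nu] := (bounded_on_pos bu, bounded_on_pos (bounded_onN bu)).
have [pv nv] := (bounded_on_pos bv, bounded_on_pos (bounded_onN bv)).
rewrite (@sE_diff _ (fun t => Num.max (u t) 0 + Num.max (v t) 0)
   (fun t => Num.max (- u t) 0 + Num.max (- v t) 0)).
- rewrite !(exp_add HE); [|by case: nu|by case: nv|by []|by []|by case: pu|by case: pv|by []|by []].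
  rewrite !fineD ?exp_fin_ge0// /sE; lra.
- by move=> t; rewrite addr_ge0.
- by move=> t; rewrite addr_ge0.
- exact: bounded_onD.
- exact: bounded_onD.
- by move=> t; have := maxE (u t); have := maxE (v t); lra.
- by apply: (Ms_add HE); [case: bu|case: bv].
Qed.

Lemma sEN u : sE E (fun t => - u t) = - sE E u.
Proof.
by rewrite /sE opprB; under [X in _ - fine (E X)]eq_fun do rewrite opprK.
Qed.

Lemma sEZ c u : bounded_on u -> sE E (fun t => c * u t) = c * sE E u.
Proof.
move=> bu.
wlog c0 : c / 0 <= c.
  move=> h; have [|c0] := leP 0 c; first exact: h.
  have := h (- c); rewrite oppr_ge0 (ltW c0) => /(_ isT).
  rewrite mulNr => /(congr1 -%R); rewrite opprK => <-.
  rewrite -sEN.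
  by congr sE; apply/funext => t; rewrite mulNr opprK.
have max0 (x : R) : 0 <= Num.max x 0 by rewrite le_max lexx orbT.
have [pu nu] := (bounded_on_pos bu, bounded_on_pos (bounded_onN bu)).
rewrite (@sE_diff _ (fun t => c * Num.max (u t) 0) (fun t => c * Num.max (- u t) 0)).
- rewrite !(exp_scale HE)//; [|by case: nu|by case: pu].
  rewrite !fineM ?exp_fin_ge0// /sE/=; lra.
- by move=> t; rewrite mulr_ge0.
- by move=> t; rewrite mulr_ge0.
- exact: bounded_onZ.
- exact: bounded_onZ.
- by move=> t; rewrite {1}(maxE (u t)) mulrBr.
- by apply: (Ms_scale HE); case: bu.
Qed.

Lemma le_sE u v : bounded_on u -> bounded_on v -> (forall t, P t -> u t <= v t) ->
  sE E u <= sE E v.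
Proof.
move=> bu bv uv; rewrite -subr_ge0 -sEN// -sED//; last exact: bounded_onN.
set w := fun t => _; have bw : bounded_on w by apply: bounded_onD => //; exact: bounded_onN.
rewrite /sE subr_ge0; apply: fine_le.
- by apply: exp_fin_ge0; [move=> t; rewrite le_max lexx orbT|exact/bounded_on_pos/bounded_onN].
- by apply: exp_fin_ge0; [move=> t; rewrite le_max lexx orbT|exact/bounded_on_pos].
- apply: (exp_le HE).
  + by case: (bounded_on_pos (bounded_onN bw)).
  + by case: (bounded_on_pos bw).
  + by move=> t; rewrite le_max lexx orbT.
  + by move=> t; rewrite le_max lexx orbT.
  + move=> t /uv uvt; have w0 : 0 <= w t by rewrite /w; lra.
    by rewrite (max_r (_ : - w t <= 0)) ?oppr_le0// le_max lexx orbT.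
Qed.

Lemma eq_sE u v : bounded_on u -> bounded_on v -> (forall t, P t -> u t = v t) ->
  sE E u = sE E v.
Proof.
by move=> bu bv uv; apply/eqP; rewrite eq_le; apply/andP; split; apply: le_sE => // t /uv ->.
Qed.

Lemma bounded_on_sum (I : Type) (r : seq I) (F : I -> T -> R) :
  (forall i, bounded_on (F i)) -> bounded_on (fun t => \sum_(i <- r) F i t).
Proof.
move=> bF; elim: r => [|i r IH].
  by under eq_fun do rewrite big_nil; exact: bounded_on_cst.
by under eq_fun do rewrite big_cons; exact: bounded_onD.
Qed.

Lemma sE_sum (I : Type) (r : seq I) (F : I -> T -> R) :
  (forall i, bounded_on (F i)) ->
  sE E (fun t => \sum_(i <- r) F i t) = \sum_(i <- r) sE E (F i).
Proof.
move=> bF; elim: r => [|i r IH].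
  by under eq_fun do rewrite big_nil; rewrite big_nil sE_cst.
under eq_fun do rewrite big_cons; rewrite big_cons sED ?IH//; exact: bounded_on_sum.
Qed.

End Theory.
End Expectation.

(** * Measurability and integration along trajectories *)

Section Trajectories.
Context {R : realType} {X A : countType}.
Local Notation traj := (@traj R X A).
Implicit Types (u v : traj -> \bar R) (t pref : traj).

Inductive random_traj d (O : measurableType d) : nat -> (O -> traj) -> Prop :=
| random_traj_nil : random_traj 0 (fun=> [::])
| random_traj_rcons n tau x a (f : O -> R) x' :
    random_traj n tau -> measurable_fun setT f ->
    random_traj n.+1 (fun o => rcons (tau o) (x, a, f o, x')).

(* A function of trajectories is measurable when it is so along every family of
   trajectories whose states and actions are fixed and whose rewards are
   measurable; this avoids putting a sigma-algebra on sequences of tuples. *)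
Definition tmeas v := forall d (O : measurableType d) n (tau : O -> traj),
  random_traj n tau -> measurable_fun setT (fun o => v (tau o)).

Lemma size_random_traj d (O : measurableType d) n (tau : O -> traj) o :
  random_traj n tau -> size (tau o) = n.
Proof. by elim=> {n tau} [//|n tau x a f x' _ IH _]; rewrite size_rcons IH. Qed.

Lemma random_traj_comp d1 d2 (O : measurableType d1) (O' : measurableType d2)
    (k : O' -> O) n (tau : O -> traj) :
  measurable_fun setT k -> random_traj n tau -> random_traj n (tau \o k).
Proof.
move=> mk; elim=> {n tau} [|n tau x a f x' _ IH mf]; first exact: random_traj_nil.
apply: random_traj_rcons => //; exact: measurableT_comp.
Qed.

Lemma random_traj_cst d (O : measurableType d) t : random_traj (size t) (fun _ : O => t).
Proof.
elim/last_ind: t => [|t [[[x a] r] x'] IH]; first exact: random_traj_nil.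
by rewrite size_rcons; apply: random_traj_rcons => //; exact: measurable_cst.
Qed.

Lemma tmeas_rcons v t x a x' : tmeas v ->
  measurable_fun setT (fun r : R => v (rcons t (x, a, r, x'))).
Proof.
move=> mv; apply: (mv _ _ (size t).+1 (fun r : R => rcons t (x, a, r, x'))).
by apply: random_traj_rcons; [exact: random_traj_cst|exact: measurable_id].
Qed.

Lemma tmeas_cst c : tmeas (fun=> c).
Proof. by move=> *; exact: measurable_cst. Qed.

Lemma tmeasD u v : tmeas u -> tmeas v -> tmeas (fun t => u t + v t)%E.
Proof. by move=> mu mv d O n tau h; apply: emeasurable_funD; [apply: mu h|apply: mv h]. Qed.

Lemma tmeas_comp (f : R -> R) (v : traj -> R) : measurable_fun setT f ->
  tmeas (fun t => (v t)%:E) -> tmeas (fun t => (f (v t))%:E).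
Proof.
move=> mf mv d O n tau h; apply/measurable_EFinP.
apply: (measurableT_comp mf); apply/measurable_EFinP; exact: mv h.
Qed.

Lemma tmeas_addR (u v : traj -> R) : tmeas (fun t => (u t)%:E) ->
  tmeas (fun t => (v t)%:E) -> tmeas (fun t => (u t + v t)%:E).
Proof. by move=> mu mv; have := tmeasD mu mv. Qed.

Lemma tmeas_scaleR c (u : traj -> R) : tmeas (fun t => (u t)%:E) ->
  tmeas (fun t => (c * u t)%:E).
Proof.
move=> mu; apply: (tmeas_comp (f := fun x => c * x)) => //.
by apply: measurable_funM; [exact: measurable_cst|exact: measurable_id].
Qed.

Lemma tmeas_sumrew : tmeas (fun t => (sumrew t)%:E).
Proof.
move=> d O n tau; elim=> {n tau} [|n tau x a f x' _ IH mf].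
  by under eq_fun do rewrite /sumrew big_nil; exact: measurable_cst.
have e o : sumrew (rcons (tau o) (x, a, f o, x')) = sumrew (tau o) + f o.
  by rewrite /sumrew -cats1 big_cat/= big_seq1.
under eq_fun do rewrite e; apply/measurable_EFinP; apply: measurable_funD => //.
exact/measurable_EFinP.
Qed.

Definition atstep (h : nat) (phi : tup R X A -> R) t : R :=
  if stepAt h t is Some z then phi z else 0.

Definition step_meas (phi : tup R X A -> R) :=
  forall x a x', measurable_fun setT (fun r => phi (x, a, r, x')).

Lemma stepAt_rcons h t z : stepAt h (rcons t z) =
  if (h < size t)%N then stepAt h t else if h == size t then Some z else None.
Proof. by rewrite /stepAt map_rcons nth_rcons size_map. Qed.

Lemma tmeas_atstep h phi : step_meas phi -> tmeas (fun t => (atstep h phi t)%:E).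
Proof.
move=> mphi d O n tau ht; apply/measurable_EFinP.
elim: ht => {n tau} [|n tau x a f x' ht IH mf].
  by rewrite /atstep /stepAt /=; under eq_fun do rewrite nth_nil; exact: measurable_cst.
rewrite /atstep; under eq_fun do rewrite stepAt_rcons (size_random_traj _ ht).
have [_|_] := boolP (h < n)%N; first exact: IH.
have [_|_] := boolP (h == n); last exact: measurable_cst.
exact: (measurableT_comp (mphi x a x')).
Qed.

Variable M : mdp R X A.
Local Notation H := (horizon M).

Hypothesis init_dist : is_dist (init M).
Hypothesis trans_dist : forall h x a, is_dist (trans M h x a).

Section Policy.
Variable pi : policy R X A.
Hypothesis pi_pol : is_policy pi.
Local Open Scope ereal_scope.

Let pi0 h x a : (0 <= pi h x a)%R. Proof. by case: pi_pol => /(_ h x a). Qed.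
Let tr0 h x a x' : (0 <= trans M h x a x')%R.
Proof. by case: (trans_dist h x a) => /(_ x'). Qed.

Lemma trajE_ge0 v n h x pref : (forall t, 0 <= v t) -> 0 <= trajE M pi v n h x pref.
Proof.
move=> v0; elim: n h x pref => [|n IH] h x pref //=.
apply: esum_ge0 => a _; apply: mule_ge0; rewrite ?lee_fin//.
apply: esum_ge0 => x' _; apply: mule_ge0; rewrite ?lee_fin//.
by apply: integral_ge0 => r _; exact: IH.
Qed.

Let term_ge0 v n h x a pref : (forall t, 0 <= v t) -> forall x',
  0 <= (trans M h x a x')%:E *
    \int[rew M h x a x']_(r in setT) trajE M pi v n h.+1 x' (rcons pref (x, a, r, x')).
Proof.
move=> v0 x'; apply: mule_ge0; rewrite ?lee_fin//.
by apply: integral_ge0 => r _; exact: trajE_ge0.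
Qed.

Let term2_ge0 v n h x pref : (forall t, 0 <= v t) -> forall a,
  0 <= (pi h x a)%:E * \esum_(x' in [set: X]) ((trans M h x a x')%:E *
    \int[rew M h x a x']_(r in setT) trajE M pi v n h.+1 x' (rcons pref (x, a, r, x'))).
Proof.
move=> v0 a; apply: mule_ge0; rewrite ?lee_fin//.
by apply: esum_ge0 => x' _; exact: term_ge0.
Qed.

(** The quantification of [tmeas] over all measurable spaces makes the induction close: the
    integrated reward becomes a second coordinate of the parameter, and Tonelli applies on the
    product. *)
Lemma tmeas_trajE v n h x : (forall t, 0 <= v t) -> tmeas v -> tmeas (trajE M pi v n h x).
Proof.
move=> v0 mv; elim: n h x => [|n IH] h x //= d O m tau ht.
apply: measurable_fun_esum => [a o|a].
  exact: (@term2_ge0 v n h x (tau o)).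
apply: measurable_funeM; apply: measurable_fun_esum => [x' o|x'].
  exact: (@term_ge0 v n h x a (tau o)).
apply: measurable_funeM.
pose f (z : O * R) := trajE M pi v n h.+1 x' (rcons (tau z.1) (x, a, z.2, x')).
apply: (@measurable_fun_fubini_tonelli_F _ _ O R R (rew M h x a x') f);
  last by move=> z; exact: trajE_ge0.
apply: (IH h.+1 x' _ _ m.+1 (fun z : O * R => rcons (tau z.1) (x, a, z.2, x'))).
apply: random_traj_rcons; last exact: measurable_snd.
apply: (random_traj_comp _ ht); exact: measurable_fst.
Qed.

(** In a run of the algorithm the larger function is the remaining success probability, whose
    measurability is not known. *)
Lemma le_trajE_nomeas u v n h x pref :
  (forall t, 0 <= u t) -> (forall t, 0 <= v t) ->
  (forall t, size t = (size pref + n)%N -> u t <= v t) ->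
  trajE M pi u n h x pref <= trajE M pi v n h x pref.
Proof.
move=> u0 v0; elim: n h x pref => [|n IH] h x pref uv /=.
  by apply: uv; rewrite addn0.
apply: le_esum => a _; apply: lee_pmul => //; rewrite ?lee_fin//.
  by apply: esum_ge0 => x' _; exact: term_ge0.
apply: le_esum => x' _; apply: lee_pmul => //; rewrite ?lee_fin//.
  by apply: integral_ge0 => r _; exact: trajE_ge0.
apply: ge0_le_integral_nomeas => r; first exact: trajE_ge0.
by apply: IH => t; rewrite size_rcons addSnnS; exact: uv.
Qed.

Lemma trajE_add u v n h x pref : (forall t, 0 <= u t) -> (forall t, 0 <= v t) ->
  tmeas u -> tmeas v ->
  trajE M pi (fun t => u t + v t) n h x pref =
  trajE M pi u n h x pref + trajE M pi v n h x pref.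
Proof.
move=> u0 v0 mu mv; elim: n h x pref => [|n IH] h x pref //=.
rewrite -esumD; [|by move=> a _; exact: term2_ge0..].
apply: eq_esum => a _; rewrite -muleDr// => [|//]; last first.
  by rewrite ge0_adde_def// inE; apply: esum_ge0 => x' _; exact: term_ge0.
congr (_ * _); rewrite -esumD; [|by move=> x' _; exact: term_ge0..].
apply: eq_esum => x' _; rewrite -muleDr//; last first.
  by rewrite ge0_adde_def// inE; apply: integral_ge0 => r _; exact: trajE_ge0.
congr (_ * _); rewrite -ge0_integralD//.
- by apply: eq_integral => r _; rewrite IH.
- by move=> r _; exact: trajE_ge0.
- by apply: tmeas_rcons; exact: tmeas_trajE.
- by move=> r _; exact: trajE_ge0.
- by apply: tmeas_rcons; exact: tmeas_trajE.
Qed.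

Lemma trajE_scale (c : R) u n h x pref : (forall t, 0 <= u t) -> tmeas u -> (0 <= c)%R ->
  trajE M pi (fun t => c%:E * u t) n h x pref = c%:E * trajE M pi u n h x pref.
Proof.
move=> u0 mu c0; elim: n h x pref => [|n IH] h x pref //=.
rewrite -esumZl//; last exact: term2_ge0.
apply: eq_esum => a _; rewrite [RHS]muleCA; congr (_ * _).
rewrite -esumZl//; last exact: term_ge0.
apply: eq_esum => x' _; rewrite [RHS]muleCA; congr (_ * _).
rewrite -ge0_integralZl_EFin//.
- by apply: eq_integral => r _; rewrite IH.
- by move=> r _; exact: trajE_ge0.
- by apply: tmeas_rcons; exact: tmeas_trajE.
Qed.

Lemma esum_pi_cst h x (c : R) : (0 <= c)%R ->
  \esum_(a in [set: A]) ((pi h x a)%:E * c%:E) = c%:E.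
Proof.
move=> c0; under eq_esum do rewrite muleC.
rewrite esumZl//; last by move=> a; rewrite lee_fin.
by case: pi_pol => _ ->; rewrite mule1.
Qed.

Lemma stepE_cst h x a (c : R) : (0 <= c)%R -> stepE M h x a (fun _ _ => c%:E) = c%:E.
Proof.
move=> c0; rewrite /stepE.
under eq_esum do rewrite integral_cst//= probability_setT mule1 muleC.
rewrite esumZl//; last by move=> x'; rewrite lee_fin.
by case: (trans_dist h x a) => _ ->; rewrite mule1.
Qed.

Lemma trajE_cst n h x pref (c : R) : (0 <= c)%R -> trajE M pi (fun=> c%:E) n h x pref = c%:E.
Proof.
move=> c0; elim: n h x pref => [//|n IH] h x pref /=.
rewrite -[RHS](esum_pi_cst h x c0); apply: eq_esum => a _; congr (_ * _).
rewrite -[RHS](stepE_cst h x a c0); apply: eq_esum => x' _; congr (_ * _).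
by apply: eq_integral => r _; exact: IH.
Qed.

Lemma trajE_past h phi n k x pref : (forall z, 0 <= phi z)%R -> (h < size pref)%N ->
  trajE M pi (fun t => (atstep h phi t)%:E) n k x pref = (atstep h phi pref)%:E.
Proof.
move=> phi0; elim: n k x pref => [//|n IH] k x pref hs /=.
have at0 : (0 <= atstep h phi pref)%R by rewrite /atstep; case: stepAt.
rewrite -[RHS](esum_pi_cst k x at0); apply: eq_esum => a _; congr (_ * _).
rewrite -[RHS](stepE_cst k x a at0); apply: eq_esum => x' _; congr (_ * _).
apply: eq_integral => r _; rewrite IH ?size_rcons; last exact: ltnW.
by rewrite /atstep stepAt_rcons hs.
Qed.

End Policy.
End Trajectories.

(** * Almost sure bounds on the rewards *)

Section RealProbability.
Context {R : realType}.
Variable nu : probability R R.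
Implicit Types a b y e : R.

Lemma bigcup_null (F : nat -> set R) (S : set R) : measurable S ->
  (forall n, measurable (F n)) -> S `<=` \bigcup_n F n ->
  (forall n, nu (F n) = 0%E) -> nu S = 0%E.
Proof.
move=> mS mF SF F0; apply: measure_negligible => //.
apply: (negligibleS SF); apply: negligible_bigcup => n; exists (F n); split => //.
exact: F0.
Qed.

(** The intervals of length [e] centred at the rationals cover the line, so they cannot all be
    null. *)
Lemma probability_short_itv e : 0 < e ->
  exists a b, b - a <= e /\ (0 < nu `]a, b[%classic)%E.
Proof.
move=> e0; apply: contrapT => h.
suff /eqP : nu setT = 0%E by rewrite probability_setT onee_eq0.
pose c n : R := ratr (odflt 0 (@unpickle rat n)).
apply: (@bigcup_null (fun n => `]c n - e / 2, c n + e / 2[%classic)).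
- exact: measurableT.
- by move=> n; exact: measurable_itv.
- move=> x _; have [|q] := @rat_in_itvoo R (x - e / 2) (x + e / 2); first lra.
  rewrite in_itv/= => qx; exists (pickle q) => //=.
  by rewrite in_itv/= /c pickleK/=; lra.
- move=> n; apply/eqP; rewrite -measure_le0 leNgt; apply/negP => nu0; apply: h.
  by exists (c n - e / 2), (c n + e / 2); split => //; lra.
Qed.

Lemma probability_bounded_below b : (0 < nu `]-oo, b[%classic)%E ->
  exists a, (0 < nu `]a, b[%classic)%E.
Proof.
move=> nu0; apply: contrapT => h; move: nu0; apply/negP; rewrite -leNgt measure_le0.
apply/eqP; apply: (@bigcup_null (fun n => `]- n%:R, b[%classic)).
- exact: measurable_itv.
- by move=> n; exact: measurable_itv.
- move=> x /=; rewrite in_itv/= => xb; exists (Num.truncn `|x|).+1 => //=.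
  rewrite in_itv/= xb andbT ltrNl.
  by apply: le_lt_trans (truncnS_gt _); rewrite -normrN ler_norm.
- move=> n; apply/eqP; rewrite -measure_le0 leNgt; apply/negP => nu0.
  by apply: h; exists (- n%:R).
Qed.

Lemma probability_bounded_above a : (0 < nu `]a, +oo[%classic)%E ->
  exists b, (0 < nu `]a, b[%classic)%E.
Proof.
move=> nu0; apply: contrapT => h; move: nu0; apply/negP; rewrite -leNgt measure_le0.
apply/eqP; apply: (@bigcup_null (fun n => `]a, n%:R[%classic)).
- exact: measurable_itv.
- by move=> n; exact: measurable_itv.
- move=> x /=; rewrite in_itv/= andbT => xb; exists (Num.truncn `|x|).+1 => //=.
  by rewrite in_itv/= xb/=; apply: le_lt_trans (truncnS_gt _); rewrite ler_norm.
- move=> n; apply/eqP; rewrite -measure_le0 leNgt; apply/negP => nu0.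
  by apply: h; exists (n%:R).
Qed.

Lemma ae_ge y : (forall b, b < y -> nu `]-oo, b[%classic = 0%E) ->
  {ae nu, forall r, y <= r}.
Proof.
move=> h; exists `]-oo, y[%classic; split; first exact: measurable_itv.
  apply: (@bigcup_null (fun n => `]-oo, y - n.+1%:R^-1[%classic)).
  - exact: measurable_itv.
  - by move=> n; exact: measurable_itv.
  - move=> x /=; rewrite in_itv/= => xy.
    have [n] := ltr_add_invr xy; move=> hn.
    by exists n => //=; rewrite in_itv/= ltrBrDr.
  - by move=> n; apply: h; rewrite ltrBlDr ltrDl invr_gt0.
by move=> r /=; rewrite in_itv/= => /negP; rewrite -ltNge.
Qed.

Lemma ae_le y : (forall b, y < b -> nu `]b, +oo[%classic = 0%E) ->
  {ae nu, forall r, r <= y}.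
Proof.
move=> h; exists `]y, +oo[%classic; split; first exact: measurable_itv.
  apply: (@bigcup_null (fun n => `]y + n.+1%:R^-1, +oo[%classic)).
  - exact: measurable_itv.
  - by move=> n; exact: measurable_itv.
  - move=> x /=; rewrite in_itv/= andbT => xy.
    have [n] := ltr_add_invr xy; move=> hn.
    by exists n => //=; rewrite in_itv/= andbT.
  - by move=> n; apply: h; rewrite ltrDl invr_gt0.
by move=> r /=; rewrite in_itv/= andbT => /negP; rewrite -ltNge.
Qed.

End RealProbability.

Section Rewards.
Context {R : realType} {X A : countType}.
Variable M : mdp R X A.
Local Notation H := (horizon M).
Hypothesis wf : wf_mdp M.

Let trans_dist : forall h x a, is_dist (trans M h x a). Proof. by case: wf => _ []. Qed.
Let tr0 h x a x' : 0 <= trans M h x a x'. Proof. by case: (trans_dist h x a) => /(_ x'). Qed.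
Let in0 x : 0 <= init M x. Proof. by case: wf => -[/(_ x)]. Qed.

Lemma step_expectation h x a (P : R * X -> Prop) :
  (forall x', 0 < trans M h x a x' -> {ae rew M h x a x', forall r, P (r, x')}) ->
  is_expectation (fun g => stepE M h x a (fun r x' => g (r, x')))
    (fun u => forall x', measurable_fun setT (fun r => u (r, x'))) P.
Proof.
move=> aeP; have mE (u : R * X -> R) : (forall x', measurable_fun setT (fun r => u (r, x'))) ->
    forall x', measurable_fun setT (fun r => (u (r, x'))%:E).
  by move=> mu x'; exact/measurable_EFinP.
split=> [c x'|u v mu mv x'|c u mu x'|u mu x'|u v mu mv u0 v0 uv|u v mu mv u0 v0|c u mu u0 c0|].
- exact: measurable_cst.
- exact: measurable_funD.
- by apply: measurable_funM => //; exact: measurable_cst.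
- by apply: measurable_maxr => //; exact: measurable_cst.
- apply: le_esum => x' _.
  have := tr0 h x a x'; rewrite le_eqVlt => /predU1P[<-|t0]; first by rewrite !mul0e.
  rewrite lee_pmul2l// ?lte_fin//; apply: ae_ge0_le_integral => //.
  + by move=> r _; rewrite lee_fin.
  + exact: mE.
  + by move=> r _; rewrite lee_fin.
  + exact: mE.
  + have := aeP x' t0; apply: filterS => r Pr _; rewrite lee_fin; exact: uv.
- rewrite /stepE -esumD => [|x' _|x' _]; last 2 first.
  + by apply: mule_ge0; rewrite ?lee_fin//; apply: integral_ge0 => r _; rewrite lee_fin.
  + by apply: mule_ge0; rewrite ?lee_fin//; apply: integral_ge0 => r _; rewrite lee_fin.
  apply: eq_esum => x' _; under eq_integral do rewrite EFinD.
  rewrite ge0_integralD//; first last.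
  + exact: mE.
  + by move=> r _; rewrite lee_fin.
  + exact: mE.
  + by move=> r _; rewrite lee_fin.
  rewrite muleDr// ge0_adde_def// inE; apply: integral_ge0 => r _; rewrite lee_fin//.
- rewrite /stepE -esumZl//; last first.
    by move=> x'; apply: mule_ge0; rewrite ?lee_fin//; apply: integral_ge0 => r _; rewrite lee_fin.
  apply: eq_esum => x' _; rewrite [RHS]muleCA; congr (_ * _)%E.
  rewrite -ge0_integralZl_EFin//; first by move=> r _; rewrite lee_fin.
  exact: mE.
- exact: stepE_cst.
Qed.

Lemma steps_sE h x a (g : R * X -> R) : stepS M h x a (fun r x' => g (r, x')) =
  sE (fun g => stepE M h x a (fun r x' => g (r, x'))) g.
Proof. by []. Qed.

(* With positive probability the rewards collected before reaching [x] at step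
   [h] sum up to a value in [lo, hi]. *)
Inductive reach : nat -> X -> R -> R -> Prop :=
| reach0 x : 0 < init M x -> reach 0 x 0 0
| reachS h x lo hi a x' p q : reach h x lo hi -> 0 < trans M h x a x' ->
    (0 < rew M h x a x' `]p, q[%classic)%E -> reach h.+1 x' (lo + p) (hi + q).

Inductive sreach : nat -> X -> Prop :=
| sreach0 x : 0 < init M x -> sreach 0 x
| sreachS h x a x' : sreach h x -> 0 < trans M h x a x' -> sreach h.+1 x'.

(** The widths of the reward intervals add up along the path; half of [e] goes to the prefix and
    half to the last reward. *)
Lemma sreach_reach h x e : sreach h x -> 0 < e ->
  exists lo hi, reach h x lo hi /\ hi - lo <= e.
Proof.
move=> hx; elim: hx e => {h x} [x x0|h x a x' _ IH t0] e e0.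
  by exists 0, 0; split; [exact: reach0|lra].
have [|lo [hi [hr le]]] := IH (e / 2); first lra.
have [|p [q [pq nu0]]] := @probability_short_itv _ (rew M h x a x') (e / 2); first lra.
by exists (lo + p), (hi + q); split; [exact: reachS nu0|lra].
Qed.

Let bad (t : @traj R X A) : \bar R := (~~ ((0 <= sumrew t) && (sumrew t <= 1)))%:R%:E.
Let out (s lo hi : R) := s + hi < 0 \/ 1 < s + lo.

Let bad0 t : (0 <= bad t)%E. Proof. by rewrite lee_fin. Qed.

Lemma detpol_policy (g : nat -> X -> A) : is_policy (@detpol R X A g).
Proof.
split=> [h x a|h x]; first by rewrite /detpol; case: ifP.
rewrite (@esum_single _ _ _ (g h x)) => [||a /negbTE ag]; rewrite /detpol ?eqxx//.
  by move=> a; case: ifP.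
by rewrite ag.
Qed.

(* Extend the prefix by an open-loop sequence of actions [acts]: a suffix along
   which the total leaves [0, 1] would contradict [wf]. *)
Lemma reach_contra h x lo hi : reach h x lo hi -> forall n lo' hi', (h + n)%N = H ->
  (exists acts e, 0 < e /\ forall pi, is_policy pi ->
    (forall k y, (h <= k)%N -> pi k y = detpol R (fun k _ => acts k) k y) ->
    forall pref, out (sumrew pref) lo' hi' -> (e%:E <= trajE M pi bad n h x pref)%E) ->
  ~ out 0 (lo + lo') (hi + hi').
Proof.
elim=> {h x lo hi} [x x0|h x lo hi a x' p q _ IH t0 nu0] n lo' hi' hn [acts [e [e0 he]]] ho.
  case: wf => _ [_ /(_ _ (detpol_policy (fun k _ => acts k))) E0].
  suff : (0 < Eexp M (detpol R (fun k _ => acts k)) bad)%E by rewrite E0 ltxx.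
  rewrite add0n in hn; rewrite !add0r in ho.
  apply: (@lt_le_trans _ _ ((init M x)%:E * e%:E)%E); first by rewrite -EFinM lte_fin mulr_gt0.
  rewrite /Eexp; pose F y := ((init M y)%:E * trajE M (detpol R (fun k _ => acts k)) bad H 0 y [::])%E.
  apply: (le_trans _ (@esum_ge_term _ _ F x _)).
    apply: lee_pmul; rewrite ?lee_fin// ?(ltW e0)//.
    rewrite -hn; apply: he => //; first exact: detpol_policy.
    by rewrite /sumrew big_nil.
  move=> y; apply: mule_ge0; rewrite ?lee_fin//; apply: trajE_ge0 => //; exact: detpol_policy.
apply: (IH n.+1 (p + lo') (q + hi')); [by rewrite addnS -addSn| |by rewrite !addrA].
have nuf : rew M h x a x' `]p, q[%classic \is a fin_num by exact: fin_num_measure.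
pose nu := fine (rew M h x a x' `]p, q[%classic).
have nu0' : 0 < nu by rewrite fine_gt0// nu0/= -ge0_fin_numE.
(* The last step passes from the prefix to the suffix: its action is put in front, and the lower
   bound is multiplied by the probabilities of the transition and of the reward interval. *)
exists (fun k => if k == h then a else acts k), (trans M h x a x' * (e * nu)); split.
  by rewrite !mulr_gt0.
move=> pi pip hpi pref hpref /=.
have b0 k y pf : (0 <= trajE M pi bad n k y pf)%E by apply: trajE_ge0.
have i0 b y : (0 <= (trans M h x b y)%:E * \int[rew M h x b y]_(r in setT)
    trajE M pi bad n h.+1 y (rcons pref (x, b, r, y)))%E.
  by apply: mule_ge0; rewrite ?lee_fin//; exact: integral_ge0.
have pi0 b : 0 <= pi h x b by case: pip => /(_ h x b).
pose F b := ((pi h x b)%:E * \esum_(y in [set: X]) ((trans M h x b y)%:E *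
  \int[rew M h x b y]_(r in setT) trajE M pi bad n h.+1 y (rcons pref (x, b, r, y))))%E.
apply: (le_trans _ (@esum_ge_term _ _ F a _)); last first.
  by move=> b; apply: mule_ge0; rewrite ?lee_fin//; apply: esum_ge0.
rewrite /F hpi// /detpol !eqxx mul1e.
apply: (le_trans _ (esum_ge_term x' (i0 a))).
rewrite EFinM lee_pmul// ?lee_fin ?(ltW (mulr_gt0 _ _))//.
apply: (@le_trans _ _ (\int[rew M h x a x']_(r in setT) (e%:E * (\1_`]p, q[%classic r)%:E))%E).
  rewrite ge0_integralZl_EFin ?(ltW e0)//; last first.
    by apply/measurable_EFinP; exact: measurable_indic.
  by rewrite integral_indic// setIT EFinM /nu fineK.
apply: ge0_le_integral_nomeas => r; first by rewrite mule_ge0 ?lee_fin ?(ltW e0).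
rewrite indicE; case: (boolP (r \in _)) => [|_]; last by rewrite mule0.
rewrite inE /= in_itv/= => /andP[pr rq]; rewrite mule1; apply: he => //.
  move=> k y hk; rewrite hpi; last exact: ltnW.
  by rewrite /detpol; case: eqP => // kh; move: hk; rewrite kh ltnn.
by move: hpref; rewrite /out /sumrew -cats1 big_cat/= big_seq1/=; case; [left|right]; lra.
Qed.

Variable a0 : A.

Lemma reach_end x lo hi : reach H x lo hi -> 0 <= hi /\ lo <= 1.
Proof.
move=> hr; have h : ~ out 0 (lo + 0) (hi + 0).
  apply: (reach_contra hr (n := 0%N)); first by rewrite addn0.
  (* With no step left the total already lies outside [0, 1], so the bad event is certain. *)
  exists (fun=> a0), 1; split => // pi _ _ pref ho.
  by rewrite /= /bad lee_fin; move: ho; rewrite /out !addr0 => -[s|s];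
    [rewrite (leNgt 0) s|rewrite (leNgt _ 1) s andbF].
by split; rewrite leNgt; apply/negP => l; apply: h; rewrite /out; [left|right]; lra.
Qed.

(* To be applied to the optimal value function [v] and its greedy policy [b]. *)
Variables (v : nat -> X -> R) (b : nat -> X -> A).
Hypothesis v01 : forall h x, 0 <= v h x <= 1.
Hypothesis vH : forall x, v H x = 0.
Hypothesis vE : forall h x, (h < H)%N ->
  v h x = stepS M h x (b h x) (fun r x' => r + v h.+1 x').

(** A violation of positive probability would contain a bounded reward interval of positive
    probability; appending it to the prefix contradicts the bounds at the next step. *)
Lemma reach_ae h x lo hi a x' :
  (forall y lo hi, reach h.+1 y lo hi -> 0 <= hi + v h.+1 y /\ lo + v h.+1 y <= 1) ->
  reach h x lo hi -> 0 < trans M h x a x' ->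
  {ae rew M h x a x', forall r, - hi <= r + v h.+1 x' <= 1 - lo}.
Proof.
move=> IH hr t0.
have l : {ae rew M h x a x', forall r, - hi - v h.+1 x' <= r}.
  apply: ae_ge => q hq; apply/eqP; rewrite -measure_le0 leNgt; apply/negP => nu0.
  have [p nu1] := probability_bounded_below nu0.
  by have [] := IH _ _ _ (reachS hr t0 nu1); lra.
have u : {ae rew M h x a x', forall r, r <= 1 - lo - v h.+1 x'}.
  apply: ae_le => p hp; apply/eqP; rewrite -measure_le0 leNgt; apply/negP => nu0.
  have [q nu1] := probability_bounded_above nu0.
  by have [] := IH _ _ _ (reachS hr t0 nu1); lra.
by apply: filterS2 l u => r rl ru; lra.
Qed.

(** Backward induction from the horizon: the almost sure bounds on [r + v h.+1 x'] pass to its mean,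
    which is [v h x] by the Bellman equation. *)
Lemma reach_value k : forall h x lo hi, (h + k)%N = H -> reach h x lo hi ->
  0 <= hi + v h x /\ lo + v h x <= 1.
Proof.
elim: k => [|k IH] h x lo hi hk hr.
  by move: hk hr; rewrite addn0 => ->; rewrite vH !addr0; exact: reach_end.
have hH : (h < H)%N by rewrite -hk; lia.
have ae x' := @reach_ae h x lo hi (b h x) x' (fun y l u => IH _ y l u (etrans (addSnnS h k) hk)) hr.
pose P (z : R * X) := - hi <= z.1 + v h.+1 z.2 <= 1 - lo.
have HE := @step_expectation h x (b h x) P ae.
have bu : bounded_on (fun u : R * X -> R => forall x', measurable_fun setT (fun r => u (r, x'))) P
    (fun z => z.1 + v h.+1 z.2).
  split; first by move=> x' /=; apply: measurable_funD; [exact: measurable_id|exact: measurable_cst].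
  exists (`|hi| + `|1 - lo|) => z /andP[l u].
  have := ler_norm hi; have := ler_norm (1 - lo); have := normr_ge0 hi; have := normr_ge0 (1 - lo).
  by rewrite ler_norml; lra.
rewrite vE// (steps_sE h x (b h x) (fun z => z.1 + v h.+1 z.2)).
have bc c := bounded_on_cst HE c.
split.
  have := le_sE HE (bc (- hi)) bu; rewrite (sE_cst HE) => /(_ _); move=> w.
  by have := w (fun z h => proj1 (andP h)); lra.
have := le_sE HE bu (bc (1 - lo)); rewrite (sE_cst HE) => w.
by have := w (fun z h => proj2 (andP h)); lra.
Qed.

(** Take a prefix interval of width at most 1. As [v] is in [0, 1], [hi >= -1] and [lo <= 1], hence
    [hi <= 2] and [lo >= -2]. Then the reward plus the next value lies in [-2, 3], and removing that
    value leaves [-3, 3]. *)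
Lemma reward_bound h x a x' : (h < H)%N -> sreach h x -> 0 < trans M h x a x' ->
  {ae rew M h x a x', forall r, `|r| <= 3}.
Proof.
move=> hH hx t0; have [//|lo [hi [hr le]]] := sreach_reach hx (e := 1).
have [k hk] : exists k, (h.+1 + k)%N = H by exists (H - h.+1)%N; lia.
have IH y l u := @reach_value k h.+1 y l u hk.
have := reach_value (etrans (esym (addSnnS h k)) hk) hr => -[h1 h2].
have v0 := v01 h x; have v1 := v01 h.+1 x'.
by apply: filterS (reach_ae IH hr t0) => r hr'; rewrite ler_norml; lra.
Qed.

End Rewards.

(** * Occupancy measures and the performance difference *)

Section Mean.
Context {R : realType} {T : choiceType}.
Implicit Types (p : T -> R) (u : T -> R).

Definition dist_exp p (w : T -> \bar R) : \bar R := \esum_(t in [set: T]) ((p t)%:E * w t)%E.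
Definition mean p u : R := sE (dist_exp p) u.
Definition allfun (u : T -> R) : Prop := True.

Lemma dist_expectation p : is_dist p -> is_expectation (dist_exp p) allfun (fun t => p t != 0).
Proof.
move=> [p0 p1]; split=> // [u v _ _ u0 v0 uv|u v _ _ u0 v0|c u _ u0 c0|].
- apply: le_esum => t _; have [->|pt] := eqVneq (p t) 0; first by rewrite !mul0e.
  by rewrite -!EFinM lee_fin ler_wpM2l// uv.
- rewrite /dist_exp -esumD; [|by move=> t _; rewrite mule_ge0// lee_fin..].
  by apply: eq_esum => t _; rewrite EFinD muleDr// ge0_adde_def// inE lee_fin.
- rewrite /dist_exp -esumZl//; last by move=> t; rewrite mule_ge0// lee_fin.
  by apply: eq_esum => t _; rewrite EFinM muleCA.
- by rewrite /dist_exp -[RHS]p1; apply: eq_esum => t _; rewrite mule1.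
Qed.

End Mean.

Section Occupancy.
Context {R : realType} {X A : countType}.
Variable M : mdp R X A.
Local Notation H := (horizon M).
Hypothesis wf : wf_mdp M.
Hypothesis reward3 : forall h x a x', (h < H)%N -> sreach M h x -> 0 < trans M h x a x' ->
  {ae rew M h x a x', forall r, `|r| <= 3}.

Let init_dist : is_dist (init M). Proof. by case: wf. Qed.
Let trans_dist : forall h x a, is_dist (trans M h x a). Proof. by case: wf => _ []. Qed.
Let tr0 h x a x' : 0 <= trans M h x a x'. Proof. by case: (trans_dist h x a) => /(_ x'). Qed.
Let in0 x : 0 <= init M x. Proof. by case: init_dist => /(_ x). Qed.

Definition reward3_step (z : R * X) := `|z.1| <= 3.

Lemma reward3_expectation h x a : (h < H)%N -> sreach M h x ->
  is_expectation (fun g => stepE M h x a (fun r x' => g (r, x')))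
    (fun u : R * X -> R => forall x', measurable_fun setT (fun r => u (r, x'))) reward3_step.
Proof.
by move=> hH hx; apply: (step_expectation wf) => x' t0; apply: filterS (reward3 hH hx t0).
Qed.

Section Policy.
Variable pi : policy R X A.
Hypothesis pi_pol : is_policy pi.
Let pi0 h x a : 0 <= pi h x a. Proof. by case: pi_pol => /(_ h x a). Qed.

Definition reward3_traj (t : @traj R X A) : Prop :=
  size t = H /\ forall h z, stepAt h t = Some z -> `|z.1.2| <= 3.

(** The almost sure comparison at each level discards the rewards above 3 in absolute value; unlike
    [le_trajE_nomeas] it asks for measurable integrands. *)
Lemma trajE_le_ae u v n h x pref : (h + n)%N = H -> sreach M h x ->
  (forall t, 0 <= u t)%E -> (forall t, 0 <= v t)%E -> tmeas u -> tmeas v ->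
  (forall t, reward3_traj t -> u t <= v t)%E ->
  size pref = h -> (forall k z, stepAt k pref = Some z -> `|z.1.2| <= 3) ->
  (trajE M pi u n h x pref <= trajE M pi v n h x pref)%E.
Proof.
move=> hn hx u0 v0 mu mv uv; elim: n h x pref hn hx => [|n IH] h x pref hn hx sp bp /=.
  by apply: uv; split => //; rewrite sp -hn addn0.
have i0 w (w0 : forall t, (0 <= w t)%E) a x' : (0 <= \int[rew M h x a x']_(r in setT)
    trajE M pi w n h.+1 x' (rcons pref (x, a, r, x')))%E.
  by apply: integral_ge0 => r _; exact: trajE_ge0.
apply: le_esum => a _; apply: lee_pmul => //; rewrite ?lee_fin//.
  by apply: esum_ge0 => x' _; apply: mule_ge0; rewrite ?lee_fin// i0.
apply: le_esum => x' _; have := tr0 h x a x'.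
rewrite le_eqVlt => /predU1P[<-|t0]; first by rewrite !mul0e.
rewrite lee_pmul2l// ?lte_fin//; apply: ae_ge0_le_integral => //.
- by move=> r _; exact: trajE_ge0.
- by apply: tmeas_rcons; exact: tmeas_trajE.
- by move=> r _; exact: trajE_ge0.
- by apply: tmeas_rcons; exact: tmeas_trajE.
have hH : (h < H)%N by lia.
apply: filterS (reward3 hH hx t0) => r r3 _; apply: IH.
- by rewrite addSnnS.
- exact: sreachS hx t0.
- by rewrite size_rcons sp.
- move=> k z; rewrite stepAt_rcons; case: ifP => _; first exact: bp.
  by case: ifP => // _ [<-].
Qed.

Let Ms (u : @traj R X A -> R) := tmeas (fun t => (u t)%:E).

Lemma traj_expectation : is_expectation (Eexp M pi) Ms reward3_traj.
Proof.
have E0 w x (w0 : forall t, (0 <= w t)%E) :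
    (0 <= (init M x)%:E * trajE M pi w H 0 x [::])%E.
  by apply: mule_ge0; rewrite ?lee_fin//; exact: trajE_ge0.
split=> [c|u v mu mv|c u mu|u mu|u v mu mv u0 v0 uv|u v mu mv u0 v0|c u mu u0 c0|].
- exact: tmeas_cst.
- exact: tmeas_addR.
- exact: tmeas_scaleR.
- apply: (tmeas_comp (f := fun x => Num.max x 0)) => //.
  by apply: measurable_maxr; [exact: measurable_id|exact: measurable_cst].
- apply: le_esum => x _; have := in0 x.
  rewrite le_eqVlt => /predU1P[<-|i0]; first by rewrite !mul0e.
  rewrite lee_pmul2l// ?lte_fin//; apply: trajE_le_ae => //.
  + exact: sreach0.
  + by move=> k z; rewrite /stepAt nth_nil.
- rewrite /Eexp -esumD => [|x _|x _]; [|by apply: E0 => t; rewrite lee_fin..].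
  apply: eq_esum => x _; rewrite -muleDr//.
    by rewrite -trajE_add// => t; rewrite lee_fin.
  by rewrite ge0_adde_def// inE; apply: trajE_ge0 => // t; rewrite lee_fin.
- rewrite /Eexp -esumZl//; last by move=> x; apply: E0 => t; rewrite lee_fin.
  apply: eq_esum => x _; rewrite [RHS]muleCA; congr (_ * _)%E.
  by rewrite -trajE_scale// => t; rewrite lee_fin.
- have [_ i1] := init_dist; rewrite -[RHS]i1; apply: eq_esum => x _.
  by rewrite trajE_cst// mule1.
Qed.

(** State distribution at step [h], by forward recursion; [occ] is defined by nested expectations
    over whole trajectories, and [occE] reconciles the two. *)
Fixpoint sd (h : nat) (x : X) : R :=
  if h is h'.+1 then
    fine (\esum_(y in [set: X]) \esum_(a in [set: A]) (sd h' y * pi h' y a * trans M h' y a x)%:E)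
  else init M x.

Lemma sd_dist h : is_dist (sd h).
Proof.
elim: h => [|h [IH0 IH1]]; first exact: init_dist.
have p0 y a x : (0 <= (sd h y * pi h y a * trans M h y a x)%:E)%E.
  by rewrite lee_fin !mulr_ge0.
have s1 : \esum_(x in [set: X]) \esum_(y in [set: X]) \esum_(a in [set: A])
    (sd h y * pi h y a * trans M h y a x)%:E = 1%E.
  rewrite esum_swap; last by move=> x y; exact: esum_ge0.
  rewrite -[RHS]IH1; apply: eq_esum => y _; rewrite esum_swap//.
  rewrite -[RHS](mule1); case: pi_pol => _ /(_ h y) <-.
  rewrite -esumZl//; last by move=> a; rewrite lee_fin.
  apply: eq_esum => a _; under eq_esum do rewrite EFinM.
  rewrite esumZl ?mulr_ge0//; last by move=> x; rewrite lee_fin.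
  by case: (trans_dist h y a) => _ ->; rewrite mule1 EFinM.
have fin x : \esum_(y in [set: X]) \esum_(a in [set: A])
    (sd h y * pi h y a * trans M h y a x)%:E \is a fin_num.
  rewrite ge0_fin_numE; last by apply: esum_ge0 => y _; exact: esum_ge0.
  apply: (@le_lt_trans _ _ 1%E); last exact: ltry.
  rewrite -s1; apply: (esum_ge_term (a := fun x => \esum_(y in [set: X]) \esum_(a in [set: A])
    (sd h y * pi h y a * trans M h y a x)%:E)) => y.
  by apply: esum_ge0 => *; exact: esum_ge0.
split=> [x|]; first by rewrite fine_ge0//; apply: esum_ge0 => y _; exact: esum_ge0.
by rewrite -[RHS]s1; apply: eq_esum => x _; rewrite /= fineK.
Qed.

Lemma sdS h x : (sd h.+1 x)%:E =
  \esum_(y in [set: X]) \esum_(a in [set: A]) (sd h y * pi h y a * trans M h y a x)%:E.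
Proof.
have [s0 s1] := sd_dist h.+1; have [t0 _] := sd_dist h.
have p0 : (0 <= \esum_(y in [set: X]) \esum_(a in [set: A]) (sd h y * pi h y a * trans M h y a x)%:E)%E.
  by apply: esum_ge0 => y _; apply: esum_ge0 => a _; rewrite lee_fin !mulr_ge0.
rewrite /= fineK// ge0_fin_numE// ltNge leye_eq; apply/negP => /eqP e.
have [_ sh1] := sd_dist h; move: e; apply/eqP; rewrite lt_eqF//.
apply: (@le_lt_trans _ _ 1%E); last exact: ltry.
rewrite -sh1; apply: le_esum => y _.
apply: (@le_trans _ _ (\esum_(a in [set: A]) ((sd h y)%:E * (pi h y a)%:E))%E).
  apply: le_esum => a _; rewrite -EFinM lee_fin ler_piMr ?mulr_ge0//.
  case: (trans_dist h y a) => tt0 tt1; rewrite -lee_fin -tt1.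
  by apply: (esum_ge_term (a := fun z => (trans M h y a z)%:E)) => z; rewrite lee_fin.
rewrite esumZl//; last by move=> a; rewrite lee_fin.
by case: pi_pol => _ ->; rewrite mule1.
Qed.

Lemma sd_sreach h x : sd h x != 0 -> sreach M h x.
Proof.
elim: h x => [|h IH] x /= hx; first by apply: sreach0; rewrite lt_neqAle eq_sym hx in0.
apply: contrapT => nr; move/eqP: hx; apply.
rewrite esum1// => y _; apply: esum1 => a _; congr EFin.
have [->|sy] := eqVneq (sd h y) 0; first by rewrite !mul0r.
have [->|ty] := eqVneq (trans M h y a x) 0; first by rewrite mulr0.
by exfalso; apply: nr; apply: (sreachS (IH _ sy) (a := a)); rewrite lt_neqAle eq_sym ty tr0.
Qed.

Section Step.
Variables (h : nat) (phi : tup R X A -> R).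
Hypothesis phi0 : forall z, 0 <= phi z.
Let S k x a := stepE M k x a (fun r x' => (phi (x, a, r, x'))%:E).

Let S0 k x a : (0 <= S k x a)%E.
Proof.
apply: esum_ge0 => x' _; apply: mule_ge0; rewrite ?lee_fin//.
by apply: integral_ge0 => r _; rewrite lee_fin.
Qed.

(** Expectation of [phi] at step [h] given the state [x] at step [k = h - m], by backward
    recursion. *)
Fixpoint step_value (m k : nat) (x : X) : \bar R :=
  if m is m'.+1 then \esum_(a in [set: A]) ((pi k x a)%:E *
    \esum_(x' in [set: X]) ((trans M k x a x')%:E * step_value m' k.+1 x'))%E
  else \esum_(a in [set: A]) ((pi k x a)%:E * S k x a)%E.

Lemma step_value_ge0 m k x : (0 <= step_value m k x)%E.
Proof.
elim: m k x => [|m IH] k x /=; apply: esum_ge0 => a _; apply: mule_ge0; rewrite ?lee_fin//.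
by apply: esum_ge0 => x' _; apply: mule_ge0; rewrite ?lee_fin.
Qed.

Lemma trajE_future m n k x pref : size pref = k -> (k + m)%N = h ->
  trajE M pi (fun t => (atstep h phi t)%:E) (m + n).+1 k x pref = step_value m k x.
Proof.
elim: m k x pref => [|m IH] k x pref sp kh.
  rewrite /= add0n; apply: eq_esum => a _; congr (_ * _)%E.
  apply: eq_esum => x' _; congr (_ * _)%E; apply: eq_integral => r _.
  rewrite trajE_past//; last by rewrite size_rcons sp -kh addn0.
  by rewrite /atstep stepAt_rcons sp -kh addn0 ltnn eqxx.
rewrite addSn; apply: eq_esum => a _; congr (_ * _)%E.
apply: eq_esum => x' _; congr (_ * _)%E.
rewrite (eq_integral (fun=> step_value m k.+1 x')) => [|r _].
  by rewrite integral_cst// [X in (_ * X)%E]probability_setT mule1.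
by rewrite -(IH k.+1 x' (rcons pref (x, a, r, x')))// ?size_rcons ?sp// addSnnS.
Qed.

(** The forward recursion [sd] and the backward recursion [step_value] are adjoint: both sides sum
    over the same transitions. Iterating moves all the steps before [h] onto [sd]. *)
Lemma sd_step_value m k : \esum_(x in [set: X]) ((sd k x)%:E * step_value m.+1 k x)%E =
  \esum_(x in [set: X]) ((sd k.+1 x)%:E * step_value m k.+1 x)%E.
Proof.
have s0 x : 0 <= sd k x by case: (sd_dist k).
have q0 y a x : 0 <= sd k y * pi k y a * trans M k y a x by rewrite !mulr_ge0.
transitivity (\esum_(y in [set: X]) \esum_(x in [set: X]) \esum_(a in [set: A])
    ((sd k y * pi k y a * trans M k y a x)%:E * step_value m k.+1 x)%E).
  apply: eq_esum => y _; rewrite esum_swap; last first.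
    by move=> *; apply: mule_ge0; rewrite ?lee_fin ?step_value_ge0.
  rewrite -esumZl//; last first.
    move=> a; apply: mule_ge0; rewrite ?lee_fin//.
    by apply: esum_ge0 => *; apply: mule_ge0; rewrite ?lee_fin ?step_value_ge0.
  apply: eq_esum => a _; rewrite muleA -EFinM -esumZl ?mulr_ge0//; last first.
    by move=> x; apply: mule_ge0; rewrite ?lee_fin ?step_value_ge0.
  by apply: eq_esum => x _; rewrite muleA -EFinM.
rewrite esum_swap; last first.
  by move=> *; apply: esum_ge0 => *; apply: mule_ge0; rewrite ?lee_fin ?step_value_ge0.
apply: eq_esum => x _; rewrite sdS -esumZr ?step_value_ge0//; last first.
  by move=> y; apply: esum_ge0 => a _; rewrite lee_fin.
by apply: eq_esum => y _; rewrite -esumZr ?step_value_ge0// => a; rewrite lee_fin.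
Qed.

Lemma Eexp_step : (h < H)%N -> Eexp M pi (fun t => (atstep h phi t)%:E) =
  \esum_(x in [set: X]) \esum_(a in [set: A]) ((sd h x * pi h x a)%:E * S h x a)%E.
Proof.
move=> hH; transitivity (\esum_(x in [set: X]) ((sd 0 x)%:E * step_value h 0 x)%E).
  apply: eq_esum => x _; congr (_ * _)%E.
  by rewrite -(@trajE_future h (H - h.+1) 0 x [::])// -addnS -subSn// subSS subnKC// ltnW.
have step k : (k <= h)%N -> \esum_(x in [set: X]) ((sd 0 x)%:E * step_value h 0 x)%E =
    \esum_(x in [set: X]) ((sd k x)%:E * step_value (h - k) k x)%E.
  elim: k => [|k IH] kh; first by rewrite subn0.
  by rewrite IH ?(ltnW kh)// (_ : h - k = (h - k.+1).+1)%N ?sd_step_value//; lia.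
rewrite (step h)// subnn; apply: eq_esum => x _ /=.
have s0 : 0 <= sd h x by case: (sd_dist h).
rewrite -esumZl//; last by move=> a; rewrite mule_ge0// lee_fin.
by apply: eq_esum => a _; rewrite muleA -EFinM.
Qed.

End Step.

Lemma occE h x a : (h < H)%N -> occ M pi h (x, a) = sd h x * pi h x a.
Proof.
move=> hH; rewrite /occ.
pose phi (z : tup R X A) : R := (z.1.1 == (x, a))%:R.
rewrite (_ : (fun t => _) = (fun t => (atstep h phi t)%:E)); last first.
  by apply/funext => t; rewrite /atstep; case: stepAt.
have phi0 z : 0 <= phi z by [].
rewrite Eexp_step//.
have s0 y : 0 <= sd h y by case: (sd_dist h).
have E0 y b : (0 <= ((sd h y * pi h y b)%:E *
   stepE M h y b (fun r x' => (phi (y, b, r, x'))%:E))%E)%E.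
  apply: mule_ge0; rewrite ?lee_fin ?mulr_ge0//; apply: esum_ge0 => x' _.
  by apply: mule_ge0; rewrite ?lee_fin//; apply: integral_ge0 => r _; rewrite lee_fin.
have e y b : stepE M h y b (fun r x' => (phi (y, b, r, x'))%:E) = ((y, b) == (x, a))%:R%:E.
  by rewrite /phi/= (stepE_cst trans_dist).
rewrite (@esum_single _ _ _ x); last 2 first.
- by move=> y; exact: esum_ge0.
- move=> y yx; apply: esum1 => b _; rewrite e xpair_eqE (negbTE yx)/=.
  by rewrite mule0.
rewrite (@esum_single _ _ _ a)//; last first.
  by move=> b ba; rewrite e xpair_eqE (negbTE ba) andbF mule0.
by rewrite e eqxx mule1.
Qed.

Lemma occ_dist h : (h < H)%N -> is_dist (occ M pi h).
Proof.
move=> hH; have [s0 s1] := sd_dist h.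
have o0 z : 0 <= occ M pi h z by case: z => x a; rewrite occE// mulr_ge0.
split=> //; rewrite esum_pair; last by move=> z; rewrite lee_fin.
rewrite -[RHS]s1; apply: eq_esum => x _.
under eq_esum do rewrite occE// EFinM.
rewrite esumZl//; last by move=> a; rewrite lee_fin.
by case: pi_pol => _ ->; rewrite mule1.
Qed.

Lemma occ_sreach h xa : (h < H)%N -> occ M pi h xa != 0 -> sreach M h xa.1.
Proof.
case: xa => x a hH; rewrite occE// mulf_eq0 negb_or => /andP[sx _]; exact: sd_sreach sx.
Qed.

Lemma Eexp_occ h phi : (h < H)%N -> (forall z, 0 <= phi z) ->
  Eexp M pi (fun t => (atstep h phi t)%:E) =
  dist_exp (occ M pi h) (fun xa => stepE M h xa.1 xa.2 (fun r x' => (phi (xa, r, x'))%:E)).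
Proof.
move=> hH phi0; rewrite Eexp_step// /dist_exp esum_pair.
  by apply: eq_esum => x _; apply: eq_esum => a _; rewrite occE.
move=> [x a]; apply: mule_ge0; first by case: (occ_dist hH) => o0 _; rewrite lee_fin.
apply: esum_ge0 => x' _; apply: mule_ge0; rewrite ?lee_fin//.
by apply: integral_ge0 => r _; rewrite lee_fin.
Qed.

Lemma occ_marginal h (u : X -> R) : (h < H)%N -> (forall x, 0 <= u x) ->
  dist_exp (occ M pi h) (fun xa => (u xa.1)%:E) = dist_exp (sd h) (fun x => (u x)%:E).
Proof.
move=> hH u0; have [s0 _] := sd_dist h.
rewrite /dist_exp esum_pair; last first.
  by move=> z; apply: mule_ge0; rewrite lee_fin//; case: (occ_dist hH).
apply: eq_esum => x _ /=; under eq_esum do rewrite occE// EFinM -muleA.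
rewrite esumZl//; last by move=> a; apply: mule_ge0; rewrite lee_fin.
congr (_ * _)%E; rewrite esumZr ?lee_fin//; last by move=> a; rewrite lee_fin.
by case: pi_pol => _ ->; rewrite mul1e.
Qed.

Lemma occ_flow h (u : X -> R) : (h < H)%N -> (forall x, 0 <= u x) ->
  dist_exp (occ M pi h) (fun xa => stepE M h xa.1 xa.2 (fun _ x' => (u x')%:E)) =
  dist_exp (sd h.+1) (fun x => (u x)%:E).
Proof.
move=> hH u0; have [s0 _] := sd_dist h.
have e x a : stepE M h x a (fun _ x' => (u x')%:E) =
    \esum_(x' in [set: X]) ((trans M h x a x' * u x')%:E).
  by apply: eq_esum => x' _; rewrite integral_cst//= probability_setT mule1 EFinM.
rewrite /dist_exp esum_pair; last first.
  move=> z; rewrite e; apply: mule_ge0; first by rewrite lee_fin; case: (occ_dist hH).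
  by apply: esum_ge0 => x' _; rewrite lee_fin mulr_ge0.
transitivity (\esum_(y in [set: X]) \esum_(x in [set: X]) \esum_(a in [set: A])
    ((sd h y * pi h y a * trans M h y a x)%:E * (u x)%:E)%E).
  apply: eq_esum => y _; rewrite esum_swap; last first.
    by move=> *; rewrite -EFinM lee_fin !mulr_ge0.
  apply: eq_esum => a _; rewrite e occE// -esumZl ?mulr_ge0//; last first.
    by move=> x; rewrite lee_fin mulr_ge0.
  by apply: eq_esum => x _; rewrite -!EFinM mulrA.
rewrite esum_swap; last first.
  by move=> *; apply: esum_ge0 => *; rewrite -EFinM lee_fin !mulr_ge0.
apply: eq_esum => x _; rewrite sdS -esumZr ?lee_fin//; last first.
  by move=> y; apply: esum_ge0 => a _; rewrite lee_fin !mulr_ge0.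
by apply: eq_esum => y _; rewrite -esumZr ?lee_fin// => a; rewrite lee_fin !mulr_ge0.
Qed.

End Policy.
End Occupancy.

(** Inverting turns this into a lower bound on exp(-y). For y <= 0 the tangent suffices, since (1 -
    y)(1 + y + y^2) = 1 - y^3; for 0 < y <= 1/2 the fourth power of 1 - y/4 is used. *)
Lemma expR_le_quadratic (R : realType) (y : R) : y <= 1 / 2 -> expR y <= 1 + y + y ^+ 2.
Proof.
move=> y1; have q0 : 0 < 1 + y + y ^+ 2 by nra.
rewrite -[expR y]invrK -expRN.
have e0 := expR_gt0 (- y).
rewrite -[leRHS]invrK lef_pV2 ?posrE ?invr_gt0//.
rewrite -[leLHS]div1r ler_pdivrMr//.
have [yn|yp] := leP y 0.
  have := expR_ge1Dx (- y); nra.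
have h4 : (1 - y / 4) ^+ 4 <= expR (- y).
  have -> : - y = 4%:R * (- y / 4) by field.
  rewrite expRM_natl; apply: lerXn2r; rewrite ?nnegrE; [lra|exact: expR_ge0|].
  have := expR_ge1Dx (- y / 4); lra.
apply: (@le_trans _ _ ((1 - y / 4) ^+ 4 * (1 + y + y ^+ 2))); last by rewrite ler_wpM2r// ltW.
rewrite -subr_ge0.
have -> : (1 - y / 4) ^+ 4 * (1 + y + y ^+ 2) - 1 =
  y ^+ 2 * ((3 / 8 - 11 / 16 * y) + 81 / 256 * y ^+ 2 - 15 / 256 * y ^+ 3 + y ^+ 4 / 256).
  by field.
apply: mulr_ge0; first exact: sqr_ge0.
(* Only the cubic term is negative: [3 / 8 - 11 / 16 * y] is at least 1/32, and the square absorbs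
   the cube. *)
have h3 : y ^+ 3 <= y ^+ 2.
  by rewrite exprS ler_piMl ?sqr_ge0//; lra.
have y4 : 0 <= y ^+ 4 by rewrite exprn_ge0// ltW.
have y2 := sqr_ge0 y.
lra.
Qed.

(** * Tower property, performance difference and exponential moments of one policy *)

Section PerformanceDifference.
Context {R : realType} {X A : countType}.
Variable M : mdp R X A.
Local Notation H := (horizon M).
Hypothesis wf : wf_mdp M.
Hypothesis reward3 : forall h x a x', (h < H)%N -> sreach M h x -> 0 < trans M h x a x' ->
  {ae rew M h x a x', forall r, `|r| <= 3}.
Variable pi : policy R X A.
Hypothesis pi_pol : is_policy pi.

Let max0 (x : R) : 0 <= Num.max x 0. Proof. by rewrite le_max lexx orbT. Qed.
Let TE := traj_expectation wf reward3 pi_pol.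

Definition step_bounded (phi : tup R X A -> R) :=
  step_meas phi /\ exists B, forall z, `|z.1.2| <= 3 -> `|phi z| <= B.

Lemma step_bounded_cst (q : X * A -> R) B : (forall xa, `|q xa| <= B) ->
  step_bounded (fun z => q z.1.1).
Proof.
by move=> qB; split=> [x a x' /=|]; [exact: measurable_cst|exists B].
Qed.

Lemma bounded_atstep h phi : step_bounded phi ->
  bounded_on (fun u => tmeas (fun t => (u t)%:E)) (reward3_traj M) (atstep h phi).
Proof.
move=> [mphi [B phiB]]; split; first exact: tmeas_atstep.
exists `|B| => t [_ t3]; rewrite /atstep; case E : (stepAt h t) => [z|]; last by rewrite normr0.
by apply: (le_trans (phiB _ (t3 _ _ E))); exact: ler_norm.
Qed.

Lemma bounded_step x a phi : step_bounded phi ->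
  bounded_on (fun u : R * X -> R => forall x', measurable_fun setT (fun r => u (r, x')))
    reward3_step (fun z => phi (x, a, z.1, z.2)).
Proof. by move=> [mphi [B phiB]]; split; [move=> x'; exact: mphi|exists B => z z3; exact: (phiB (x, a, z.1, z.2))]. Qed.

(** Off the support of the occupancy the conditional expectation may be infinite, where [fine]
    alters it; the weight 0 makes this invisible. *)
Lemma mean_stepE h psi : (h < H)%N -> (forall z, 0 <= psi z) -> step_bounded psi ->
  exists s : X * A -> R, [/\
    forall xa, s xa = fine (stepE M h xa.1 xa.2 (fun r x' => (psi (xa, r, x'))%:E)),
    bounded_on allfun (fun xa => occ M pi h xa != 0) s &
    dist_exp (occ M pi h) (fun xa => stepE M h xa.1 xa.2 (fun r x' => (psi (xa, r, x'))%:E))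
    = (mean (occ M pi h) s)%:E].
Proof.
move=> hH psi0 bpsi; have od := occ_dist wf pi_pol hH.
pose s xa := fine (stepE M h xa.1 xa.2 (fun r x' => (psi (xa, r, x'))%:E)).
have SE xa : occ M pi h xa != 0 ->
    stepE M h xa.1 xa.2 (fun r x' => (psi (xa, r, x'))%:E) = (s xa)%:E.
  case: xa => x a ox; have hx := occ_sreach wf pi_pol hH ox.
  rewrite /s fineK//; apply: (exp_fin_ge0 (reward3_expectation wf reward3 a hH hx)
    (u := fun z => psi (x, a, z.1, z.2))) => //.
  exact: bounded_step bpsi.
have s0 xa : 0 <= s xa.
  rewrite fine_ge0//; apply: esum_ge0 => x' _; apply: mule_ge0.
    by rewrite lee_fin; case: wf => _ [/(_ h xa.1 xa.2) [/(_ x')]].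
  by apply: integral_ge0 => r _; rewrite lee_fin.
have bs : bounded_on allfun (fun xa => occ M pi h xa != 0) s.
  case: bpsi => mpsi [B psiB]; split => //; exists `|B| => -[x a] ox.
  have hx := occ_sreach wf pi_pol hH ox.
  have HE := reward3_expectation wf reward3 a hH hx.
  rewrite ger0_norm// -lee_fin -SE// -(exp_cst HE)//; apply: (exp_le HE (u := fun z => psi (x, a, z.1, z.2)) (v := fun=> `|B|)) => //.
  - by move=> x'; exact: mpsi.
  - move=> z z3; apply: (le_trans (ler_norm _)); apply: le_trans (ler_norm _).
    exact: (psiB (x, a, z.1, z.2)).
exists s; split => //; rewrite -(sE_nneg (dist_expectation od) s0 bs).
apply: eq_esum => xa _; have [->|ox] := eqVneq (occ M pi h xa) 0; first by rewrite !mul0e.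
by rewrite SE.
Qed.

(** The tower property for signed functions, from [mean_stepE] applied to the positive and negative
    parts. *)
Lemma sE_step_mean h phi : (h < H)%N -> step_bounded phi ->
  bounded_on allfun (fun xa => occ M pi h xa != 0)
    (fun xa => stepS M h xa.1 xa.2 (fun r x' => phi (xa, r, x'))) /\
  sE (Eexp M pi) (atstep h phi) =
  mean (occ M pi h) (fun xa => stepS M h xa.1 xa.2 (fun r x' => phi (xa, r, x'))).
Proof.
move=> hH bphi; have od := occ_dist wf pi_pol hH.
have bp (f : tup R X A -> R) : step_bounded f -> step_bounded (fun z => Num.max (f z) 0).
  move=> [mf [B fB]]; split=> [x a x' /=|].
    by apply: measurable_maxr => //; exact: measurable_cst.
  exists `|B| => z /fB fz; have [_|_] := leP (f z) 0; first by rewrite normr0.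
  by rewrite (le_trans fz)// ler_norm.
have bN : step_bounded (fun z => - phi z).
  case: bphi => mphi [B phiB]; split=> [x a x' /=|]; first by apply: measurableT_comp.
  by exists B => z /phiB; rewrite normrN.
have [s1 [s1E b1 e1]] := mean_stepE hH (fun z => max0 (phi z)) (bp _ bphi).
have [s2 [s2E b2 e2]] := mean_stepE hH (fun z => max0 (- phi z)) (bp _ bN).
have -> : (fun xa => stepS M h xa.1 xa.2 (fun r x' => phi (xa, r, x'))) =
    (fun xa => s1 xa + - s2 xa).
  apply/funext => xa; rewrite s1E s2E; congr (_ - _).
have HD := dist_expectation od.
split; first by apply: (bounded_onD HD) => //; exact: (bounded_onN HD).
rewrite [RHS](sED HD b1 (bounded_onN HD b2)) sEN /sE.
congr (_ - _).
  rewrite (_ : (fun t => _) = (fun t => (atstep h (fun z => Num.max (phi z) 0) t)%:E)).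
    by rewrite (Eexp_occ wf pi_pol) ?e1.
  by apply/funext => t; rewrite /atstep; case: stepAt => //; rewrite max_l.
rewrite (_ : (fun t => _) = (fun t => (atstep h (fun z => Num.max (- phi z) 0) t)%:E)).
  by rewrite (Eexp_occ wf pi_pol) ?e2.
by apply/funext => t; rewrite /atstep; case: stepAt => //; rewrite oppr0 max_l.
Qed.

Lemma mean_marginal h (u : X -> R) : (h < H)%N ->
  mean (occ M pi h) (fun xa => u xa.1) = mean (sd M pi h) u.
Proof.
move=> hH; rewrite /mean /sE.
by rewrite (occ_marginal wf pi_pol (u := fun x => Num.max (u x) 0))//
  (occ_marginal wf pi_pol (u := fun x => Num.max (- u x) 0)).
Qed.

Lemma mean_flow h (u : X -> R) B : (h < H)%N -> (forall x, `|u x| <= B) ->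
  bounded_on allfun (fun xa => occ M pi h xa != 0)
    (fun xa => stepS M h xa.1 xa.2 (fun _ x' => u x')) /\
  mean (occ M pi h) (fun xa => stepS M h xa.1 xa.2 (fun _ x' => u x')) = mean (sd M pi h.+1) u.
Proof.
move=> hH uB; have bu (f : X -> R) : (forall x, `|f x| <= B) -> step_bounded (fun z => f z.2).
  by move=> fB; split=> [x a x' /=|]; [exact: measurable_cst|exists B].
have [b e] := sE_step_mean hH (bu _ uB); split; first exact: b.
have max0' (f : X -> R) : (forall x, `|f x| <= B) -> forall x, `|Num.max (f x) 0| <= B.
  move=> fB x; have [_|_] := leP (f x) 0; last exact: fB.
  by rewrite normr0 (le_trans _ (fB x)).
have od := occ_dist wf pi_pol hH.
have [s1 [s1E b1 e1]] := mean_stepE hH (fun z => max0 (u z.2)) (bu _ (max0' _ uB)).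
have uB' x : `|- u x| <= B by rewrite normrN.
have [s2 [s2E b2 e2]] := mean_stepE hH (fun z => max0 (- u z.2)) (bu _ (max0' _ uB')).
have -> : (fun xa => stepS M h xa.1 xa.2 (fun _ x' => u x')) = (fun xa => s1 xa + - s2 xa).
  by apply/funext => xa; rewrite s1E s2E; congr (_ - _).
have HD := dist_expectation od.
rewrite /mean (sED HD b1 (bounded_onN HD b2)) sEN [RHS]/sE.
rewrite -(occ_flow wf pi_pol hH (u := fun x => Num.max (u x) 0))//.
by rewrite -(occ_flow wf pi_pol hH (u := fun x => Num.max (- u x) 0))// e1 e2.
Qed.

Lemma sum_atstep (f : tup R X A -> R) t : \sum_(h < size t) atstep h f t = \sum_(z <- t) f z.
Proof.
elim: t => [|z t IH]; first by rewrite big_ord0 big_nil.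
by rewrite big_ord_recl big_cons -IH.
Qed.

Lemma step_bounded_reward : step_bounded (fun z => z.1.2).
Proof. by split=> [x a x' /=|]; [exact: measurable_id|exists 3]. Qed.

Lemma bounded_sumrew :
  bounded_on (fun u => tmeas (fun t => (u t)%:E)) (reward3_traj M) (@sumrew R X A).
Proof.
split; first exact: tmeas_sumrew.
have [_ [B hB]] := bounded_on_sum TE (index_enum 'I_H)
  (fun h : 'I_H => bounded_atstep h step_bounded_reward).
by exists B => t Pt; have := hB t Pt; case: Pt => <- _; rewrite sum_atstep.
Qed.

Lemma Jval_sum : Jval M pi =
  \sum_(h < H) mean (occ M pi h) (fun xa => stepS M h xa.1 xa.2 (fun r _ => r)).
Proof.
rewrite -[LHS]/(sE (Eexp M pi) (@sumrew R X A)).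
have bF (h : 'I_H) := bounded_atstep h step_bounded_reward.
rewrite (eq_sE TE (v := fun t => \sum_(h < H) atstep h (fun z => z.1.2) t)).
- rewrite (sE_sum TE)//; apply: eq_bigr => h _.
  by have [_ ->] := sE_step_mean (ltn_ord h) step_bounded_reward.
- exact: bounded_sumrew.
- exact: (bounded_on_sum TE).
- by move=> t [<- _]; rewrite sum_atstep.
Qed.

(** Outside a null event the total is in [0, 1]. On that event it is almost surely bounded by some
    [B], so [B] times the indicator, of expectation 0, corrects both bounds. *)
Lemma Jval_ge0 : 0 <= Jval M pi <= 1.
Proof.
rewrite -[Jval M pi]/(sE (Eexp M pi) (@sumrew R X A)).
pose bad (t : @traj R X A) : R := (~~ ((0 <= sumrew t) && (sumrew t <= 1)))%:R.
have mbad : tmeas (fun t => (bad t)%:E).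
  have -> : bad = fun t => (fun s => 1 - \1_(`[0, 1]%classic) s) (sumrew t) :> R.
    apply/funext => t; rewrite /bad indicE mem_setE/= in_itv/=.
    by case: (_ && _); rewrite ?subrr ?subr0.
  apply: (tmeas_comp (f := fun s => 1 - \1_(`[0, 1]%classic) s)); last exact: tmeas_sumrew.
  by apply: measurable_funB; [exact: measurable_cst|exact: measurable_indic].
have bbad : bounded_on (fun u => tmeas (fun t => (u t)%:E)) (reward3_traj M) bad.
  by split => //; exists 1 => t _; rewrite /bad; case: (~~ _); rewrite ?normr1 ?normr0.
have bad0 : sE (Eexp M pi) bad = 0.
  apply: EFin_inj; rewrite -(sE_nneg TE)//.
  by case: wf => _ [_ ->].
have [_ [B hB]] := bounded_sumrew.
have bc c := bounded_on_cst TE c.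
have badP t : reward3_traj M t -> - (`|B| * bad t) <= sumrew t <= 1 + `|B| * bad t.
  move=> /hB; rewrite /bad ler_norml => /andP[l u]; have := ler_norm B.
  case: (boolP ((0 <= sumrew t) && (sumrew t <= 1))) => [/andP[s0 s1] _|_ nB]; first by rewrite /= mulr0 oppr0 addr0 s0 s1.
  by rewrite /= mulr1; lra.
apply/andP; split.
  have := le_sE TE (bounded_onN TE (bounded_onZ TE `|B| bbad)) bounded_sumrew
    (fun t Pt => proj1 (andP (badP t Pt))).
  by rewrite sEN (sEZ TE)// bad0 mulr0 oppr0.
have := le_sE TE bounded_sumrew (bounded_onD TE (bc 1) (bounded_onZ TE `|B| bbad))
    (fun t Pt => proj2 (andP (badP t Pt))).
by rewrite (sED TE)// ?(sEZ TE)// ?bad0 ?mulr0 ?addr0 ?(sE_cst TE)//; exact: (bounded_onZ TE).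
Qed.

(** The means of [v k] under the state distributions telescope, because [mean_flow] carries the mean
    of [v h.+1] after one step to [sd h.+1]. *)
Lemma performance_difference (v : nat -> X -> R) :
  (forall h x, `|v h x| <= 1) -> (forall x, v H x = 0) ->
  mean (init M) (v 0) - Jval M pi =
  \sum_(h < H) mean (occ M pi h)
     (fun xa => v h xa.1 - stepS M h xa.1 xa.2 (fun r x' => r + v h.+1 x')).
Proof.
move=> v1 vH; rewrite Jval_sum.
have -> : mean (init M) (v 0) = mean (sd M pi 0) (v 0) - mean (sd M pi H) (v H).
  rewrite (_ : v H = fun=> 0); last by apply/funext => x; rewrite vH.
  by rewrite (_ : mean (sd M pi H) _ = 0) ?subr0// /mean (sE_cst (dist_expectation (sd_dist wf pi_pol H))).
rewrite -[_ - mean _ (v H)]opprB -(telescope_sumr (fun k => mean (sd M pi k) (v k)))// -sumrN.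
rewrite big_mkord -sumrB; apply: eq_bigr => h _.
have hH := ltn_ord h; have HD := dist_expectation (occ_dist wf pi_pol hH).
have [b1 e1] := sE_step_mean hH step_bounded_reward.
have [b2 e2] := mean_flow hH (v1 h.+1).
have b0 : bounded_on allfun (fun xa => occ M pi h xa != 0) (fun xa => v h xa.1).
  by split => //; exists 1 => xa _.
have b12 := bounded_onD HD b1 b2.
have bu : step_bounded (fun z => z.1.2 + v h.+1 z.2).
  split=> [x a x' /=|]; first by apply: measurable_funD; [exact: measurable_id|exact: measurable_cst].
  by exists (3 + 1) => z z3; rewrite (le_trans (ler_normD _ _))// lerD.
have [b3 _] := sE_step_mean hH bu.
(* Additivity of [stepS] rests on bounded rewards, so it is applied on the support of the occupancy
   only. *)
have E3 : mean (occ M pi h) (fun xa => stepS M h xa.1 xa.2 (fun r x' => r + v h.+1 x')) =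
    mean (occ M pi h) (fun xa => stepS M h xa.1 xa.2 (fun r _ => r)) +
    mean (occ M pi h) (fun xa => stepS M h xa.1 xa.2 (fun _ x' => v h.+1 x')).
  rewrite /mean -(sED HD b1 b2); apply: (eq_sE HD b3 b12) => -[x a] /= ox.
  have hx := occ_sreach wf pi_pol hH ox.
  have HE := reward3_expectation wf reward3 a hH hx.
  apply: (sED HE (u := fun z => z.1) (v := fun z => v h.+1 z.2)).
    exact: (bounded_step (phi := fun z => z.1.2) x a step_bounded_reward).
  by split=> [x' /=|]; [exact: measurable_cst|exists 1 => z _].
have -> : mean (occ M pi h) (fun xa => v h xa.1 - stepS M h xa.1 xa.2 (fun r x' => r + v h.+1 x'))
    = mean (sd M pi h) (v h) -
      mean (occ M pi h) (fun xa => stepS M h xa.1 xa.2 (fun r x' => r + v h.+1 x')).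
  by rewrite -(mean_marginal (v h) hH) /mean (sED HD b0 (bounded_onN HD b3)) sEN.
by rewrite E3 e2 opprB -addrA -opprD [X in _ - X]addrC.
Qed.

(** The quadratic bound on the exponential, then 1 + z <= exp z. Since [q] depends on the
    state-action pair only, the second-order term is a plain occupancy mean. *)
Lemma Eexp_expR h (phi : tup R X A -> R) (q : X * A -> R) B c : (h < H)%N -> step_meas phi ->
  (forall z, `|z.1.2| <= 3 -> `|phi z| <= 1 / 2) ->
  (forall z, `|z.1.2| <= 3 -> phi z ^+ 2 <= q z.1.1) -> (forall xa, `|q xa| <= B) ->
  (Eexp M pi (fun t => (expR (atstep h phi t + c))%:E) <=
   (expR (c + mean (occ M pi h) (fun xa => stepS M h xa.1 xa.2 (fun r x' => phi (xa, r, x')))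
    + mean (occ M pi h) q))%:E)%E.
Proof.
move=> hH mphi phi1 phiq qB; have bphi : step_bounded phi by split => //; exists (1 / 2).
have bq := step_bounded_cst qB.
have [b1 <-] := sE_step_mean hH bphi.
have od := occ_dist wf pi_pol hH; have HD := dist_expectation od.
have [b2 e2] := sE_step_mean hH bq.
have <- : sE (Eexp M pi) (atstep h (fun z => q z.1.1)) = mean (occ M pi h) q.
  rewrite e2; apply: (eq_sE HD) => //; first by split => //; exists B.
  move=> [x a] /= ox; have hx := occ_sreach wf pi_pol hH ox.
  exact: (sE_cst (reward3_expectation wf reward3 a hH hx)).
have ba1 := bounded_atstep h bphi; have ba2 := bounded_atstep h bq.
have bu : bounded_on (fun u => tmeas (fun t => (u t)%:E)) (reward3_traj M)
    (fun t => expR (atstep h phi t + c)).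
  split; last first.
    exists (expR (1 / 2 + c)) => t Pt; rewrite ger0_norm ?expR_ge0// ler_expR lerD2r.
    case: Pt => _ t3; rewrite /atstep; case E : stepAt => [z|]; last lra.
    by rewrite (le_trans (ler_norm _))// phi1// (t3 _ _ E).
  apply: (tmeas_comp (f := fun s => expR (s + c))); last exact: tmeas_atstep.
  apply: measurableT_comp => //; apply: measurable_funD; [exact: measurable_id|exact: measurable_cst].
rewrite (sE_nneg TE)// lee_fin.
have bs := bounded_onD TE (bounded_onD TE (bounded_on_cst TE 1) ba1) ba2.
apply: (le_trans (le_sE TE bu (bounded_onZ TE (expR c) bs) _)).
  move=> t [st t3]; rewrite addrC expRD ler_wpM2l ?expR_ge0//.
  rewrite /atstep; case E : stepAt => [z|]; last by rewrite expR0 !addr0.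
  have z3 := t3 _ _ E; have := phi1 _ z3; rewrite ler_norml => /andP[_ pz].
  by apply: (le_trans (expR_le_quadratic pz)); rewrite lerD2l; exact: phiq.
rewrite (sEZ TE)// (sED TE)//; last exact: (bounded_onD TE (bounded_on_cst TE 1) ba1).
rewrite (sED TE (bounded_on_cst TE 1) ba1) (sE_cst TE) -[X in _ <= expR X]addrA expRD ler_wpM2l ?expR_ge0//.
by rewrite -addrA; exact: expR_ge1Dx.
Qed.

End PerformanceDifference.

(** * Concentration along a run of the algorithm *)

Section Run.
Context {R : realType} {X A : countType}.
Variable M : mdp R X A.
Local Notation H := (horizon M).
Hypothesis wf : wf_mdp M.
Hypothesis reward3 : forall h x a x', (h < H)%N -> sreach M h x -> 0 < trans M h x a x' ->
  {ae rew M h x a x', forall r, `|r| <= 3}.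
Variables (I J : finType) (F : I -> nat -> X -> A -> R) (g : I -> nat -> X -> A)
  (W : J -> nat -> X -> A -> \bar R) (T : nat) (gamma delta : R) (idef : I).
Local Notation choice := (Defs.choose M F g W T 1 gamma delta idef).
Local Notation grun := (run M F g W T 1 gamma delta idef).
Implicit Types (hist : seq (@traj R X A)) (good : seq (@traj R X A) -> bool).

Let piP i : is_policy (piF R g i). Proof. exact: detpol_policy. Qed.

Lemma glow_polE n hist : glow_pol M F g W T 1 gamma delta idef n hist =
  piF R g (choice n.+1 (take n hist)).
Proof. by rewrite /glow_pol divn1 muln1. Qed.

Lemma run_ge0 m hist good : (0 <= grun m hist good)%E.
Proof.
case: wf => -[in0 _] [td _]; elim: m hist => [|m IH] hist /=; first by rewrite lee_fin.
apply: esum_ge0 => x _; apply: mule_ge0; rewrite ?lee_fin//; apply: trajE_ge0 => //.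
by rewrite glow_polE.
Qed.

(* No measurability of [good] or of the algorithm is needed: the supermartingale
   [Phi] is only integrated with respect to the last trajectory. *)
Lemma run_supermartingale (Phi : seq (@traj R X A) -> R) good :
  (forall hist, 0 <= Phi hist) ->
  (forall hist, (size hist < T)%N -> tmeas (fun t => (Phi (rcons hist t))%:E)) ->
  (forall hist, (size hist < T)%N ->
     (Eexp M (piF R g (choice (size hist).+1 hist))
        (fun t => (Phi (rcons hist t))%:E) <= (Phi hist)%:E)%E) ->
  (forall hist, size hist = T -> all (fun t => size t == H) hist -> Phi hist < 1 -> good hist) ->
  ((1 - Phi [::])%:E <= grun T [::] good)%E.
Proof.
move=> Phi0 mPhi EPhi goodP.
suff h m hist : (size hist + m)%N = T -> all (fun t => size t == H) hist ->
    ((1 - Phi hist)%:E <= grun m hist good)%E by exact: h.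
elim: m hist => [|m IH] hist sh aH /=.
  rewrite addn0 in sh; rewrite lee_fin; case: (ltP (Phi hist) 1) => [/(goodP _ sh aH) ->|P1].
    by rewrite lerBlDr lerDl.
  by apply: (@le_trans _ _ 0) => //; lra.
have shT : (size hist < T)%N by rewrite -sh; lia.
rewrite glow_polE take_size; set pi := piF _ _ _; have pip : is_policy pi by exact: piP.
have TE := traj_expectation wf reward3 pip.
(* [v] is a measurable minorant of the success probability after the next trajectory; the truncation
   makes it nonnegative, as the nested integrals require. *)
pose v t := Num.max (1 - Phi (rcons hist t)) 0.
have v0 t : 0 <= v t by rewrite /v le_max lexx orbT.
have mPhi' := mPhi _ shT.
have mv : tmeas (fun t => (v t)%:E).
  apply: (tmeas_comp (f := fun s => Num.max (1 - s) 0)) => //.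
  apply: measurable_maxr; last exact: measurable_cst.
  by apply: measurable_funB; [exact: measurable_cst|exact: measurable_id].
case: (wf) => -[in0 _] [td _].
apply: (@le_trans _ _ (Eexp M pi (fun t => (v t)%:E))); last first.
  apply: le_esum => x _; apply: lee_pmul; rewrite ?lee_fin//.
    by apply: trajE_ge0 => // t; rewrite lee_fin.
  apply: le_trajE_nomeas => //.
  - by move=> t; exact: run_ge0.
  - move=> t st; rewrite EFin_max ge_max run_ge0 andbT; apply: IH.
      by rewrite size_rcons addSnnS.
    by rewrite all_rcons aH st add0n eqxx.
have := exp_add TE mv mPhi' v0 (fun t => Phi0 (rcons hist t)).
have : (1%:E <= Eexp M pi (fun t => (v t + Phi (rcons hist t))%:E))%E.
  have m1 : tmeas (fun _ : @traj R X A => 1%:E) by exact: tmeas_cst.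
  have w0 t : 0 <= v t + Phi (rcons hist t) by rewrite addr_ge0.
  rewrite -(exp_one TE); apply: (exp_le TE m1 (tmeas_addR mv mPhi') (fun=> ler01) w0).
  by move=> t _; rewrite /v; have [] := leP (1 - Phi (rcons hist t)) 0; lra.
move=> h1 e; rewrite e in h1.
have h2 := le_trans h1 (leeD (lexx _) (EPhi _ shT)).
by rewrite EFinB leeBlDr.
Qed.

Section Concentration.
Variables (K : finType) (n_ h_ : K -> nat) (U : K -> tup R X A -> R) (comp : K -> I -> R).
Variable Lam : R.
Hypothesis mU : forall k, step_meas (U k).
Hypothesis EU : forall k i,
  (Eexp M (piF R g i) (fun t => (expR (atstep (h_ k) (U k) t + comp k i))%:E) <= 1)%E.

(** The process stops at round [n_ k], so its final value is its value at that time, and one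
    supermartingale over the whole run covers the deviations at every round. *)
Definition increment k hist s : R := if (s < n_ k)%N then
  atstep (h_ k) (U k) (nth [::] hist s) + comp k (choice s.+1 (take s hist)) else 0.
Definition log_martingale k hist : R := \sum_(0 <= s < size hist) increment k hist s.
Definition potential hist : R := \sum_k (expR (- Lam) * expR (log_martingale k hist)).

Lemma log_martingale_rcons k hist t : log_martingale k (rcons hist t) = log_martingale k hist +
  if (size hist < n_ k)%N then atstep (h_ k) (U k) t + comp k (choice (size hist).+1 hist) else 0.
Proof.
rewrite /log_martingale size_rcons big_nat_recr//=; congr (_ + _).
  apply: eq_big_nat => s /andP[_ sh].
  by rewrite /increment nth_rcons sh -cats1 takel_cat// ltnW.
by rewrite /increment nth_rcons ltnn eqxx -cats1 takel_cat// take_size.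
Qed.

Lemma log_martingaleE k hist : (n_ k <= size hist)%N -> log_martingale k hist =
  \sum_(0 <= s < n_ k)
    (atstep (h_ k) (U k) (nth [::] hist s) + comp k (choice s.+1 (take s hist))).
Proof.
move=> nk; rewrite /log_martingale (big_cat_nat (leq0n _) nk)/=.
have -> : \sum_(n_ k <= s < size hist) increment k hist s = 0.
  rewrite big_nat_cond big1// => s; rewrite andbT /increment => /andP[ns _].
  by rewrite ltnNge ns.
rewrite addr0; apply: eq_big_nat => s /andP[_ sn]; by rewrite /increment sn.
Qed.

Let w hist k t : R := expR (if (size hist < n_ k)%N then
  atstep (h_ k) (U k) t + comp k (choice (size hist).+1 hist) else 0).

Let potential_rcons hist t : potential (rcons hist t) =
  \sum_k (expR (- Lam) * expR (log_martingale k hist)) * w hist k t.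
Proof. by apply: eq_bigr => k _; rewrite log_martingale_rcons expRD mulrA. Qed.

Let mw hist k : tmeas (fun t => (w hist k t)%:E).
Proof.
rewrite /w; have [_|_] := boolP (size hist < n_ k)%N; last exact: tmeas_cst.
apply: (tmeas_comp (f := fun s => expR (s + comp k (choice (size hist).+1 hist)))).
  apply: measurableT_comp => //.
  by apply: measurable_funD; [exact: measurable_id|exact: measurable_cst].
exact: tmeas_atstep.
Qed.

Let Ew hist i k : i = choice (size hist).+1 hist ->
  (Eexp M (piF R g i) (fun t => (w hist k t)%:E) <= 1)%E.
Proof.
move=> ->; rewrite /w; have [_|_] := boolP (size hist < n_ k)%N; first exact: EU.
by rewrite expR0 (exp_one (traj_expectation wf reward3 (piP _))).
Qed.

(** The potential starts at |K| exp(-Lam). If it ends below 1, so does each of its nonnegative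
    terms, and no log-martingale has reached [Lam]. *)
Lemma run_concentration good :
  (forall hist, size hist = T -> all (fun t => size t == H) hist ->
     (forall k, log_martingale k hist < Lam) -> good hist) ->
  ((1 - #|K|%:R * expR (- Lam))%:E <= grun T [::] good)%E.
Proof.
move=> goodP.
have e0 hist k : 0 <= expR (- Lam) * expR (log_martingale k hist).
  by rewrite mulr_ge0 ?expR_ge0.
have eI hist i (ei : i = choice (size hist).+1 hist) :=
  exp_sum_le (traj_expectation wf reward3 (piP i)) (index_enum K) (e0 hist) (mw hist)
   (fun k t => expR_ge0 _) (fun k => Ew k ei).
have <- : potential [::] = #|K|%:R * expR (- Lam).
  rewrite /potential /log_martingale (eq_bigr (fun=> expR (- Lam))).
    by rewrite sumr_const mulr_natl.
  by move=> k _; rewrite big_geq// expR0 mulr1.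
apply: run_supermartingale.
- by move=> hist; apply: sumr_ge0.
- move=> hist _; under eq_fun do rewrite potential_rcons.
  by have [] := eI hist _ erefl.
- move=> hist _; under eq_fun do rewrite potential_rcons.
  by have [] := eI hist _ erefl.
- move=> hist sT aH P1; apply: goodP => // k; rewrite ltNge; apply/negP => kL.
  move: P1; apply/negP; rewrite -leNgt /potential (bigD1 k)//=.
  apply: (@le_trans _ _ (expR (- Lam) * expR (log_martingale k hist))); last first.
    by rewrite lerDl sumr_ge0.
  by rewrite -expRD -[leLHS]expR0 ler_expR addrC subr_ge0.
Qed.

End Concentration.
End Run.

(** * Density ratio transfer and the elliptic potential *)

Section Mixtures.
Context {R : realType} {T : choiceType}.

(** Integrates a pointwise inequality between different distributions. Positive and negative parts
    go to opposite sides, and two finite sums of nonnegative series are compared termwise. *)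
Lemma mean_mix_ge0 (K : finType) (p u : K -> T -> R) :
  (forall k, is_dist (p k)) ->
  (forall k, bounded_on allfun (fun t => p k t != 0) (u k)) ->
  (forall t, 0 <= \sum_k p k t * u k t) -> 0 <= \sum_k mean (p k) (u k).
Proof.
move=> dp bu pu0; have max0 (x : R) : 0 <= Num.max x 0 by rewrite le_max lexx orbT.
have p0 k t : 0 <= p k t by case: (dp k).
pose a k t := p k t * Num.max (u k t) 0; pose b k t := p k t * Num.max (- u k t) 0.
have ab k t : p k t * u k t = a k t - b k t.
  by rewrite /a /b -mulrBr; congr (_ * _); have [|] := leP (u k t) 0; have [|] := leP (- u k t) 0; lra.
have HE k := dist_expectation (dp k).
have eA k : dist_exp (p k) (fun t => (Num.max (u k t) 0)%:E) =
    (fine (dist_exp (p k) (fun t => (Num.max (u k t) 0)%:E)))%:E.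
  by rewrite fineK// (exp_fin_ge0 (HE k))//; exact: (bounded_on_pos (HE k)).
have eB k : dist_exp (p k) (fun t => (Num.max (- u k t) 0)%:E) =
    (fine (dist_exp (p k) (fun t => (Num.max (- u k t) 0)%:E)))%:E.
  rewrite fineK// (exp_fin_ge0 (HE k))//; apply: (bounded_on_pos (HE k)).
  exact: (bounded_onN (HE k)).
rewrite /mean /sE sumrB subr_ge0 -lee_fin -!sumEFin.
under eq_bigr do rewrite -eB; under [leRHS]eq_bigr do rewrite -eA.
rewrite /dist_exp -esum_sum; last by move=> t k _ _; rewrite -EFinM lee_fin mulr_ge0.
rewrite -esum_sum; last by move=> t k _ _; rewrite -EFinM lee_fin mulr_ge0.
apply: le_esum => t _; under eq_bigr do rewrite -EFinM; under [leRHS]eq_bigr do rewrite -EFinM.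
rewrite !sumEFin lee_fin -subr_ge0 -sumrB.
by have := pu0 t; under eq_bigr do rewrite ab.
Qed.

End Mixtures.

Section Transfer.
Context {R : realType}.
Implicit Types d D gam w Delta m : R.

(* [gam * clipped_ratio d D gam] is min(d/D, gam), with the value gam when D = 0
   (unlike the convention 0/0 = 1 of [Defs.ratio]). *)
Definition clipped_ratio d D gam : R := if D == 0 then 1 else Num.min (d / D / gam) 1.

Lemma clipped_ratio_bound d D gam : 0 <= d -> 0 <= D -> 0 < gam -> 0 <= clipped_ratio d D gam <= 1.
Proof.
move=> d0 D0 g0; rewrite /clipped_ratio; case: eqP => _; first by rewrite ler01 lexx.
by rewrite ge_min lexx orbT andbT le_min ler01 andbT !divr_ge0// ltW.
Qed.

(* The square is penalized by 8 + 1/2, more than the 8 of the algorithm, so that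
   the soundness of the version space keeps a margin of 1/2 against its variance;
   the constants 8 + 1/2 and 13 + 6/10 must keep the latter below the 18 of the
   theorem. *)
Lemma density_ratio_transfer d D gam w Delta : 0 <= d -> 0 <= D -> 0 < gam -> 0 <= w <= gam ->
  ((d != 0) || (D != 0) -> `|Delta| <= 4) ->
  d * Delta <= D * (Delta * w - (8 + 1 / 2) / gam * w ^+ 2 +
      (13 + 6 / 10) * `|gam * clipped_ratio d D gam - w|) + 700 * (d * clipped_ratio d D gam).
Proof.
move=> d0 D0 g0 /andP[w0 wg] hD.
have [/andP[/eqP d00 /eqP D00]|] := boolP ((d == 0) && (D == 0)).
  by rewrite d00 D00 !mul0r mulr0 addr0.
rewrite negb_and => /hD; rewrite ler_norml => /andP[D1 D2].
rewrite /clipped_ratio; case: eqP => [->|/eqP Dn0].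
  (* For [D = 0] the clipped ratio is 1, and [Delta <= 4] is covered by 700. *)
  by rewrite mul0r add0r mulr1; nra.
have Dp : 0 < D by rewrite lt_neqAle eq_sym Dn0.
pose rho := d / D; have -> : d = D * rho by rewrite /rho mulrC divfK.
have -> : D * rho / D = rho by rewrite mulrC mulKf.
have r0 : 0 <= rho by rewrite divr_ge0.
set chi := Num.min _ _; have [c0 c1] : 0 <= chi /\ chi <= 1.
  by rewrite /chi ge_min lexx orbT le_min ler01 andbT divr_ge0// ltW.
have gc : gam * chi <= rho.
  rewrite /chi minr_pMr ?(ltW g0)// ge_min mulrC divfK ?lexx//; exact: lt0r_neq0.
have rc : rho - gam * chi <= rho * chi.
  rewrite /chi; case: (leP (rho / gam) 1) => h; last by nra.
  have -> : gam * (rho / gam) = rho by rewrite mulrC divfK//; exact: lt0r_neq0.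
  by rewrite subrr mulr_ge0// divr_ge0// ltW.
set e := `|_|; have e1 : gam * chi - w <= e by exact: ler_norm.
have e2 : w - gam * chi <= e by rewrite /e distrC ler_norm.
have e0 : 0 <= e by exact: normr_ge0.
(* If [w] is at most 9 times the clipped ratio [gam * chi], its square is at most 81 gam rho chi;
   otherwise [w] is at most 9/8 of its distance [e] to that ratio. With |Delta| <= 4 this yields the
   constants 4 + 8.5 * 9/8 < 13.6 and 4 + 8.5 * 81 < 700. *)
have w2 : w ^+ 2 / gam <= 81 * (rho * chi) + 9 / 8 * e.
  rewrite ler_pdivrMr//; have [h|h] := leP w (9 * (gam * chi)).
    have h1 : w ^+ 2 <= 81 * (gam * chi) ^+ 2 by nra.
    have h2 : (gam * chi) ^+ 2 <= rho * chi * gam.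
      rewrite expr2 (_ : rho * chi * gam = rho * (gam * chi)); last by ring.
      by rewrite ler_wpM2r// mulr_ge0// ltW.
    have h3 : 0 <= 9 / 8 * e * gam by rewrite mulr_ge0 ?(ltW g0)//; lra.
    by rewrite mulrDl; nra.
  have h1 : w <= 9 / 8 * e by lra.
  have h2 : w ^+ 2 <= 9 / 8 * e * gam by rewrite expr2 ler_pM.
  have h3 : 0 <= 81 * (rho * chi) * gam by rewrite mulr_ge0 ?(ltW g0)// mulr_ge0// mulr_ge0.
  by rewrite mulrDl; lra.
have main : rho * Delta <= Delta * w - (8 + 1 / 2) / gam * w ^+ 2 + (13 + 6 / 10) * e + 700 * (rho * chi).
  have h1 : (rho - w) * Delta <= 4 * (rho - gam * chi) + 4 * e.
    have : rho - w <= (rho - gam * chi) + e by lra.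
    have : - ((rho - gam * chi) + e) <= rho - w by lra.
    by nra.
  have h2 : (8 + 1 / 2) / gam * w ^+ 2 = (8 + 1 / 2) * (w ^+ 2 / gam) by field; exact: lt0r_neq0.
  rewrite h2; have h3 : 0 <= rho * chi by rewrite mulr_ge0.
  lra.
move: main; set X := _ + _ * e; move: X => X main.
rewrite -subr_ge0 (_ : _ - _ = D * (X + 700 * (rho * chi) - rho * Delta)); last by ring.
by apply: mulr_ge0; [exact: D0|rewrite subr_ge0; exact: main].
Qed.

(** Clipping at [gam] is a contraction; for [D > 0] the two conventions for the ratio agree. *)
Lemma clip_dist_le d D gam (v : \bar R) : 0 <= d -> 0 < D -> 0 < gam -> (0 <= v)%E ->
  (`|gam * clipped_ratio d D gam - fine (Order.min v gam%:E)|%:E <= Defs.edist (Defs.ratio d D) v)%E.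
Proof.
move=> d0 D0 g0 v0; rewrite /clipped_ratio /Defs.ratio (gt_eqF D0) /Defs.edist.
have gn : gam != 0 by exact: lt0r_neq0.
rewrite minr_pMr ?(ltW g0)// mulr1 (mulrC gam) divfK//.
set rho := d / D; case: v v0 => [r r0|_|//]; last first.
  by rewrite /= leey.
have -> : fine (Order.min r%:E gam%:E) = Num.min r gam by rewrite -EFin_min.
case: eqP => [[->]|_]; first by rewrite subrr normr0.
rewrite -EFinB/= lee_fin.
case: (leP rho gam) => h1; case: (leP r gam) => h2 //; rewrite ler_norml.
- have := ler_norm (rho - r); have := ler_norm (r - rho); rewrite distrC; lra.
- have := ler_norm (rho - r); have := ler_norm (r - rho); rewrite distrC; lra.
- by rewrite subrr oppr_le0 normr_ge0.
Qed.

Lemma le_ln1D x : 0 <= x <= 1 -> x <= 2 * ln (1 + x) :> R.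
Proof.
move=> /andP[x0 x1]; have p : 0 < 1 + x by lra.
have h : ln (1 + (- (x / (1 + x)))) <= - (x / (1 + x)).
  by apply: le_ln1Dx; rewrite ltrN2 ltr_pdivrMr//; lra.
have e : 1 + (- (x / (1 + x))) = (1 + x)^-1 by field; exact: lt0r_neq0.
rewrite e lnV ?posrE// in h.
have : x / 2 <= x / (1 + x) by rewrite ler_wpM2l// lef_pV2 ?posrE//; lra.
lra.
Qed.

Lemma harmonic_le n : \sum_(k < n) (k.+1%:R : R)^-1 <= 1 + ln n.+1%:R.
Proof.
suff h l : \sum_(k < l.+1) (k.+1%:R : R)^-1 <= 1 + ln l.+1%:R.
  case: n => [|n]; first by rewrite big_ord0 ln1 addr0.
  by apply: (le_trans (h n)); rewrite lerD2l ler_ln ?posrE// ler_nat.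
elim: l => [|l IH]; first by rewrite big_ord_recr big_ord0/= ln1 invr1 add0r addr0.
rewrite big_ord_recr/=; apply: (@le_trans _ _ (1 + ln l.+1%:R + l.+2%:R^-1)).
  by rewrite lerD2r.
rewrite -addrA lerD2l -lerBrDl -opprB lerNr -ln_div ?posrE//.
have -> : l.+1%:R / l.+2%:R = 1 + - (l.+2%:R^-1) :> R.
  have e : l.+1%:R = l.+2%:R - 1 :> R by rewrite -[l.+2%:R]natr1 addrK.
  by rewrite e mulrBl mulfV ?pnatr_eq0// mul1r.
by apply: le_ln1Dx; rewrite ltrN2 invf_lt1// ltr1n.
Qed.

(** While the past sum S is below [m], a term is bounded by [dd n]. Afterwards it is at most 2 m x /
    gam with x = dd n / (S + m), and x <= 2 ln(1 + x) makes the logarithms telescope. *)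
Lemma potential_bound (dd : nat -> R) m gam N : 0 <= m -> 0 < gam ->
  (forall n, 0 <= dd n <= m) ->
  \sum_(n < N) dd n * clipped_ratio (dd n) ((\sum_(s < n) dd s) / n%:R) (gam * n.+1%:R) <=
  m * (2 + 4 / gam * ln (N%:R + 1)).
Proof.
move=> m0 g0 dm; pose S n := \sum_(s < n) dd s.
have S0 n : 0 <= S n by apply: sumr_ge0 => s _; case/andP: (dm s).
have SS n : S n.+1 = S n + dd n by rewrite /S big_ord_recr.
have [m00|mp] : m = 0 \/ 0 < m.
  by move: m0; rewrite le_eqVlt => /predU1P[<-|]; [left|right].
  rewrite m00 mul0r big1// => n _; have := dm n; rewrite m00 => h.
  by have -> : dd n = 0 by [apply/eqP; rewrite eq_le andbC]; rewrite mul0r.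
have chi01 n : 0 <= clipped_ratio (dd n) (S n / n%:R) (gam * n.+1%:R) <= 1.
  by apply: clipped_ratio_bound; [case/andP: (dm n)|rewrite divr_ge0|rewrite mulr_gt0].
(* [B] collects the rounds with [S n < m]. Before each increase it is at most [S n < m], and the
   increase is at most [m]; hence the bound [2 * m]. *)
suff [B [BS B2 hB]] : exists B, [/\ B <= S N, B <= 2 * m &
    \sum_(n < N) dd n * clipped_ratio (dd n) (S n / n%:R) (gam * n.+1%:R) <=
    B + 4 * m / gam * (ln (S N + m) - ln m)].
  apply: (le_trans hB); have lnS : ln (S N + m) - ln m <= ln (N%:R + 1).
    rewrite lerBlDr -lnM ?posrE ?ltr_wpDl// ler_ln ?posrE ?mulr_gt0 ?ltr_wpDl//.
    rewrite mulrDl mul1r lerD2r /S.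
    apply: (@le_trans _ _ (\sum_(s < N) m)); last by rewrite sumr_const card_ord mulr_natl.
    by apply: ler_sum => s _; case/andP: (dm s).
  have : 4 * m / gam * (ln (S N + m) - ln m) <= 4 * m / gam * ln (N%:R + 1).
    by rewrite ler_wpM2l// divr_ge0 ?(ltW g0)// mulr_ge0.
  have -> : m * (2 + 4 / gam * ln (N%:R + 1)) = 2 * m + 4 * m / gam * ln (N%:R + 1).
    by field; exact: lt0r_neq0.
  lra.
elim: N => [|n [B [BS B2 hB]]].
  by exists 0; rewrite !big_ord0 /S big_ord0 !add0r subrr mulr0; split => //; lra.
have /andP[d0 d1] := dm n; have /andP[c0 c1] := chi01 n.
have Sm : 0 < S n + m by rewrite ltr_wpDl.
have lnE : ln (S n.+1 + m) = ln (S n + m) + ln (1 + dd n / (S n + m)).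
  rewrite -lnM ?posrE//; last by rewrite ltr_wpDr// divr_ge0// ltW.
  by congr ln; rewrite SS mulrDr mulr1 mulrC divfK ?gt_eqF//; ring.
have x01 : 0 <= dd n / (S n + m) <= 1.
  by rewrite divr_ge0 ?(ltW Sm)//= ler_pdivrMr// mul1r; have := S0 n; lra.
have lnp := le_ln1D x01.
have mg : 0 <= 4 * m / gam by rewrite divr_ge0 ?(ltW g0)// mulr_ge0.
rewrite big_ord_recr/= lnE; set L := ln (1 + _) in lnp *.
have L0 : 0 <= L by have := proj1 (andP x01); lra.
have mgL : 0 <= 4 * m / gam * L by rewrite mulr_ge0.
have [h|h] := ltP (S n) m.
  exists (B + dd n); split; [by rewrite SS lerD2r|lra|].
  have : dd n * clipped_ratio (dd n) (S n / n%:R) (gam * n.+1%:R) <= dd n by rewrite ler_piMr.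
  rewrite !mulrDr mulrN; move: hB; rewrite !mulrDr mulrN; lra.
exists B; split; [by rewrite SS; lra|by []|].
have Sp : 0 < S n by lra.
have np : (0 < n)%N by case: (n) Sp => //; rewrite /S big_ord0 ltxx.
have npR : (0 : R) < n%:R by rewrite ltr0n.
have cle : clipped_ratio (dd n) (S n / n%:R) (gam * n.+1%:R) <= 2 * (dd n / (S n + m)) / gam.
  rewrite /clipped_ratio ifF; last by apply/negbTE; rewrite mulf_neq0 ?invr_eq0 ?gt_eqF.
  rewrite ge_min; apply/orP; left.
  have -> : dd n / (S n / n%:R) / (gam * n.+1%:R) = dd n / S n / gam * (n%:R / n.+1%:R).
    by field; rewrite !gt_eqF//= pnatr_eq0 -lt0n np.
  apply: (@le_trans _ _ (dd n / S n / gam)).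
    rewrite ler_piMr ?divr_ge0 ?(ltW g0) ?(ltW Sp)//.
    by rewrite ler_pdivrMr ?ltr0n// mul1r ler_nat.
  (* In this regime [2 * S n >= S n + m], which brings in the denominator of the logarithmic
     increment. *)
  rewrite ler_pM2r ?invr_gt0// ler_pdivrMr//.
  have -> : 2 * (dd n / (S n + m)) * S n = dd n * (2 * S n / (S n + m)) by field; rewrite gt_eqF.
  by rewrite ler_peMr// ler_pdivlMr// mul1r; lra.
have : dd n * clipped_ratio (dd n) (S n / n%:R) (gam * n.+1%:R) <= 4 * m / gam * L.
  apply: (@le_trans _ _ (m * (2 * (2 * L) / gam))).
    apply: ler_pM => //; apply: (le_trans cle).
    by rewrite ler_pM2r ?invr_gt0// ler_pM2l.
  by rewrite (_ : _ * (_ / _) = 4 * m / gam * L)//; field; rewrite gt_eqF.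
move: hB; rewrite !mulrDr mulrN; lra.
Qed.

End Transfer.

(** * The algorithm on its good event *)

Section Glow.
Context {R : realType} {X A : countType}.
Variable M : mdp R X A.
Local Notation H := (horizon M).
Hypothesis wf : wf_mdp M.
Variables (I J : finType) (F : I -> nat -> X -> A -> R) (g : I -> nat -> X -> A)
  (W : J -> nat -> X -> A -> \bar R).
Hypothesis F01 : forall i h x a, (h < H)%N -> 0 <= F i h x a <= 1.
Hypothesis W0 : forall j h x a, (h < H)%N -> (0 <= W j h x a)%E.
Hypothesis greedy : greedy_ok M F g.
Variable iQ : I.
Hypothesis FQ : forall h x a, (h < H)%N -> F iQ h x a = Qstar M h x a.

Definition greedy_value i h x : R := if (h < H)%N then F i h x (g i h x) else 0.

Lemma greedy_value01 i h x : 0 <= greedy_value i h x <= 1.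
Proof. by rewrite /greedy_value; case: ifP => [|_]; [exact: F01|rewrite lexx ler01]. Qed.

Lemma greedy_value_end i x : greedy_value i H x = 0.
Proof. by rewrite /greedy_value ltnn. Qed.

(** The greedy action for [iQ] attains the supremum in [Qrec], which is thereby finite. *)
Lemma bellman h x a : (h < H)%N ->
  F iQ h x a = stepS M h x a (fun r x' => r + greedy_value iQ h.+1 x').
Proof.
move=> hH; rewrite FQ// /Qstar.
have e : (H - h = (H - h.+1).+1)%N by lia.
rewrite e /= (_ : (H - (H - h.+1).+1 = h)%N); last by lia.
congr stepS; apply/funext => r; apply/funext => x'; congr (_ + _).
case E : (H - h.+1)%N => [|n]; first by rewrite /greedy_value ifF//; lia.
have hH' : (h.+1 < H)%N by lia.
rewrite /greedy_value hH' -E; have qE b : Qrec M (H - h.+1) x' b = F iQ h.+1 x' b by rewrite FQ.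
suff -> : ereal_sup [set (Qrec M (H - h.+1) x' b)%:E | b in [set: A]] =
   (F iQ h.+1 x' (g iQ h.+1 x'))%:E by [].
apply/eqP; rewrite eq_le; apply/andP; split.
  by apply: ge_ereal_sup => _ [b _ <-]; rewrite qE lee_fin; exact: greedy.
by apply: ereal_sup_ubound; exists (g iQ h.+1 x') => //; rewrite qE.
Qed.

Lemma reward3 h x a x' : (h < H)%N -> sreach M h x -> 0 < trans M h x a x' ->
  {ae rew M h x a x', forall r, `|r| <= 3}.
Proof.
apply: (reward_bound wf a (v := greedy_value iQ) (b := g iQ)).
- exact: greedy_value01.
- exact: greedy_value_end.
- by move=> k y kH; rewrite {1}/greedy_value kH bellman.
Qed.

Let piP i : is_policy (piF R g i). Proof. exact: detpol_policy. Qed.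

Definition bellman_error i h (xa : X * A) : R :=
  F i h xa.1 xa.2 - stepS M h xa.1 xa.2 (fun r x' => r + greedy_value i h.+1 x').

Definition td i h (z : tup R X A) : R :=
  F i h z.1.1.1 z.1.1.2 - z.1.2 - nextv M F g i h z.2.

(** The two values differ by at most 1, so only 1 is added to the reward bound 3. *)
Lemma td_bound i h z : (h < H)%N -> `|z.1.2| <= 3 -> `|td i h z| <= 4.
Proof.
move=> hH; rewrite ler_norml => /andP[z1 z2]; rewrite /td.
have /andP[f0 f1] := F01 i z.1.1.1 z.1.1.2 hH.
have /andP[v0 v1] : 0 <= nextv M F g i h z.2 <= 1 := greedy_value01 i h.+1 z.2.
by rewrite ler_norml; apply/andP; split; lra.
Qed.

Lemma step_meas_td i h : step_meas (td i h).
Proof.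
move=> x a x'; rewrite /td /=; apply: measurable_funB; last exact: measurable_cst.
by apply: measurable_funB; [exact: measurable_cst|exact: measurable_id].
Qed.

Lemma stepS_td i h x a (c d : R) : (h < H)%N -> sreach M h x ->
  stepS M h x a (fun r x' => td i h (x, a, r, x') * c + d) = bellman_error i h (x, a) * c + d.
Proof.
move=> hH hx; have HE := reward3_expectation wf reward3 a hH hx.
rewrite -[LHS]/(sE (fun g => stepE M h x a (fun r x' => g (r, x')))
  (fun z : R * X => td i h (x, a, z.1, z.2) * c + d)).
pose u (z : R * X) := z.1 + greedy_value i h.+1 z.2.
have bu : bounded_on (fun u : R * X -> R => forall x', measurable_fun setT (fun r => u (r, x')))
    reward3_step u.
  split=> [x'|]; first by rewrite /u /=; apply: measurable_funD; [exact: measurable_id|exact: measurable_cst].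
  exists 4 => z; rewrite /reward3_step ler_norml => /andP[z1 z2].
  have /andP[v0 v1] := greedy_value01 i h.+1 z.2; rewrite /u ler_norml; apply/andP; split; lra.
have bc k := bounded_on_cst HE k.
rewrite (_ : (fun z => _) = (fun z => (F i h x a * c + d) + (- c) * u z)).
  rewrite (sED HE)//; last exact: (bounded_onZ HE).
  rewrite (sE_cst HE) (sEZ HE)// /bellman_error /=.
  rewrite (_ : stepS M h x a _ = sE (fun g => stepE M h x a (fun r x' => g (r, x'))) u) //.
  by ring.
by apply/funext => z; rewrite /td /u /nextv /greedy_value /=; ring.
Qed.

Lemma bellman_error_bound i h x a : (h < H)%N -> sreach M h x ->
  `|bellman_error i h (x, a)| <= 4.
Proof.
move=> hH hx; have HE := reward3_expectation wf reward3 a hH hx.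
have -> : bellman_error i h (x, a) = sE (fun g => stepE M h x a (fun r x' => g (r, x')))
    (fun z : R * X => td i h (x, a, z.1, z.2) * 1 + 0).
  by rewrite -[RHS]/(stepS M h x a (fun r x' => td i h (x, a, r, x') * 1 + 0)) stepS_td// mulr1 addr0.
have bt : bounded_on (fun u : R * X -> R => forall x', measurable_fun setT (fun r => u (r, x')))
    reward3_step (fun z : R * X => td i h (x, a, z.1, z.2) * 1 + 0).
  split=> [x'|]; first by under eq_fun do rewrite mulr1 addr0; exact: step_meas_td.
  by exists 4 => z z3; rewrite mulr1 addr0; exact: td_bound.
have tb z : reward3_step z -> - 4 <= td i h (x, a, z.1, z.2) * 1 + 0 <= 4.
  by move=> z3; rewrite mulr1 addr0 -ler_norml; exact: td_bound.
rewrite ler_norml; apply/andP; split.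
  rewrite -[leLHS](sE_cst HE); apply: (le_sE HE (bounded_on_cst HE _) bt) => z /tb/andP[]//.
rewrite -[leRHS](sE_cst HE); apply: (le_sE HE bt (bounded_on_cst HE _)) => z /tb/andP[]//.
Qed.

Lemma bellman_error_Q h x a : (h < H)%N -> bellman_error iQ h (x, a) = 0.
Proof. by move=> hH; rewrite /bellman_error/= bellman// subrr. Qed.

Lemma bounded_bellman_error i h pi (u : X * A -> R) B : (h < H)%N -> is_policy pi ->
  (forall xa, `|u xa| <= B) ->
  bounded_on allfun (fun xa => occ M pi h xa != 0) (fun xa => bellman_error i h xa * u xa).
Proof.
move=> hH pip uB; split=> //; exists (4 * B) => -[x a] ox; rewrite normrM ler_pM//.
by apply: bellman_error_bound => //; exact: (occ_sreach wf pip hH ox).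
Qed.

Definition predicted_value i : R := mean (init M) (greedy_value i 0).

(** Performance difference for the greedy values of [i]: on the support of its own policy the action
    is greedy, so the value there equals [F i]. *)
Lemma Jval_greedy i : predicted_value i - Jval M (piF R g i) =
  \sum_(h < H) mean (occ M (piF R g i) h) (bellman_error i h).
Proof.
rewrite /predicted_value (performance_difference wf reward3 (piP i)).
- apply: eq_bigr => h _; have hH := ltn_ord h.
  have HD := dist_expectation (occ_dist wf (piP i) hH).
  rewrite /mean; apply: (eq_sE HD).
  + split=> //; exists 4 => -[x a] ox /=; have hx := occ_sreach wf (piP i) hH ox.
    have := bellman_error_bound i (g i h x) hH hx.
    move: ox; rewrite (occE wf (piP i))// mulf_eq0 negb_or /piF /detpol => /andP[_].
    by case: ifP => [/eqP -> _|_]; [rewrite /greedy_value hH|rewrite eqxx].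
  + by split=> //; exists 4 => -[x a] ox; apply: bellman_error_bound => //; exact: (occ_sreach wf (piP i) hH ox).
  + move=> [x a]; rewrite (occE wf (piP i))// mulf_eq0 negb_or /piF /detpol => /andP[_].
    by case: ifP => [/eqP -> _|_]; [rewrite /bellman_error /greedy_value hH|rewrite eqxx].
- by move=> h x; have /andP[v0 v1] := greedy_value01 i h x; rewrite ger0_norm.
- exact: greedy_value_end.
Qed.

(** Performance difference for the optimal values: every term is the gap between the greedy action
    and the action played. *)
Lemma Jval_le_predicted pi : is_policy pi -> Jval M pi <= predicted_value iQ.
Proof.
move=> pip; rewrite -subr_ge0 /predicted_value (performance_difference wf reward3 pip).
- apply: sumr_ge0 => h _; have hH := ltn_ord h.
  have HD := dist_expectation (occ_dist wf pip hH).
  rewrite -[leLHS](sE_cst HD); apply: (le_sE HD).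
  + exact: (bounded_on_cst HD).
  + split=> //; exists 1 => -[x a] ox /=; rewrite -bellman// /greedy_value hH.
    have /andP[a0 a1] := F01 iQ x (g iQ h x) hH; have /andP[b0 b1] := F01 iQ x a hH.
    by rewrite ler_norml; apply/andP; split; lra.
  + by move=> [x a] ox /=; rewrite -bellman// /greedy_value hH subr_ge0; exact: greedy.
- by move=> h x; have /andP[v0 v1] := greedy_value01 iQ h x; rewrite ger0_norm.
- exact: greedy_value_end.
Qed.

Lemma Jstar_le_predicted : Jstar M <= predicted_value iQ.
Proof.
rewrite /Jstar; set S := [set _ | _ in _].
have lub : (ereal_sup S <= (predicted_value iQ)%:E)%E.
  by apply: ge_ereal_sup => _ [pi pip <-]; rewrite lee_fin; exact: Jval_le_predicted.
have lb : ((Jval M (piF R g iQ))%:E <= ereal_sup S)%E.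
  by apply: ereal_sup_ubound; exists (piF R g iQ) => //; exact: piP.
by move: lub lb; case: (ereal_sup S) => [r| |]//=; rewrite lee_fin.
Qed.

Lemma predicted_value_le1 i : predicted_value i <= 1.
Proof.
case: wf => id _; have HD := dist_expectation id.
rewrite -[leRHS](sE_cst HD); apply: (le_sE HD).
- by split=> //; exists 1 => x _; have /andP[v0 v1] := greedy_value01 i 0 x; rewrite ger0_norm.
- exact: (bounded_on_cst HD).
- by move=> x _; case/andP: (greedy_value01 i 0 x).
Qed.

Lemma suboptimality_le1 i : Jstar M - Jval M (piF R g i) <= 1.
Proof.
have := Jstar_le_predicted; have := predicted_value_le1 iQ.
by have /andP[] := Jval_ge0 wf reward3 (piP i); lra.
Qed.

Lemma suboptimality_Q : Jstar M - Jval M (piF R g iQ) <= 0.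
Proof.
have := Jval_greedy iQ; rewrite big1 => [e|h _]; last first.
  rewrite /mean (_ : bellman_error iQ h = fun=> 0).
    exact: (sE_cst (dist_expectation (occ_dist wf (piP iQ) (ltn_ord h)))).
  by apply/funext => -[x a]; rewrite bellman_error_Q.
by have := Jstar_le_predicted; lra.
Qed.

(** * Clipped weights, exponential bounds on the losses, and change of measure *)

Variable gamma : R.
Hypothesis gamma0 : 0 < gamma.

Let gam0 n : 0 < gam gamma n.+1. Proof. by rewrite /gam mulr_gt0. Qed.

Definition weight j h t (xa : X * A) : R := fine (Order.min (W j h xa.1 xa.2) (gam gamma t)%:E).

Lemma weight_bound j h n xa : (h < H)%N -> 0 <= weight j h n.+1 xa <= gam gamma n.+1.
Proof.
move=> hH; rewrite /weight; have := W0 j xa.1 xa.2 hH; have := ltW (gam0 n).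
case: (W j h xa.1 xa.2) => [r| |]// g0 r0.
  by rewrite lee_fin in r0; rewrite -EFin_min/= ge_min lexx orbT le_min g0 r0.
by rewrite minye//= g0 lexx.
Qed.

Definition Zloss t i j h (z : tup R X A) : R :=
  td i h z * weight j h t z.1.1 - alph gamma t * weight j h t z.1.1 ^+ 2.
(** Mean of [Zloss] over a round played with the policy of [k]; [energy] is the proxy for its
    variance. *)
Definition drift t i j h k : R := mean (occ M (piF R g k) h)
  (fun xa => bellman_error i h xa * weight j h t xa - alph gamma t * weight j h t xa ^+ 2).
Definition energy t j h k : R := mean (occ M (piF R g k) h) (fun xa => weight j h t xa ^+ 2).

Lemma weight_sqr_bound j h n xa : (h < H)%N -> `|weight j h n.+1 xa ^+ 2| <= gam gamma n.+1 ^+ 2.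
Proof.
move=> hH; have /andP[w0 w1] := weight_bound j n xa hH.
by rewrite ger0_norm ?sqr_ge0// lerXn2r// nnegrE// ltW.
Qed.

Lemma weight_abs_bound j h n xa : (h < H)%N -> `|weight j h n.+1 xa| <= gam gamma n.+1.
Proof. by move=> hH; have /andP[w0 w1] := weight_bound j n xa hH; rewrite ger0_norm. Qed.

Lemma bounded_be_weight n i j h k : (h < H)%N ->
  bounded_on allfun (fun xa => occ M (piF R g k) h xa != 0)
    (fun xa => bellman_error i h xa * weight j h n.+1 xa).
Proof.
by move=> hH; apply: (bounded_bellman_error i (B := gam gamma n.+1)) => // xa; exact: weight_abs_bound.
Qed.

Lemma bounded_weight_sqr n j h k c : (h < H)%N ->
  bounded_on allfun (fun xa => occ M (piF R g k) h xa != 0)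
    (fun xa => c * weight j h n.+1 xa ^+ 2).
Proof.
move=> hH; apply: (bounded_onZ (dist_expectation (occ_dist wf (piP k) hH))).
by split => //; exists (gam gamma n.+1 ^+ 2) => xa _; exact: weight_sqr_bound.
Qed.

Lemma driftE n i j h k : (h < H)%N -> drift n.+1 i j h k =
  mean (occ M (piF R g k) h) (fun xa => bellman_error i h xa * weight j h n.+1 xa)
  - alph gamma n.+1 * energy n.+1 j h k.
Proof.
move=> hH; have HD := dist_expectation (occ_dist wf (piP k) hH).
rewrite /drift /mean (sED HD (bounded_be_weight n i j k hH)); last first.
  by apply: (bounded_onN HD); exact: bounded_weight_sqr.
rewrite sEN (sEZ HD)//; have := bounded_weight_sqr n j k 1 hH.
by congr bounded_on; apply/funext => xa; rewrite mul1r.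
Qed.

(** 12 = 4 + 8: the temporal difference contributes 4 w, and the penalty at most 8 w, since w^2 /
    gam <= w by clipping. *)
Lemma Zloss_bound n i j h z : (h < H)%N -> `|z.1.2| <= 3 ->
  `|Zloss n.+1 i j h z| <= 12 * weight j h n.+1 z.1.1.
Proof.
move=> hH z3; have /andP[w0 w1] := weight_bound j n z.1.1 hH.
have := td_bound i hH z3; rewrite !ler_norml /Zloss /alph => /andP[t1 t2].
set w := weight _ _ _ _ in w0 w1 *; set gt := gam gamma n.+1 in w1 *.
have gp : 0 < gt by exact: gam0.
have h1 : 0 <= 8 / gt * w ^+ 2 by rewrite mulr_ge0 ?sqr_ge0// divr_ge0// ltW.
have h2 : 8 / gt * w ^+ 2 <= 8 * w.
  rewrite -[leLHS]mulrA ler_wpM2l// ler_pdivrMl// expr2.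
  by rewrite ler_wpM2r.
by apply/andP; split; nra.
Qed.

(** The condition on [lam] keeps the exponent below 12 / 24 = 1/2, the range of the quadratic bound;
    144 = 12^2. *)
Lemma Eexp_Zloss n i j h k lam : (h < H)%N -> `|lam| * gam gamma n.+1 <= 1 / 24 ->
  (Eexp M (piF R g k) (fun t => (expR (atstep h (fun z => (lam * Zloss n.+1 i j h z)%R) t +
    (- lam * drift n.+1 i j h k - 144 * lam ^+ 2 * energy n.+1 j h k)))%:E) <= 1)%E.
Proof.
move=> hH lg; pose q xa := 144 * lam ^+ 2 * weight j h n.+1 xa ^+ 2.
have HD := dist_expectation (occ_dist wf (piP k) hH).
apply: (le_trans (Eexp_expR wf reward3 (piP k) (q := q) (B := 144 * lam ^+ 2 * gam gamma n.+1 ^+ 2)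
  _ hH _ _ _ _)).
- move=> x a x' /=; rewrite /Zloss /=; apply: measurable_funM; first exact: measurable_cst.
  apply: measurable_funB; last exact: measurable_cst.
  by apply: measurable_funM; [exact: step_meas_td|exact: measurable_cst].
- move=> z z3; rewrite normrM; have := Zloss_bound n i j hH z3.
  have /andP[w0 w1] := weight_bound j n z.1.1 hH => hz.
  apply: (@le_trans _ _ (`|lam| * (12 * gam gamma n.+1))); last lra.
  rewrite ler_wpM2l//; lra.
- move=> z z3; have := Zloss_bound n i j hH z3; rewrite ler_norml => /andP[l u].
  rewrite exprMn (_ : q z.1.1 = lam ^+ 2 * (144 * weight j h n.+1 z.1.1 ^+ 2)); last by rewrite /q; ring.
  rewrite ler_wpM2l ?sqr_ge0//; move: l u; set Z := Zloss _ _ _ _ _; set w := weight _ _ _ _ => l u.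
  have : 0 <= (12 * w - Z) * (Z + 12 * w) by rewrite mulr_ge0//; lra.
  by rewrite (_ : _ * _ = 144 * w ^+ 2 - Z ^+ 2) ?subr_ge0//; ring.
- move=> xa; have k0 : 0 <= 144 * lam ^+ 2 by rewrite mulr_ge0// sqr_ge0.
  by rewrite /q normrM (ger0_norm k0); apply: ler_wpM2l => //; exact: weight_sqr_bound.
rewrite -[leRHS]/(1%R%:E) lee_fin -[leRHS]expR0 ler_expR.
have bd : bounded_on allfun (fun xa => occ M (piF R g k) h xa != 0)
   (fun xa => bellman_error i h xa * weight j h n.+1 xa - alph gamma n.+1 * weight j h n.+1 xa ^+ 2).
  apply: (bounded_onD HD); first exact: bounded_be_weight.
  by apply: (bounded_onN HD); exact: bounded_weight_sqr.
have SE x a : sreach M h x -> stepS M h x a (fun r x' => lam * Zloss n.+1 i j h (x, a, r, x')) =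
    lam * (bellman_error i h (x, a) * weight j h n.+1 (x, a) - alph gamma n.+1 * weight j h n.+1 (x, a) ^+ 2).
  move=> hx; have := stepS_td i a (lam * weight j h n.+1 (x, a))
    (- (lam * (alph gamma n.+1 * weight j h n.+1 (x, a) ^+ 2))) hH hx.
  rewrite (_ : (fun r x' => _) = (fun r x' => lam * Zloss n.+1 i j h (x, a, r, x'))).
    by move=> ->; ring.
  by apply/funext => r; apply/funext => x'; rewrite /Zloss /=; ring.
have -> : mean (occ M (piF R g k) h) (fun xa => stepS M h xa.1 xa.2 (fun r x' => lam * Zloss n.+1 i j h (xa, r, x')))
    = lam * drift n.+1 i j h k.
  rewrite /drift /mean -(sEZ HD)//; apply: (eq_sE HD); last first.
  - by move=> [x a] ox; apply: SE; exact: (occ_sreach wf (piP k) hH ox).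
  - exact: (bounded_onZ HD).
  - have [_ [B hB]] := bounded_onZ HD lam bd; split => //; exists B => -[x a] ox /=.
    by rewrite SE; [exact: (hB (x, a) ox)|exact: (occ_sreach wf (piP k) hH ox)].
have -> : mean (occ M (piF R g k) h) q = 144 * lam ^+ 2 * energy n.+1 j h k.
  rewrite /energy /mean -(sEZ HD)//.
  by have := bounded_weight_sqr n j k 1 hH; congr bounded_on; apply/funext => xa; rewrite mul1r.
lra.
Qed.

Lemma Eexp_initial i k lam : (0 < H)%N -> `|lam| <= 1 / 2 ->
  (Eexp M (piF R g k) (fun t => (expR (atstep 0 (fun z => (lam * greedy_value i 0 z.1.1.1)%R) t +
    (- lam * predicted_value i - lam ^+ 2)))%:E) <= 1)%E.
Proof.
move=> hH ll; have HD := dist_expectation (occ_dist wf (piP k) hH).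
have v01 x := greedy_value01 i 0 x.
have bv : bounded_on allfun (fun xa => occ M (piF R g k) 0 xa != 0) (fun xa : X * A => greedy_value i 0 xa.1).
  by split => //; exists 1 => xa _; have /andP[v0 v1] := v01 xa.1; rewrite ger0_norm.
apply: (le_trans (Eexp_expR wf reward3 (piP k) (q := fun=> lam ^+ 2) (B := lam ^+ 2)
  _ hH _ _ _ _)).
- by move=> x a x' /=; exact: measurable_cst.
- move=> z _; rewrite normrM; have /andP[v0 v1] := v01 z.1.1.1; rewrite (ger0_norm v0).
  by apply: (le_trans _ ll); rewrite ler_piMr.
- move=> z _; rewrite exprMn ler_piMr ?sqr_ge0// expr2.
  by have /andP[v0 v1] := v01 z.1.1.1; rewrite mulr_ile1.
- by move=> xa; rewrite ger0_norm// sqr_ge0.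
rewrite -[leRHS]/(1%R%:E) lee_fin -[leRHS]expR0 ler_expR {2}/mean (sE_cst HD).
have SE x a : sreach M 0 x -> stepS M 0 x a (fun _ _ => lam * greedy_value i 0 x) = lam * greedy_value i 0 x.
  by move=> hx; exact: (sE_cst (reward3_expectation wf reward3 a hH hx)).
have -> : mean (occ M (piF R g k) 0) (fun xa => stepS M 0 xa.1 xa.2 (fun _ _ => lam * greedy_value i 0 xa.1))
    = lam * predicted_value i.
  rewrite /predicted_value -[init M]/(sd M (piF R g k) 0) -(mean_marginal wf (piP k))//.
  rewrite /mean -(sEZ HD)//; apply: (eq_sE HD); last first.
  - by move=> [x a] ox; apply: SE; exact: (occ_sreach wf (piP k) hH ox).
  - exact: (bounded_onZ HD).
  - have [_ [B hB]] := bounded_onZ HD lam bv; split => //; exists B => -[x a] ox /=.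
    by rewrite SE; [exact: (hB (x, a) ox)|exact: (occ_sreach wf (piP k) hH ox)].
lra.
Qed.

(* [ch s] indexes the policy played in round [s], counted from 0. *)
Definition past_mixture (ch : nat -> I) n h (xa : X * A) : R :=
  (\sum_(s < n) occ M (piF R g (ch s)) h xa) / n%:R.
Definition novelty (ch : nat -> I) n h (xa : X * A) : R :=
  clipped_ratio (occ M (piF R g (ch n)) h xa) (past_mixture ch n h xa) (gam gamma n.+1).

(** [density_ratio_transfer] at each pair, integrated by [mean_mix_ge0] over [n.+1] distributions:
    the past occupancies with weight 1/n, and the current one last. *)
Lemma bellman_error_transfer (ch : nat -> I) n i j h : (h < H)%N -> (0 < n)%N ->
  mean (occ M (piF R g (ch n)) h) (bellman_error i h) <=
  n%:R^-1 * \sum_(s < n) (mean (occ M (piF R g (ch s)) h)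
       (fun xa => bellman_error i h xa * weight j h n.+1 xa)
     - (8 + 1 / 2) / gam gamma n.+1 * energy n.+1 j h (ch s)
     + (13 + 6 / 10) * mean (occ M (piF R g (ch s)) h)
       (fun xa => `|gam gamma n.+1 * novelty ch n h xa - weight j h n.+1 xa|))
  + 700 * mean (occ M (piF R g (ch n)) h) (novelty ch n h).
Proof.
move=> hH n0; pose d s := occ M (piF R g (ch s)) h.
pose D := past_mixture ch n h; pose chi := novelty ch n h.
rewrite -/chi; have od s : is_dist (d s) := occ_dist wf (piP (ch s)) hH.
have HD s := dist_expectation (od s).
have d0 s xa : 0 <= d s xa by case: (od s).
have D0 xa : 0 <= D xa by apply: divr_ge0 => //; apply: sumr_ge0 => s _; exact: d0.
have nn0 : (n%:R : R) != 0 by rewrite pnatr_eq0 -lt0n.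
have c01 xa : 0 <= chi xa <= 1.
  by apply: clipped_ratio_bound; [exact: d0|exact: D0|exact: gam0].
have bchi s : bounded_on allfun (fun xa => d s xa != 0) chi.
  by split => //; exists 1 => xa _; have /andP[c0 c1] := c01 xa; rewrite ger0_norm.
have bbe s : bounded_on allfun (fun xa => d s xa != 0) (bellman_error i h).
  by split => //; exists 4 => -[x a] ox; apply: bellman_error_bound => //; exact: (occ_sreach wf (piP _) hH ox).
have be s : bounded_on allfun (fun xa => d s xa != 0)
    (fun xa => `|gam gamma n.+1 * chi xa - weight j h n.+1 xa|).
  split => //; exists (gam gamma n.+1) => xa _; rewrite normr_id.
  have /andP[w0 w1] := weight_bound j n xa hH; have /andP[c0 c1] := c01 xa.
  have h1 : 0 <= gam gamma n.+1 * chi xa by rewrite mulr_ge0// ltW.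
  have h2 : gam gamma n.+1 * chi xa <= gam gamma n.+1 by rewrite ler_piMr// ltW.
  by rewrite ler_norml; apply/andP; split; lra.
pose v xa := bellman_error i h xa * weight j h n.+1 xa
  + - ((8 + 1 / 2) / gam gamma n.+1 * weight j h n.+1 xa ^+ 2)
  + (13 + 6 / 10) * `|gam gamma n.+1 * chi xa - weight j h n.+1 xa|.
have bw s := bounded_weight_sqr n j (ch s) 1 hH.
have bw' s : bounded_on allfun (fun xa => d s xa != 0) (fun xa => weight j h n.+1 xa ^+ 2).
  by have := bw s; congr bounded_on; apply/funext => xa; rewrite mul1r.
have b1 s := bounded_be_weight n i j (ch s) hH.
have b2 s := bounded_onN (HD s) (bounded_onZ (HD s) ((8 + 1 / 2) / gam gamma n.+1) (bw' s)).
have b3 s := bounded_onZ (HD s) (13 + 6 / 10) (be s).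
have bv s : bounded_on allfun (fun xa => d s xa != 0) v.
  exact: (bounded_onD (HD s) (bounded_onD (HD s) (b1 s) (b2 s)) (b3 s)).
pose u s xa := if (s < n)%N then n%:R^-1 * v xa else 700 * chi xa - bellman_error i h xa.
have := @mean_mix_ge0 R _ 'I_n.+1 (fun s => d s) (fun s => u s) (fun s => od s).
have bu s : bounded_on allfun (fun xa => d s xa != 0) (u s).
  rewrite /u; case: (s < n)%N; first exact: (bounded_onZ (HD s)).
  by apply: (bounded_onD (HD s)); [exact: (bounded_onZ (HD s))|exact: (bounded_onN (HD s))].
move=> /(_ (fun s => bu s)); rewrite big_ord_recr/=.
have -> : mean (d n) (u n) = 700 * mean (d n) chi - mean (d n) (bellman_error i h).
  rewrite /u ltnn /mean (sED (HD n)); [|exact: (bounded_onZ (HD n))|exact: (bounded_onN (HD n))].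
  by rewrite (sEZ (HD n))// sEN.
rewrite (eq_bigr (fun s : 'I_n => n%:R^-1 * (mean (d s) (fun xa => bellman_error i h xa * weight j h n.+1 xa)
     - (8 + 1 / 2) / gam gamma n.+1 * energy n.+1 j h (ch s)
     + (13 + 6 / 10) * mean (d s) (fun xa => `|gam gamma n.+1 * chi xa - weight j h n.+1 xa|)))); last first.
  move=> s _; rewrite /u ltn_ord /mean (sEZ (HD s))// /v; congr (_ * _).
  rewrite (sED (HD s) (bounded_onD (HD s) (b1 s) (b2 s)) (b3 s)) (sED (HD s) (b1 s) (b2 s)) sEN.
  by rewrite (sEZ (HD s) _ (bw' s)) (sEZ (HD s) _ (be s)).
rewrite -mulr_sumr => hm; rewrite -subr_ge0 -addrA; apply: hm => -[x a].
rewrite big_ord_recr/= /u ltnn.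
rewrite (eq_bigr (fun s : 'I_n => d s (x, a) * (n%:R^-1 * v (x, a)))); last by move=> s _; rewrite ltn_ord.
rewrite -mulr_suml mulrA -/(D (x, a)).
have := @density_ratio_transfer R (d n (x, a)) (D (x, a)) (gam gamma n.+1) (weight j h n.+1 (x, a))
  (bellman_error i h (x, a)) (d0 _ _) (D0 _) (gam0 n) (weight_bound j n (x, a) hH).
rewrite -/(chi (x, a)) => hp; rewrite mulrBr addrA subr_ge0.
rewrite (_ : d n (x, a) * (700 * chi (x, a)) = 700 * (d n (x, a) * chi (x, a))); last by ring.
(* A pair with nonzero current or past occupancy has a reachable state, where the Bellman error is
   bounded. *)
apply: hp => /orP[ox|Dx]; apply: bellman_error_bound => //.
  exact: (occ_sreach wf (piP _) hH ox).
apply: contrapT => nx; move/eqP: Dx; apply; rewrite /D /past_mixture big1 ?mul0r// => s _.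
by apply: contrapT => /eqP ox; apply: nx; exact: (occ_sreach wf (piP _) hH ox).
Qed.

(** At each pair the occupancies are capped by [C * mu xa], so [potential_bound] applies; summing
    over the pairs leaves [C], as [mu] has mass 1. *)
Lemma sum_clipped_ratio (ch : nat -> I) (mu : X * A -> R) (C : R) N h : (h < H)%N ->
  is_dist mu -> 0 <= C -> (forall i xa, occ M (piF R g i) h xa <= C * mu xa) ->
  \sum_(n < N) mean (occ M (piF R g (ch n)) h) (novelty ch n h) <=
  C * (2 + 4 / gamma * ln (N%:R + 1)).
Proof.
move=> hH dmu C0 occC; pose d s := occ M (piF R g (ch s)) h; have od s : is_dist (d s) := occ_dist wf (piP (ch s)) hH.
have d0 s xa : 0 <= d s xa by case: (od s).
pose chi n := novelty ch n h.
have c01 n xa : 0 <= chi n xa <= 1.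
  apply: clipped_ratio_bound; [exact: d0| |exact: gam0].
  by apply: divr_ge0 => //; apply: sumr_ge0 => s _; exact: d0.
(* [mu] enters as the last component of the mixture, with the constant [B] as its function. *)
set B := C * _; pose p n := if (n < N)%N then d n else mu.
pose u n xa := if (n < N)%N then - chi n xa else B.
have dp n : is_dist (p n) by rewrite /p; case: ifP.
have bu n : bounded_on allfun (fun xa => p n xa != 0) (u n).
  rewrite /u; case: (n < N)%N; last exact: (bounded_on_cst (dist_expectation (dp n))).
  by split => //; exists 1 => xa _; have /andP[c0 c1] := c01 n xa; rewrite normrN ger0_norm.
have := @mean_mix_ge0 R _ 'I_N.+1 (fun n => p n) (fun n => u n) (fun n => dp n) (fun n => bu n).
rewrite !big_ord_recr/=.
have -> : mean (p N) (u N) = B by rewrite /u /p ltnn /mean (sE_cst (dist_expectation dmu)).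
rewrite (eq_bigr (fun n : 'I_N => - mean (d n) (chi n))); last first.
  by move=> n _; rewrite /u /p ltn_ord /mean sEN.
rewrite sumrN addrC subr_ge0; apply => xa; rewrite big_ord_recr/= /u /p ltnn.
rewrite (eq_bigr (fun n : 'I_N => - (d n xa * chi n xa))); last first.
  by move=> n _; rewrite ltn_ord mulrN.
rewrite sumrN addrC subr_ge0 /B.
have -> : mu xa * (C * (2 + 4 / gamma * ln (N%:R + 1))) = (C * mu xa) * (2 + 4 / gamma * ln (N%:R + 1)) by ring.
apply: (@potential_bound R (fun n => d n xa) (C * mu xa) gamma N) => //.
  by rewrite mulr_ge0//; case: dmu.
by move=> n; rewrite d0 /d occC.
Qed.

(** * The union bound and the good event *)

Variables (T : nat) (delta : R) (idef : I).
(** Exponential rate for the initial values; it is finally set to sqrt(log_term / T), which balances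
    their two errors. *)
Variable lam3 : R.
Hypothesis H0 : (0 < H)%N.
Hypothesis lam3_bound : 0 < lam3 <= 1 / 2.

Local Notation pick_index := (Defs.choose M F g W T 1 gamma delta idef).
Implicit Types hist : seq (@traj R X A).

Definition log_term : R := ln (6 * #|I|%:R * #|J|%:R * T%:R * H%:R / delta).
Hypothesis log_term0 : 0 <= log_term.

(* The events of the union bound, for every round: the deviations of the losses
   ([true] for the optimism of [Qstar], [false] for the soundness of the version
   space) and of the initial values (both signs). *)
Definition index : finType := (('I_T * 'I_H * (I * J) * bool) + ('I_T * I * bool))%type.

(** 1/(24 gam) is the largest rate allowed by [Eexp_Zloss]; its variance charge 144/24 = 6 stays
    below the penalty 8. The negative rate charges only 144/288 = 1/2. *)
Definition rate n (b : bool) : R :=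
  if b then (24 * gam gamma n.+1)^-1 else - (288 * gam gamma n.+1)^-1.
Definition index_len (k : index) : nat :=
  match k with inl (n, _, _, _) => n | inr (n, _, _) => n end.
Definition index_step (k : index) : nat :=
  match k with inl (_, h, _, _) => h | inr _ => 0%N end.
Definition index_fun (k : index) (z : tup R X A) : R :=
  match k with
  | inl (n, h, (i, j), b) => rate n b * Zloss n.+1 i j h z
  | inr (_, i, b) => (-1) ^+ b * lam3 * greedy_value i 0 z.1.1.1
  end.
Definition index_comp (k : index) (l : I) : R :=
  match k with
  | inl (n, h, (i, j), b) =>
      - rate n b * drift n.+1 i j h l - 144 * rate n b ^+ 2 * energy n.+1 j h l
  | inr (_, i, b) => - ((-1) ^+ b * lam3) * predicted_value i - ((-1) ^+ b * lam3) ^+ 2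
  end.

Lemma index_meas k : step_meas (index_fun k).
Proof.
case: k => [[[[n h] [i j]] b]|[[n i] b]] x a x' /=; last exact: measurable_cst.
rewrite /Zloss /=; apply: measurable_funM; first exact: measurable_cst.
apply: measurable_funB; last exact: measurable_cst.
by apply: measurable_funM; [exact: step_meas_td|exact: measurable_cst].
Qed.

Lemma rate_bound n b : `|rate n b| * gam gamma n.+1 <= 1 / 24.
Proof.
have gp := gam0 n; have gn : gam gamma n.+1 != 0 by exact: lt0r_neq0.
have e (k : R) : 0 < k -> `|(k * gam gamma n.+1)^-1| * gam gamma n.+1 = k^-1.
  by move=> k0; rewrite gtr0_norm ?invr_gt0 ?mulr_gt0// invfM -mulrA mulVf// mulr1.
rewrite /rate div1r; case: b; rewrite ?normrN e ?ltr0n// lef_pV2 ?posrE ?ltr0n//.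
by rewrite ler_nat.
Qed.

Lemma index_Eexp k l : (Eexp M (piF R g l)
  (fun t => (expR (atstep (index_step k) (index_fun k) t + index_comp k l))%:E) <= 1)%E.
Proof.
case: k => [[[[n h] [i j]] b]|[[n i] b]] /=.
  by apply: Eexp_Zloss; [exact: ltn_ord|exact: rate_bound].
have /andP[l0 l1] := lam3_bound; apply: Eexp_initial => //.
by rewrite normrM normr_sign (gtr0_norm l0); lra.
Qed.

Section History.
Variable hist : seq (@traj R X A).
Hypothesis size_hist : size hist = T.
Hypothesis size_trajs : all (fun t => size t == H) hist.
Hypothesis good : forall k,
  log_martingale M F g W T gamma delta idef index_len index_step index_fun index_comp k hist < log_term.

Let ch s : I := pick_index s.+1 (take s hist).

(** Trajectories have full length, so [pmap] drops nothing and the data contain one tuple per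
    round. *)
Lemma emp_data h n (phi : tup R X A -> R) : (h < H)%N -> (n <= T)%N ->
  emp (data h (take n hist)) phi = (\sum_(s < n) atstep h phi (nth [::] hist s)) / n%:R.
Proof.
move=> hH nT; have sn : size (take n hist) = n by rewrite size_takel// size_hist.
have sz : forall hs : seq (@traj R X A), all (fun t => size t == H) hs ->
    size (data h hs) = size hs /\ \sum_(z <- data h hs) phi z = \sum_(t <- hs) atstep h phi t.
  elim=> [|t hs IH] /=; first by rewrite !big_nil.
  move=> /andP[/eqP st /IH [s1 s2]]; rewrite big_cons -s2 /data /= /atstep.
  case E : (stepAt h t) => [z|] /=; first by rewrite big_cons s1.
  case: t st E => [|z0 t] st; first by move: hH; rewrite -st.
  by rewrite /stepAt (nth_map z0) ?st.
have := size_trajs; rewrite -{1}(cat_take_drop n hist) all_cat => /andP[/sz[s1 s2] _].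
rewrite /emp s1 s2 sn (big_nth [::]) sn big_mkord; congr (_ / _).
by apply: eq_bigr => s _; rewrite nth_take.
Qed.

Lemma atstep_scale h (c : R) (phi : tup R X A -> R) t :
  atstep h (fun z => c * phi z) t = c * atstep h phi t.
Proof. by rewrite /atstep; case: stepAt => //; rewrite mulr0. Qed.

Lemma good_Zloss n i j h b : (n < T)%N -> (h < H)%N ->
  rate n b * (\sum_(s < n) atstep h (Zloss n.+1 i j h) (nth [::] hist s)) <
  rate n b * (\sum_(s < n) drift n.+1 i j h (ch s)) +
  144 * rate n b ^+ 2 * (\sum_(s < n) energy n.+1 j h (ch s)) + log_term.
Proof.
move=> nT hH; have := good (inl (Ordinal nT, Ordinal hH, (i, j), b)).
rewrite log_martingaleE/=; last by rewrite size_hist ltnW.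
rewrite big_mkord big_split/= sumrB; under eq_bigr do rewrite atstep_scale.
under [X in _ + (X - _)]eq_bigr do rewrite mulNr.
by rewrite sumrN -!mulr_sumr -/(ch _) => h1; lra.
Qed.

Lemma good_initial n i (b : bool) : (n < T)%N ->
  (-1) ^+ b * lam3 * (\sum_(s < n) atstep 0 (fun z => greedy_value i 0 z.1.1.1) (nth [::] hist s)) <
  (-1) ^+ b * lam3 * (n%:R * predicted_value i) + n%:R * lam3 ^+ 2 + log_term.
Proof.
move=> nT; have := good (inr (Ordinal nT, i, b)).
rewrite log_martingaleE/=; last by rewrite size_hist ltnW.
rewrite big_mkord big_split/=; under eq_bigr do rewrite atstep_scale.
rewrite -mulr_sumr sumr_const card_ord -mulr_natl.
have -> : ((-1) ^+ b * lam3) ^+ 2 = lam3 ^+ 2 by rewrite exprMn sqrr_sign mul1r.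
lra.
Qed.

Let energy_ge0 n j h k : (h < H)%N -> 0 <= energy n.+1 j h k.
Proof.
move=> hH; have HD := dist_expectation (occ_dist wf (piP k) hH).
rewrite -[leLHS](sE_cst HD); apply: (le_sE HD (bounded_on_cst HD _)).
  by have := bounded_weight_sqr n j k 1 hH; congr bounded_on; apply/funext => xa; rewrite mul1r.
by move=> xa _; exact: sqr_ge0.
Qed.

Lemma drift_Q n j h k : (h < H)%N ->
  drift n.+1 iQ j h k = - (8 / gam gamma n.+1) * energy n.+1 j h k.
Proof.
move=> hH; rewrite driftE// (_ : mean _ _ = 0) ?add0r ?mulNr//.
rewrite /mean (_ : (fun xa => _) = fun=> 0).
  exact: (sE_cst (dist_expectation (occ_dist wf (piP k) hH))).
by apply/funext => -[x a]; rewrite bellman_error_Q// mul0r.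
Qed.

Lemma lossE n i j h : (h < H)%N -> (n <= T)%N ->
  loss M F g W gamma n.+1 i j h (data h (take n hist)) =
  (\sum_(s < n) atstep h (Zloss n.+1 i j h) (nth [::] hist s)) / n%:R.
Proof. by move=> hH nT; rewrite /loss -emp_data. Qed.

Let betE n : bet M I J T 1 gamma delta n.+1 = 36 * gam gamma n.+1 * log_term / n%:R.
Proof. by rewrite /bet subn1/= mul1n -/log_term mulrAC. Qed.

Lemma Q_in_version_space n : (n < T)%N ->
  inVS M F g W T 1 gamma delta n.+1 (take n hist) iQ.
Proof.
move=> nT; apply/forallP => h; apply/forallP => j; have hH := ltn_ord h.
(* For [n = 0] both sides are 0 by the convention on division, so the first version space is the
   whole class. *)
rewrite lossE ?(ltnW nT)// betE ler_wpM2r ?invr_ge0//.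
have := good_Zloss iQ j true nT hH.
under [X in _ < _ * X + _ + _]eq_bigr do rewrite drift_Q//.
rewrite -mulr_sumr; set a := \sum_(_ < _) _; set V := \sum_(_ < _) energy _ _ _ _.
have V0 : 0 <= V by apply: sumr_ge0 => s _; exact: energy_ge0.
have gp := gam0 n; rewrite /rate; set gt := gam gamma n.+1 in gp *.
have gn : gt != 0 by exact: lt0r_neq0.
have p24 : 0 < 24 * gt by lra.
rewrite -(ltr_pM2l p24) mulVKf ?(lt0r_neq0 p24)// => h1; apply: ltW; apply: (lt_le_trans h1).
(* The penalty 8 exceeds the variance charge 6 by 2, and the deviation 24 is below the 36 of the
   threshold. *)
have e : 24 * gt * ((24 * gt)^-1 * (- (8 / gt) * V) + 144 * (24 * gt)^-1 ^+ 2 * V + log_term) =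
  - (2 / gt * V) + 24 * gt * log_term by field.
rewrite e; have : 0 <= 2 / gt * V by rewrite mulr_ge0// divr_ge0// ltW.
have : 0 <= gt * log_term by rewrite mulr_ge0// ltW.
lra.
Qed.

Lemma chosen_spec n : (n < T)%N ->
  inVS M F g W T 1 gamma delta n.+1 (take n hist) (ch n) /\
  Defs.val1 F g (take n hist) iQ <= Defs.val1 F g (take n hist) (ch n).
Proof.
move=> nT; have VQ := Q_in_version_space nT.
rewrite /ch /Defs.choose; case: pickP => [i0 V0|/(_ iQ)]; last by rewrite VQ.
by case: Order.TotalTheory.arg_maxP => // i Vi mi; split => //; exact: mi.
Qed.

(** The argmax compares empirical initial values; the deviations of the two functions, in opposite
    directions, cost [lam3 + log_term / (lam3 * n%:R)] each. *)
Lemma initial_gap n : (0 < n < T)%N ->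
  predicted_value iQ - predicted_value (ch n) <= 2 * lam3 + 2 * log_term / lam3 * n%:R^-1.
Proof.
move=> /andP[n0 nT]; have [_] := chosen_spec nT.
have vE i : Defs.val1 F g (take n hist) i =
    (\sum_(s < n) atstep 0 (fun z => greedy_value i 0 z.1.1.1) (nth [::] hist s)) / n%:R.
  by rewrite /Defs.val1 -emp_data ?(ltnW nT)// /greedy_value H0.
rewrite !vE; have n0R : (0 : R) < n%:R by rewrite ltr0n.
rewrite ler_pM2r ?invr_gt0//.
have := good_initial iQ true nT; have := good_initial (ch n) false nT.
rewrite /= expr1 expr0 mul1r; set a := \sum_(_ < _) _; set b := \sum_(_ < _) _ => h1 h2 h3.
have /andP[l0 _] := lam3_bound.
have : lam3 * (n%:R * (predicted_value iQ - predicted_value (ch n))) <=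
    2 * (n%:R * lam3 ^+ 2 + log_term).
  have := ler_wpM2l (ltW l0) h3; rewrite mulrBr mulrBr; lra.
have np : 0 < lam3 * n%:R by rewrite mulr_gt0.
rewrite mulrA -ler_pdivlMl// => /le_trans; apply.
by rewrite le_eqVlt; apply/orP; left; apply/eqP; field; rewrite !lt0r_neq0.
Qed.

Variable eps_app : R.
Hypothesis realizable : W_realizable M g W T eps_app.

(** Realizability yields one weight for all evaluation policies, so the same [j] serves every past
    round. On the support of a past occupancy the mixture is positive, and [clip_dist_le]
    applies. *)
Lemma approximate_ratio n h : (0 < n < T)%N -> (h < H)%N -> exists j, forall s, (s < n)%N ->
  mean (occ M (piF R g (ch s)) h)
    (fun xa => `|gam gamma n.+1 * novelty ch n h xa - weight j h n.+1 xa|) <= eps_app.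
Proof.
move=> /andP[n0 nT] hH.
have [|j jP] := realizable hH (ch n) (s := [seq ch k | k <- iota 0 n]).
  by rewrite size_map size_iota n0 ltnW.
exists j => s sn; have od := occ_dist wf (piP (ch s)) hH.
have HD := dist_expectation od.
have mixE xa : mixocc M g [seq ch k | k <- iota 0 n] h xa = past_mixture ch n h xa.
  rewrite /mixocc size_map size_iota big_map -[n in iota 0 n]subn0 -/(index_iota 0 n).
  by rewrite big_mkord.
have p0 l xa : 0 <= occ M (piF R g l) h xa by case: (occ_dist wf (piP l) hH).
have n0R : (0 : R) < n%:R by rewrite ltr0n.
rewrite -lee_fin -(sE_nneg HD)//; last first.
  split => //; exists (gam gamma n.+1) => xa _; rewrite normr_id.
  have /andP[w0 w1] := weight_bound j n xa hH.
  have D0 : 0 <= past_mixture ch n h xa.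
    by apply: divr_ge0 => //; apply: sumr_ge0 => k _; exact: p0.
  have /andP[c0 c1] := clipped_ratio_bound (p0 (ch n) xa) D0 (gam0 n).
  have h1 : 0 <= gam gamma n.+1 * novelty ch n h xa by rewrite mulr_ge0// ltW.
  have h2 : gam gamma n.+1 * novelty ch n h xa <= gam gamma n.+1 by rewrite ler_piMr// ltW.
  by rewrite ler_norml; apply/andP; split; lra.
apply: (le_trans _ (jP (ch s))); apply: le_esum => xa _.
have [->|ox] := eqVneq (occ M (piF R g (ch s)) h xa) 0; first by rewrite !mul0e.
rewrite lee_wpmul2l ?lee_fin// mixE; apply: clip_dist_le => //.
  apply: divr_gt0 => //; rewrite (bigD1 (Ordinal sn))//=.
  by apply: ltr_wpDr; [apply: sumr_ge0 => k _; exact: p0|rewrite lt_neqAle eq_sym ox p0].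
exact: W0.
Qed.

(** The negative rate turns the empirical test into one on means: the threshold 36 plus the
    deviation 288 gives 324, and the penalty grows to 8 + 1/2. *)
Lemma version_space_sound n h j : (0 < n < T)%N -> (h < H)%N ->
  \sum_(s < n) (mean (occ M (piF R g (ch s)) h)
       (fun xa => bellman_error (ch n) h xa * weight j h n.+1 xa)
     - (8 + 1 / 2) / gam gamma n.+1 * energy n.+1 j h (ch s)) <=
  324 * gam gamma n.+1 * log_term.
Proof.
move=> /andP[n0 nT] hH; have n0R : (0 : R) < n%:R by rewrite ltr0n.
have [VS _] := chosen_spec nT; have gZ := good_Zloss (ch n) j false nT hH.
have := forallP (forallP VS (Ordinal hH)) j.
rewrite lossE ?(ltnW nT)// betE ler_pM2r ?invr_gt0// => {}VS.
pose m s := mean (occ M (piF R g (ch s)) h)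
  (fun xa => bellman_error (ch n) h xa * weight j h n.+1 xa).
have dE : \sum_(s < n) drift n.+1 (ch n) j h (ch s) =
    \sum_(s < n) m s - 8 / gam gamma n.+1 * \sum_(s < n) energy n.+1 j h (ch s).
  by rewrite mulr_sumr -sumrB; apply: eq_bigr => s _; rewrite driftE.
rewrite {}dE in gZ; rewrite sumrB -mulr_sumr -/(m _).
move: VS gZ; move: (\sum_(s < n) atstep _ _ _) (\sum_(s < n) energy _ _ _ _) (\sum_(s < n) m s).
move=> a V b VS; have gp := gam0 n.
rewrite /rate; move: (gam gamma n.+1) gp VS => gt gp VS; have gn : gt != 0 by exact: lt0r_neq0.
have p288 : 0 < 288 * gt by lra.
rewrite -(ltr_pM2l p288) => gZ.
have e1 : 288 * gt * (- (288 * gt)^-1 * a) = - a by field.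
have e2 : 288 * gt * (- (288 * gt)^-1 * (b - 8 / gt * V) +
     144 * (- (288 * gt)^-1) ^+ 2 * V + log_term) =
     - (b - (8 + 1 / 2) / gt * V) + 288 * gt * log_term by field.
move: gZ; rewrite e1 e2; lra.
Qed.

Lemma round_regret n : (0 < n < T)%N ->
  Jstar M - Jval M (piF R g (ch n)) <= 2 * lam3 + 2 * log_term / lam3 * n%:R^-1 +
   \sum_(h < H) (648 * gamma * log_term + (13 + 6 / 10) * eps_app +
     700 * mean (occ M (piF R g (ch n)) h) (novelty ch n h)).
Proof.
move=> n0T; have /andP[n0 nT] := n0T.
have js := Jstar_le_predicted; have jg := Jval_greedy (ch n); have ig := initial_gap n0T.
have n0R : (0 : R) < n%:R by rewrite ltr0n.
suff : \sum_(h < H) mean (occ M (piF R g (ch n)) h) (bellman_error (ch n) h) <=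
   \sum_(h < H) (648 * gamma * log_term + (13 + 6 / 10) * eps_app +
     700 * mean (occ M (piF R g (ch n)) h) (novelty ch n h)).
  by move: js jg ig; move: (Jstar M) (Jval M _) => x y; lra.
apply: ler_sum => h _; have hH := ltn_ord h.
have [j jP] := approximate_ratio n0T hH.
apply: (le_trans (bellman_error_transfer ch (ch n) j hH n0)); rewrite lerD2r.
rewrite big_split/= -mulr_sumr mulrDr; apply: lerD.
  apply: (@le_trans _ _ (n%:R^-1 * (324 * gam gamma n.+1 * log_term))).
    by rewrite ler_wpM2l ?invr_ge0//; exact: version_space_sound.
  have gl0 : 0 <= gamma * log_term by rewrite mulr_ge0// ltW.
  (* [gam gamma n.+1 / n%:R] is at most twice [gamma], whence 648 = 2 * 324. *)
  rewrite mulrC ler_pdivrMr// /gam -[n.+1%:R]natr1.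
  have : gamma * log_term <= gamma * log_term * n%:R by rewrite ler_peMr// ler1n.
  rewrite (_ : 324 * _ * _ = 324 * (gamma * log_term * n%:R) + 324 * (gamma * log_term)); last by ring.
  rewrite (_ : 648 * _ * _ * _ = 648 * (gamma * log_term * n%:R)); last by ring.
  lra.
rewrite mulrCA ler_wpM2l// ler_pdivrMl//.
apply: (@le_trans _ _ (\sum_(s < n) eps_app)); last by rewrite sumr_const card_ord mulr_natl.
by apply: ler_sum => s _; exact: jP.
Qed.

Lemma regretE : regret M F g W T 1 gamma delta idef hist =
  \sum_(n < T) (Jstar M - Jval M (piF R g (ch n))).
Proof.
rewrite /regret big_add1/= big_mkord; apply: eq_bigr => n _.
by rewrite /chosen subn1 muln1.
Qed.

Variables (mu : nat -> X * A -> R) (C : R).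
Hypothesis mu_dist : forall h, (h < H)%N -> is_dist (mu h).
Hypothesis C0 : 0 <= C.
Hypothesis occ_cover : forall i h xa, (h < H)%N -> occ M (piF R g i) h xa <= C * mu h xa.

(** The leading 1 pays for round 0, which is played without data. *)
Definition regret_cap : R :=
  1 + 2 * T%:R * lam3 + 2 * log_term / lam3 * (1 + ln T%:R) +
  H%:R * ((648 * gamma * log_term + (13 + 6 / 10) * eps_app) * T%:R +
    700 * (C * (2 + 4 / gamma * ln (T%:R + 1)))).

Lemma good_regret : (0 < T)%N -> 0 <= eps_app ->
  regret M F g W T 1 gamma delta idef hist <= regret_cap.
Proof.
move=> T0 eps0; rewrite regretE.
pose nov n h := mean (occ M (piF R g (ch n)) h) (novelty ch n h).
have nov0 n h : (h < H)%N -> 0 <= nov n h.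
  move=> hH; have od := occ_dist wf (piP (ch n)) hH; have HD := dist_expectation od.
  have c01 xa : 0 <= novelty ch n h xa <= 1.
    apply: clipped_ratio_bound; [by case: od|apply: divr_ge0 => //|exact: gam0].
    by apply: sumr_ge0 => s _; case: (occ_dist wf (piP (ch s)) hH).
  rewrite -[leLHS](sE_cst HD); apply: (le_sE HD (bounded_on_cst HD _)) => [|xa _].
    by split => //; exists 1 => xa _; have /andP[c0 c1] := c01 xa; rewrite ger0_norm.
  by case/andP: (c01 xa).
have cap h : (h < H)%N -> \sum_(n < T) nov n h <= C * (2 + 4 / gamma * ln (T%:R + 1)).
  by move=> hH; apply: (sum_clipped_ratio ch T hH (mu_dist hH) C0) => i xa; exact: occ_cover.
have r0 := suboptimality_le1 (ch 0%N).
have /andP[l0 _] := lam3_bound.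
pose c := 648 * gamma * log_term + (13 + 6 / 10) * eps_app.
have c0 : 0 <= c.
  by rewrite /c -mulrA; have := mulr_ge0 (ltW gamma0) log_term0; lra.
have rr n : (n.+1 < T)%N -> Jstar M - Jval M (piF R g (ch n.+1)) <=
    2 * lam3 + 2 * log_term / lam3 * n.+1%:R^-1 + \sum_(h < H) (c + 700 * nov n.+1 h).
  by move=> nT; apply: round_regret.
case ET : T T0 => [//|N] _; rewrite big_ord_recl/= /regret_cap ET -/c.
have rs : \sum_(n < N) (Jstar M - Jval M (piF R g (ch (bump 0 n)))) <=
   \sum_(n < N) (2 * lam3 + 2 * log_term / lam3 * n.+1%:R^-1 + \sum_(h < H) (c + 700 * nov n.+1 h)).
  by apply: ler_sum => n _; apply: rr; rewrite ET ltnS ltn_ord.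
set S := \sum_(n < N) _ in rs *; move: rs; move: S => S rs.
have k7 : (0 : R) < 700 by lra.
have hs : \sum_(h < H) \sum_(n < N) (c + 700 * nov n.+1 h) <=
    H%:R * (c * N.+1%:R + 700 * (C * (2 + 4 / gamma * ln (N.+1%:R + 1)))).
  set K := c * _ + _; have -> : H%:R * K = \sum_(h < H) K by rewrite sumr_const card_ord mulr_natl.
  apply: ler_sum => h _; have hH := ltn_ord h.
  rewrite big_split/= -mulr_sumr sumr_const card_ord; apply: lerD.
    by rewrite -(mulr_natr c N) ler_wpM2l// ler_nat.
  rewrite (ler_pM2l k7); have := cap _ hH; rewrite ET big_ord_recl/=; have := nov0 0%N h hH.
  by lra.
have ll : 0 <= 2 * log_term / lam3 by rewrite divr_ge0 ?(ltW l0)// mulr_ge0.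
have h1 := ler_wpM2l ll (harmonic_le N).
have h2 : 2 * lam3 * N%:R <= 2 * N.+1%:R * lam3.
  by rewrite mulrAC ler_wpM2r ?(ltW l0)// ler_wpM2l// ler_nat.
have e : \sum_(n < N) (2 * lam3 + 2 * log_term / lam3 * n.+1%:R^-1 + \sum_(h < H) (c + 700 * nov n.+1 h))
    = 2 * lam3 * N%:R + 2 * log_term / lam3 * \sum_(n < N) n.+1%:R^-1 +
      \sum_(h < H) \sum_(n < N) (c + 700 * nov n.+1 h).
  rewrite [in RHS]exchange_big big_split/= big_split/= sumr_const card_ord mulr_natr.
  by rewrite mulr_sumr.
rewrite {}e in rs; rewrite mulrDr mulr1 in h1 *.
move: (\sum_(h < H) _) (2 * log_term / lam3 * _) (2 * lam3 * _) (2 * N.+1%:R * _) (H%:R * _) rs hs h1 h2 r0.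
by move: (2 * log_term / lam3 * _) => *; lra.
Qed.

End History.

Lemma glow_core (mu : nat -> X * A -> R) (C eps_app cap : R) : (0 < T)%N -> 0 < delta ->
  (0 < #|J|)%N -> 0 <= eps_app ->
  W_realizable M g W T eps_app -> (forall h, (h < H)%N -> is_dist (mu h)) -> 0 <= C ->
  (forall i h xa, (h < H)%N -> occ M (piF R g i) h xa <= C * mu h xa) ->
  regret_cap eps_app C <= cap ->
  ((1 - delta)%:E <= glow_prob M F g W T 1 gamma delta idef
     (fun hist => (regret M F g W T 1 gamma delta idef hist <= cap)%R))%E.
Proof.
move=> T0 d0 J0 e0 real mud C0 occC hcap; rewrite /glow_prob muln1.
have conc := run_concentration wf reward3 index_meas index_Eexp (F := F) (W := W) (T := T)
  (gamma := gamma) (delta := delta) (idef := idef) (Lam := log_term) (n_ := index_len).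
apply: le_trans (conc _ _); last first.
  move=> hist sT sH good; apply: (le_trans _ hcap).
  exact: (good_regret sT sH good real mud C0 occC T0 e0).
rewrite lee_fin lerD2l lerN2.
have I0 : (0 < #|I|)%N by apply/card_gt0P; exists iQ.
have -> : expR (- log_term) = delta / (6 * #|I|%:R * #|J|%:R * T%:R * H%:R).
  rewrite expRN /log_term lnK ?invf_div// posrE divr_gt0// !mulr_gt0// ltr0n//.
have p : (0 : R) < 6 * #|I|%:R * #|J|%:R * T%:R * H%:R by rewrite !mulr_gt0// ltr0n.
rewrite mulrA ler_pdivrMr// mulrC ler_wpM2l ?(ltW d0)//.
have -> : 6 * #|I|%:R * #|J|%:R * T%:R * H%:R = (6 * #|I| * #|J| * T * H)%:R :> R.
  by rewrite !natrM.
rewrite ler_nat /index card_sum !card_prod !card_ord card_bool.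
(* The index set has 2|I||J|TH + 2|I|T elements, at most 4|I||J|TH, which the factor 6 in [log_term]
   covers. *)
have : (#|I| * T <= #|I| * #|J| * T * H)%N.
  by rewrite -!mulnA (mulnCA #|J|) mulnA leq_pmulr// muln_gt0 J0 H0.
have -> : (T * H * (#|I| * #|J|) * 2 = 2 * (#|I| * #|J| * T * H))%N by ring.
have -> : (T * #|I| * 2 = 2 * (#|I| * T))%N by ring.
have -> : (6 * #|I| * #|J| * T * H = 6 * (#|I| * #|J| * T * H))%N by ring.
by lia.
Qed.

End Glow.

(** * Numerical constants *)

Section Constants.
Context {R : realType}.
Implicit Types H T C L eps : R.

Lemma ln_ge1 (x : R) : 4 <= x -> 1 <= ln x.
Proof.
move=> x4; have x0 : 0 < x by lra.
rewrite -ler_expR lnK ?posrE//; apply: le_trans x4.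
have h : expR (1 / 2) <= 1 + 1 / 2 + (1 / 2) ^+ 2 :> R by apply: expR_le_quadratic.
have e : expR 1 = expR (1 / 2) ^+ 2 :> R.
  by rewrite expr2 -expRD; congr expR; field.
rewrite e; have := expR_ge0 (1 / 2 : R); move: h; move: (expR _) => y h y0.
have : y ^+ 2 <= (7 / 4) ^+ 2 by rewrite lerXn2r ?nnegrE//; lra.
lra.
Qed.

Lemma ln2_ge_half : 1 / 2 <= ln 2 :> R.
Proof.
rewrite -ler_expR lnK ?posrE//.
have h : expR (1 / 2) <= 1 + 1 / 2 + (1 / 2) ^+ 2 :> R by apply: expR_le_quadratic.
lra.
Qed.

Lemma sqr_le_le (x y : R) : 0 <= y -> x ^+ 2 <= y ^+ 2 -> x <= y.
Proof.
move=> y0 h; have [x0|x0] := leP x 0; first exact: le_trans y0.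
by rewrite -ler_sqr ?nnegrE// ltW.
Qed.

(** With this [gamma], both gamma T L and C / gamma equal S = sqrt(C T L), and [lam3] equates T lam3
    with Lam / lam3. The collected coefficient 1 + 6 + 12 + 5832 + 2800 + 5600 is below 128 *
    128. *)
Lemma cap_bound H T C L Lam ell eps gamma lam3 : 1 <= H -> 1 <= T -> 1 <= C -> 1 / 2 <= L -> 1 <= ell ->
  ln T <= ell -> ln (T + 1) <= ell -> 0 < Lam -> Lam <= 9 * (L * ell) -> C <= T * L ->
  gamma = Num.sqrt (C / (T * L)) -> lam3 = Num.sqrt (Lam / T) ->
  1 + 2 * T * lam3 + 2 * Lam / lam3 * (1 + ln T) +
    H * ((648 * gamma * Lam + (13 + 6 / 10) * eps) * T +
      700 * (2 * C * (2 + 4 / gamma * ln (T + 1)))) <=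
  128 * 128 * (H * (ell ^+ 2 * Num.sqrt (C * T * L))) + (13 + 6 / 10) * (H * T * eps).
Proof.
move=> H1 T1 C1 L1 l1 lT lT1 Lam0 Lamb CTL gammaE lam3E.
have T0 : 0 < T by lra.
have C0 : 0 < C by lra.
have L0 : 0 < L by lra.
have TL0 : 0 < T * L by rewrite mulr_gt0.
set S := Num.sqrt (C * T * L).
have S0 : 0 < S by rewrite sqrtr_gt0 !mulr_gt0.
have S2 : S ^+ 2 = C * T * L by rewrite sqr_sqrtr// !mulr_ge0// ltW.
have l30 : 0 < lam3 by rewrite lam3E sqrtr_gt0 divr_gt0.
have l32 : lam3 ^+ 2 = Lam / T by rewrite lam3E sqr_sqrtr// divr_ge0// ltW.
have g0 : 0 < gamma by rewrite gammaE sqrtr_gt0 divr_gt0.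
have gE : gamma = S / (T * L).
  rewrite gammaE (_ : C / (T * L) = (S / (T * L)) ^+ 2).
    by rewrite sqrtr_sqr ger0_norm// divr_ge0// ltW.
  by rewrite exprMn S2; field; rewrite !lt0r_neq0.
have T3 : T * lam3 <= 3 * (ell * S).
  apply: sqr_le_le; first by rewrite !mulr_ge0//; lra.
  have -> : (T * lam3) ^+ 2 = T * Lam by rewrite exprMn l32; field; rewrite lt0r_neq0.
  have -> : (3 * (ell * S)) ^+ 2 = 9 * (ell * ell * (C * (T * L))) by rewrite !exprMn S2; ring.
  apply: (@le_trans _ _ (T * (9 * (L * ell)))); first by rewrite ler_pM2l.
  have -> : T * (9 * (L * ell)) = 9 * (ell * 1 * (1 * (T * L))) by ring.
  rewrite ler_pM2l//; apply: ler_pM.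
  - by rewrite mulr1; lra.
  - by rewrite mul1r ltW.
  - by rewrite ler_pM2l//; lra.
  - by rewrite ler_pM2r.
have Ll : Lam / lam3 = T * lam3.
  have LamE : Lam = lam3 ^+ 2 * T by rewrite l32 divfK// lt0r_neq0.
  by rewrite LamE; field; rewrite lt0r_neq0.
have lT0 : 0 <= ln T by rewrite ln_ge0.
have gT : gamma * Lam * T <= 9 * (ell * S).
  have -> : gamma * Lam * T = S * (Lam / L) by rewrite gE; field; rewrite !lt0r_neq0.
  rewrite (_ : 9 * (ell * S) = S * (9 * ell)); last by ring.
  by rewrite ler_pM2l// ler_pdivrMr//; lra.
have Cg : C / gamma = S.
  have -> : C / gamma = C * T * L / S by rewrite gE; field; rewrite !lt0r_neq0.
  by rewrite -S2 expr2 mulfK// lt0r_neq0.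
have CS : C <= S.
  apply: sqr_le_le; first exact: ltW.
  by rewrite S2 expr2 -mulrA ler_pM2l.
pose y := ell ^+ 2 * S.
have lS : S <= ell * S by rewrite ler_peMl// ltW.
have ly : ell * S <= y by rewrite /y expr2 -mulrA ler_peMl// mulr_ge0//; lra.
have y0 : 0 < y by rewrite /y mulr_gt0// exprn_gt0//; lra.
have Hy : y <= H * y by rewrite ler_peMl// ltW.
have H0 : 0 < H by lra.
have t3 : 2 * Lam / lam3 * (1 + ln T) <= 6 * (ell * S) + 6 * y.
  rewrite -[2 * Lam / lam3]mulrA Ll.
  have h : 0 <= T * lam3 by rewrite mulr_ge0// ltW.
  apply: (@le_trans _ _ (2 * (3 * (ell * S)) * (1 + ell))).
    by apply: ler_pM; [lra|lra|lra|lra].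
  by rewrite le_eqVlt /y; apply/orP; left; apply/eqP; ring.
have h1 : H * (gamma * Lam * T) <= H * (9 * y) by rewrite ler_pM2l//; lra.
have h2 : H * C <= H * y by rewrite ler_pM2l//; lra.
have h3 : H * (S * ln (T + 1)) <= H * y.
  by rewrite ler_pM2l// (le_trans _ ly)// mulrC ler_pM2r.
have e1 : H * ((648 * gamma * Lam + (13 + 6 / 10) * eps) * T + 700 * (2 * C * (2 + 4 / gamma * ln (T + 1))))
   = 648 * (H * (gamma * Lam * T)) + (13 + 6 / 10) * (H * T * eps) + 2800 * (H * C)
     + 5600 * (H * (C / gamma * ln (T + 1))) by field; rewrite lt0r_neq0.
rewrite e1 Cg -/y -(mulrA 2 T); rewrite (_ : H * (9 * y) = 9 * (H * y)) in h1; last by ring.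
clear - T3 lS ly Hy CS C1 h1 h2 h3 t3.
move: (H * (S * _)) (H * C) (H * (_ * T)) (H * T * eps) (H * y) (T * lam3) (ell * S) (2 * Lam / lam3 * _)
  h1 h2 h3 t3 T3 lS ly Hy => *.
lra.
Qed.

(* Chosen as a power of 2 so that both the constant [scale ^+ 2] = 2^60 of the
   theorem and the bound on [ln (3 + H + T)] are easy to evaluate. *)
Definition scale : R := 4 * (128 * 128) * (128 * 128).

(** The condition on [T] involves the logarithm of [T]. As [T] is polynomial in [B], this logarithm
    is O(ln B); its square, squared again when sqrt(T) is compared with eps T, gives the exponent
    4. *)
Lemma sample_size q H C L eps eps_app T : q = scale -> 1 <= H -> 1 <= C -> 1 / 2 <= L -> 0 < eps ->
  eps_app <= eps / (18 * H) ->
  let B := 3 + H + C + eps^-1 + L in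
  let T0 := q ^+ 2 * (H ^+ 2 * C / eps ^+ 2) * L * ln B ^+ 4 in
  T0 <= T -> T <= 2 * T0 + 1 ->
  128 * 128 * (H * (ln (3 + H + T) ^+ 2 * Num.sqrt (C * T * L))) +
    (13 + 6 / 10) * (H * T * eps_app) <= eps * T.
Proof.
move=> qE H1 C1 L1 e0 eapp B T0 T0T TT0.
have ei : 0 < eps^-1 by rewrite invr_gt0.
have B5 : 5 <= B by rewrite /B; lra.
have B0 : 0 < B by lra.
set lB := ln B in T0 T0T TT0 *.
have lB1 : 1 <= lB by apply: ln_ge1; lra.
have lBB : lB <= B by apply/ltW/ln_sublinear.
have q0 : 0 < q by rewrite qE /scale; lra.
have q1 : 1 <= q by rewrite qE /scale; lra.
have c1 : 1 <= q ^+ 2 by rewrite exprn_ege1.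
have T00 : 0 < T0.
  have [h1 [h2 [h3 h4]]] : 0 < H /\ 0 < C /\ 0 < L /\ 0 < lB by split; [|split; [|split]]; lra.
  apply: mulr_gt0; last exact: exprn_gt0.
  apply: mulr_gt0 => //; apply: mulr_gt0; first exact: exprn_gt0.
  by apply: divr_gt0; [apply: mulr_gt0 => //|]; exact: exprn_gt0.
have Tp : 0 < T by lra.
(* The degree 10 is 2 for H, 1 for C, 2 for 1/eps, 1 for L and 4 for the logarithm. *)
have T0B : T0 <= q ^+ 2 * B ^+ 10.
  rewrite /T0 (_ : q ^+ 2 * (H ^+ 2 * C / eps ^+ 2) * L * lB ^+ 4 =
    q ^+ 2 * (H ^+ 2 * C * eps^-1 ^+ 2 * L * lB ^+ 4)); last by rewrite exprVn; ring.
  rewrite ler_pM2l ?exprn_gt0// (_ : B ^+ 10 = B ^+ 2 * B * B ^+ 2 * B * B ^+ 4); last by ring.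
  have pw (x : R) k : 0 <= x -> x <= B -> x ^+ k <= B ^+ k.
    by move=> x0 xB; rewrite lerXn2r// nnegrE// ltW.
  have HB : H <= B by rewrite /B; lra.
  have CB : C <= B by rewrite /B; lra.
  have eB : eps^-1 <= B by rewrite /B; lra.
  have LB : L <= B by rewrite /B; lra.
  have C0 : 0 <= C by lra.
  have L0 : 0 <= L by lra.
  have l0 : 0 <= lB by lra.
  have a1 := ler_pM (sqr_ge0 H) C0 (pw H 2 (ltac:(lra)) HB) CB.
  have n1 := mulr_ge0 (sqr_ge0 H) C0.
  have a2 := ler_pM n1 (sqr_ge0 _) a1 (pw _ 2 (ltW ei) eB).
  have n2 := mulr_ge0 n1 (sqr_ge0 eps^-1).
  have a3 := ler_pM n2 L0 a2 LB.
  exact: (ler_pM (mulr_ge0 n2 L0) (exprn_ge0 4 l0) a3 (pw _ 4%N l0 lBB)).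
(* [3 + H + T] is at most 2^62 B^10, and 62 ln 2 + 10 ln B <= 72 ln B. *)
have ell : ln (3 + H + T) <= 72 * lB.
  have b1 : B <= q ^+ 2 * B ^+ 10.
    apply: (@le_trans _ _ (1 * B)); first by rewrite mul1r.
    apply: ler_pM => //; first exact: ltW.
    by rewrite (_ : B = B ^+ 1)// ler_weXn2l//; lra.
  have hT : 3 + H + T <= 2 ^+ 62 * B ^+ 10.
    have -> : 2 ^+ 62 = 4 * q ^+ 2 :> R by rewrite qE /scale; ring.
    have HB : 3 + H <= B by rewrite /B; lra.
    by rewrite -mulrA; lra.
  have p : 0 < 3 + H + T by lra.
  have p2 : (0 : R) < 2 ^+ 62 by rewrite exprn_gt0.
  have p3 : 0 < B ^+ 10 by rewrite exprn_gt0.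
  apply: (@le_trans _ _ (ln (2 ^+ 62 * B ^+ 10))).
    by rewrite ler_ln ?posrE//; exact: mulr_gt0.
  rewrite (lnM (x := 2 ^+ 62)) ?posrE// !lnXn//.
  have l2 : ln 2 <= lB by rewrite ler_ln ?posrE//; lra.
  rewrite -!(mulr_natl (ln _)) -/lB; lra.
have e1 : 1 <= ln (3 + H + T) by apply: ln_ge1; lra.
set S := Num.sqrt _.
have S0 : 0 <= S by exact: sqrtr_ge0.
have S2 : S ^+ 2 = C * T * L by rewrite sqr_sqrtr// !mulr_ge0//; lra.
have H0 : 0 < H by lra.
have main : q * (H * (lB ^+ 2 * S)) <= eps * T.
  apply: sqr_le_le; first by rewrite mulr_ge0// ltW.
  have -> : (q * (H * (lB ^+ 2 * S))) ^+ 2 = eps ^+ 2 * T * T0.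
    by rewrite !exprMn S2 /T0; field; rewrite lt0r_neq0.
  have -> : (eps * T) ^+ 2 = eps ^+ 2 * T * T by ring.
  by rewrite ler_pM2l// mulr_gt0// exprn_gt0.
have sq : ln (3 + H + T) ^+ 2 <= 5184 * lB ^+ 2.
  have -> : 5184 * lB ^+ 2 = (72 * lB) ^+ 2 by ring.
  by rewrite lerXn2r ?nnegrE//; lra.
have z1 : H * (ln (3 + H + T) ^+ 2 * S) <= 5184 * (H * (lB ^+ 2 * S)).
  have -> : 5184 * (H * (lB ^+ 2 * S)) = H * ((5184 * lB ^+ 2) * S) by ring.
  by rewrite ler_pM2l// ler_wpM2r.
have z2 : H * T * eps_app <= eps * T / 18.
  have -> : eps * T / 18 = H * T * (eps / (18 * H)) by field; rewrite lt0r_neq0.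
  by rewrite ler_pM2l// mulr_gt0.
have z0 : 0 <= H * (lB ^+ 2 * S).
  by apply: mulr_ge0; [exact: ltW|apply: mulr_ge0; [exact: sqr_ge0|exact: S0]].
(* The estimation error takes the share 5184 / 65536 of [eps * T], the approximation error 13.6 /
   18; together they stay below 1. *)
move: main z1 z2 z0; rewrite qE /scale; clear; lra.
Qed.

End Constants.

(** * The regret bound *)

Section Final.
Context {R : realType} {X A : countType}.
Variable M : mdp R X A.
Local Notation H := (horizon M).
Hypothesis wf : wf_mdp M.
Variables (I J : finType) (F : I -> nat -> X -> A -> R) (g : I -> nat -> X -> A)
  (W : J -> nat -> X -> A -> \bar R) (idef : I).
Hypothesis F01 : forall i h x a, (h < H)%N -> 0 <= F i h x a <= 1.
Hypothesis W0 : forall j h x a, (h < H)%N -> (0 <= W j h x a)%E.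
Hypothesis greedy : greedy_ok M F g.
Variable iQ : I.
Hypothesis FQ : forall h x a, (h < H)%N -> F iQ h x a = Qstar M h x a.
Hypothesis Ccov_fin : (Ccov M g < +oo)%E.

Let piP i : is_policy (piF R g i). Proof. exact: detpol_policy. Qed.
Let r3 := reward3 wf F01 greedy FQ.
Let C := fine (Ccov M g).

Lemma ratio_le (a b c : R) : 0 <= a -> 0 <= b -> (Defs.ratio a b <= c%:E)%E -> a <= c * b.
Proof.
move=> a0 b0; rewrite /Defs.ratio; case: eqP => [->|/eqP bn0].
  by case: eqP => [->|_]; [rewrite mulr0|rewrite leye_eq].
by rewrite lee_fin ler_pdivrMr// lt_neqAle eq_sym bn0.
Qed.

(** Summing [occ <= e * mu] over all pairs compares the total masses 1 and [e]. *)
Lemma Ccov_ge1 : (0 < H)%N -> (1 <= Ccov M g)%E.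
Proof.
move=> H0; apply: le_ereal_inf_tmp => _ [mu [mud ->]].
set e := ereal_sup _; have rle xa : (Defs.ratio (occ M (piF R g idef) 0 xa) (mu 0%N xa) <= e)%E.
  by apply: ereal_sup_ubound; exists idef, 0%N, xa.
have [p0 p1] := occ_dist wf (piP idef) H0; have [m0 m1] := mud _ H0.
have [xa oxa] : exists xa, occ M (piF R g idef) 0 xa != 0.
  apply: contrapT => h; have : \esum_(t in [set: X * A]) (occ M (piF R g idef) 0 t)%:E = 0%E.
    apply: esum1 => t _; congr EFin; apply: contrapT => /eqP ot; apply: h; by exists t.
  by rewrite p1 => /eqP; rewrite onee_eq0.
have rpos : (0 < e)%E.
  apply: lt_le_trans (rle xa); have op : 0 < occ M (piF R g idef) 0 xa by rewrite lt_neqAle eq_sym oxa p0.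
  rewrite /Defs.ratio; case: eqP => [_|/eqP mn]; first by rewrite (negbTE oxa).
  by rewrite lte_fin divr_gt0// lt_neqAle eq_sym mn m0.
case E : e rpos rle => [r| |]//= r0 rle; last by rewrite leey.
have r0' : 0 <= r by rewrite -lee_fin ltW.
rewrite -p1 -[leRHS]mule1 -m1 -esumZl//.
by apply: le_esum => t _; rewrite -EFinM lee_fin; exact: ratio_le.
Qed.

Lemma C_ge1 : (0 < H)%N -> 1 <= C /\ Ccov M g = C%:E.
Proof.
move=> H0; have := Ccov_ge1 H0; rewrite /C; move: Ccov_fin.
by case: (Ccov M g) => [r| |]//= _; rewrite lee_fin.
Qed.

(** The infimum need not be attained, so a measure within a factor 2 of it is taken; [C >= 1] makes
    the inequality strict. *)
Lemma covering : (0 < H)%N -> exists mu : nat -> X * A -> R,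
  (forall h, (h < H)%N -> is_dist (mu h)) /\
  (forall i h xa, (h < H)%N -> occ M (piF R g i) h xa <= (2 * C) * mu h xa).
Proof.
move=> H0; have [C1 CE] := C_ge1 H0.
have : (Ccov M g < (2 * C)%:E)%E by rewrite CE lte_fin; lra.
move=> /ereal_inf_lt [_ [mu [mud ->]] hlt]; exists mu; split => // i h xa hH.
apply: ratio_le; [by case: (occ_dist wf (piP i) hH)|by case: (mud _ hH)|].
by apply: le_trans (ltW hlt); apply: ereal_sup_ubound; exists i, h, xa.
Qed.

Section Rounds.
Variables (T : nat) (gamma delta eps_app : R).
Local Notation regret := (regret M F g W T 1 gamma delta idef).
Local Notation glow_prob := (glow_prob M F g W T 1 gamma delta idef).

Lemma glow_prob_sure (good : seq (@traj R X A) -> bool) : (forall hist, good hist) -> (1%:E <= glow_prob good)%E.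
Proof.
move=> goodP; rewrite /glow_prob muln1.
have := @run_supermartingale R X A M wf (fun h x a x' => @r3 h x a x') I J F g W T gamma delta idef
  (fun=> 0) good; rewrite subr0; apply => //.
- by move=> hist _; exact: tmeas_cst.
- move=> hist _; rewrite (exp_cst (traj_expectation wf (fun h x a x' => @r3 h x a x') (piP _)))//.
Qed.

Lemma glow_prob_sure_ge (good : seq (@traj R X A) -> bool) : 0 < delta -> (forall hist, good hist) ->
  ((1 - delta)%:E <= glow_prob good)%E.
Proof.
by move=> d0 goodP; apply: le_trans (glow_prob_sure goodP); rewrite lee_fin; lra.
Qed.

Lemma regret_le hist : regret hist <= T%:R.
Proof.
apply: (@le_trans _ _ (\sum_(1 <= t < T.+1) 1)).
  by apply: ler_sum => t _; exact: (suboptimality_le1 wf F01 greedy FQ).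
by rewrite big_add1 sumr_const_nat subn0.
Qed.

(** Here [L] can be arbitrarily small and cannot absorb the other logarithms; but the only policy is
    greedy for [Qstar]. *)
Lemma regret_singleton hist : (#|I| <= 1)%N -> regret hist <= 0.
Proof.
move=> I1; apply: sumr_le0 => t _; have -> : chosen M F g W T 1 gamma delta idef t hist = iQ.
  exact: (fintype_le1P I1).
exact: (suboptimality_Q wf F01 greedy FQ).
Qed.

Lemma regret_horizon0 hist : H = 0%N -> regret hist <= 0.
Proof.
move=> H0; apply: sumr_le0 => t _; set i := chosen _ _ _ _ _ _ _ _ _ _ _.
have := Jval_greedy wf F01 greedy FQ i; have := Jstar_le_predicted wf F01 greedy FQ.
have e k : predicted_value M F g k = 0.
  rewrite /predicted_value /mean (_ : greedy_value M F g k 0 = fun=> 0).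
    by case: wf => id _; exact: (sE_cst (dist_expectation id)).
  by apply/funext => x; rewrite /greedy_value H0.
rewrite !e big1 => [|h _]; last by exfalso; have := ltn_ord h; lia.
by lra.
Qed.

Hypothesis delta01 : 0 < delta < 1.
Hypothesis realizable : W_realizable M g W T eps_app.
Let L := ln (#|I|%:R * #|J|%:R / delta).

Lemma realizable_nontrivial : (0 < H)%N -> (0 < T)%N -> (0 < #|J|)%N /\ 0 <= eps_app.
Proof.
move=> H0 T0; have [|j jP] := realizable H0 iQ (s := [:: iQ]); first by rewrite /= T0.
split; first by apply/card_gt0P; exists j.
rewrite -lee_fin; apply: le_trans (jP iQ); apply: esum_ge0 => xa _.
apply: mule_ge0; first by rewrite lee_fin; case: (occ_dist wf (piP iQ) H0).
by rewrite /Defs.edist; case: ifP.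
Qed.

Lemma L_ge0 : (0 < H)%N -> (0 < T)%N -> 0 <= L.
Proof.
move=> H0 T0; have [J0 _] := realizable_nontrivial H0 T0; have /andP[d0 d1] := delta01.
have I0 : (0 < #|I|)%N by apply/card_gt0P; exists iQ.
apply: ln_ge0; rewrite ler_pdivlMr// mul1r (le_trans (ltW d1))// -natrM ler1n muln_gt0 I0.
by [].
Qed.

Lemma L_ge_half : (1 < #|I|)%N -> (0 < H)%N -> (0 < T)%N -> 1 / 2 <= L.
Proof.
move=> I2 H0 T0; have [J0 _] := realizable_nontrivial H0 T0; have /andP[d0 d1] := delta01.
apply: le_trans ln2_ge_half _; have IJ : (2 : R) <= #|I|%:R * #|J|%:R.
  by rewrite -natrM ler_nat -[2%N]muln1 leq_mul.
rewrite ler_ln ?posrE//; last by rewrite divr_gt0//; lra.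
by rewrite ler_pdivlMr//; lra.
Qed.

Lemma log_term_bound : (1 < #|I|)%N -> (0 < H)%N -> (0 < T)%N ->
  0 < log_term M I J T delta <= 9 * (L * ln (3 + H%:R + T%:R)).
Proof.
move=> I2 H0 T0; have L2 := L_ge_half I2 H0 T0; have /andP[d0 d1] := delta01.
have [J0 _] := realizable_nontrivial H0 T0.
have H1 : (1 : R) <= H%:R by rewrite ler1n.
have T1 : (1 : R) <= T%:R by rewrite ler1n.
have IJ : (0 : R) < #|I|%:R * #|J|%:R / delta.
  by rewrite divr_gt0// mulr_gt0// ltr0n// ltnW.
have -> : log_term M I J T delta = L + ln (6 * (T%:R * H%:R)).
  rewrite /log_term /L -lnM ?posrE//; last by rewrite !mulr_gt0//; lra.
  by congr ln; ring.
set y : R := 3 + H%:R + T%:R; have y5 : 5 <= y by rewrite /y; lra.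
have l1 : 1 <= ln y by apply: ln_ge1; lra.
have TH1 : 1 <= T%:R * H%:R :> R by rewrite -natrM ler1n muln_gt0 T0.
have p0 : 0 <= ln (6 * (T%:R * H%:R) : R) by apply: ln_ge0; lra.
have p4 : ln (6 * (T%:R * H%:R)) <= 4 * ln y.
  have -> : 4 * ln y = ln (y ^+ 4) by rewrite lnXn ?mulr_natl//; lra.
  rewrite ler_ln ?posrE; [|lra|by rewrite exprn_gt0//; lra].
  rewrite (_ : y ^+ 4 = y ^+ 2 * (y * y)); last by ring.
  apply: ler_pM; rewrite ?mulr_ge0//; [|by apply: ler_pM => //; rewrite /y; lra].
  have -> : y ^+ 2 = y * y by ring.
  by apply: (@le_trans _ _ (5 * 5)); [lra|apply: ler_pM; lra].
have LL : L <= L * ln y by rewrite ler_peMr//; lra.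
have L4 : 4 * ln y <= 8 * (L * ln y).
  have := ler_wpM2r (_ : 0 <= ln y) L2 => /(_ ltac:(lra)); lra.
by apply/andP; split; lra.
Qed.

(** If [T] is below [4 * log_term], or [C] above [T * L], then [cap] already exceeds the trivial
    regret bound [T]. Otherwise the rate of the initial values is at most 1/2, and [cap_bound]
    applies. *)
Lemma glow_high_probability cap : (1 < #|I|)%N -> (0 < H)%N -> (0 < T)%N ->
  gamma = Num.sqrt (C / (T%:R * L)) ->
  128 * 128 * (H%:R * (ln (3 + H%:R + T%:R) ^+ 2 * Num.sqrt (C * T%:R * L))) +
    (13 + 6 / 10) * (H%:R * T%:R * eps_app) <= cap ->
  ((1 - delta)%:E <= glow_prob (fun hist => (regret hist <= cap)%R))%E.
Proof.
move=> I2 H0 T0 gE hcap; have /andP[d0 d1] := delta01.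
have L2 := L_ge_half I2 H0 T0; have [C1 _] := C_ge1 H0.
have [J0 e0] := realizable_nontrivial H0 T0.
have /andP[La0 La9] := log_term_bound I2 H0 T0.
have H1 : (1 : R) <= H%:R by rewrite ler1n.
have T1 : (1 : R) <= T%:R by rewrite ler1n.
set ell := ln _ in hcap La9; set S := Num.sqrt _ in hcap.
have l1 : 1 <= ell by apply: ln_ge1; lra.
have S0 : 0 <= S by exact: sqrtr_ge0.
have CTL0 : 0 <= C * T%:R * L by rewrite !mulr_ge0//; lra.
have S2 : S ^+ 2 = C * T%:R * L by rewrite sqr_sqrtr.
have small : T%:R <= 6 * (ell * S) ->
    ((1 - delta)%:E <= glow_prob (fun hist => (regret hist <= cap)%R))%E.
  move=> TS; apply: glow_prob_sure_ge => // hist; apply: (le_trans (regret_le hist)).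
  apply: le_trans hcap; have he : 0 <= H%:R * T%:R * eps_app by rewrite !mulr_ge0.
  have h1 : ell * S <= ell ^+ 2 * S by rewrite expr2 -mulrA ler_peMl// mulr_ge0//; lra.
  have h2 : ell ^+ 2 * S <= H%:R * (ell ^+ 2 * S) by rewrite ler_peMl// mulr_ge0// sqr_ge0.
  have h3 : 0 <= ell * S by rewrite mulr_ge0//; lra.
  move: TS he h1 h2 h3.
  by move: (H%:R * T%:R * eps_app) (H%:R * (ell ^+ 2 * S)) (ell ^+ 2 * S) (ell * S) => *; lra.
have lS : 0 <= ell * S by rewrite mulr_ge0//; lra.
have [LT|TL4] := leP (4 * log_term M I J T delta) T%:R; last first.
  apply: small; apply: sqr_le_le; first by lra.
  have -> : (6 * (ell * S)) ^+ 2 = 36 * (ell * ell * (C * T%:R * L)) by rewrite !exprMn S2; ring.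
  apply: (@le_trans _ _ (T%:R * (36 * (L * ell)))).
    by rewrite expr2 ler_pM2l; [lra|lra].
  rewrite (_ : T%:R * (36 * (L * ell)) = 36 * (ell * 1 * (1 * T%:R * L))); last by ring.
  rewrite ler_wpM2l//; apply: ler_pM.
  - by rewrite mulr1; lra.
  - by rewrite mul1r mulr_ge0//; lra.
  - by rewrite ler_wpM2l//; lra.
  - by rewrite ler_wpM2r ?ler_wpM2r//; lra.
have [CTL|CTL] := leP C (T%:R * L); last first.
  apply: small; apply: (@le_trans _ _ (2 * S)); last first.
    have : S <= ell * S by rewrite ler_peMl.
    lra.
  apply: sqr_le_le; first lra.
  have -> : (2 * S) ^+ 2 = 4 * (T%:R * L * C) by rewrite exprMn S2; ring.
  apply: (@le_trans _ _ (4 * (T%:R * L * (T%:R * L)))); last first.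
    by rewrite ler_wpM2l// ler_wpM2l ?mulr_ge0 ?(ltW CTL)//; lra.
  have -> : 4 * (T%:R * L * (T%:R * L)) = T%:R ^+ 2 * ((2 * L) * (2 * L)) by ring.
  rewrite ler_peMr ?sqr_ge0//; apply: (@le_trans _ _ (1 * 1)); first lra.
  by apply: ler_pM; lra.
have [mu [mud occC]] := covering H0.
have g0 : 0 < gamma by rewrite gE sqrtr_gt0 divr_gt0 ?mulr_gt0//; lra.
apply: (glow_core wf F01 W0 greedy FQ g0 idef H0
  (lam3 := Num.sqrt (log_term M I J T delta / T%:R)) _ _ (mu := mu) (C := 2 * C) (eps_app := eps_app)) => //.
- rewrite sqrtr_gt0 divr_gt0//=; last lra.
  apply: sqr_le_le; first lra.
  rewrite sqr_sqrtr ?divr_ge0//; last exact: ltW.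
  rewrite ler_pdivrMr; lra.
- exact: ltW.
- by lra.
apply: le_trans hcap; apply: cap_bound => //; try lra.
- by rewrite ler_ln ?posrE; lra.
- by rewrite ler_ln ?posrE; lra.
Qed.

End Rounds.
End Final.

Theorem theorem3p1 :
  exists c k : nat,
  forall (R : realType) (X A : countType) (M : mdp R X A) (I J : finType)
    (F : I -> nat -> X -> A -> R) (g : I -> nat -> X -> A)
    (W : J -> nat -> X -> A -> \bar R) (idef : I),
    wf_mdp M -> Fclass_ok M F -> Wclass_ok M W -> greedy_ok M F g ->
    Qstar_in_F M F -> (Ccov M g < +oo)%E ->
    let H : R := (horizon M)%:R in
    let C : R := fine (Ccov M g) in
    (forall eps delta eps_app : R,
       0 < eps -> 0 < delta < 1 -> eps_app <= eps / (18 * H) ->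
       let L := ln (#|I|%:R * #|J|%:R / delta) in
       let T0 := c%:R * (H ^+ 2 * C / eps ^+ 2) * L *
                 ln (3 + H + C + eps^-1 + L) ^+ k in
       forall T : nat, T0 <= T%:R <= 2 * T0 + 1 ->
       W_realizable M g W T eps_app ->
       let gamma := Num.sqrt (C / (T%:R * L)) in
       ((1 - delta)%:E <=
        glow_prob M F g W T 1 gamma delta idef
          (fun hist => (regret M F g W T 1 gamma delta idef hist / T%:R <= eps)%R))%E)
    /\
    (forall (delta eps_app : R) (T : nat),
       0 < delta < 1 ->
       W_realizable M g W T eps_app ->
       let L := ln (#|I|%:R * #|J|%:R / delta) in
       let gamma := Num.sqrt (C / (T%:R * L)) in
       ((1 - delta)%:E <=
        glow_prob M F g W T 1 gamma delta idef
          (fun hist => (regret M F g W T 1 gamma delta idef hist <=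
             c%:R * ln (3 + H + C + L + T%:R) ^+ k *
             (H * Num.sqrt (C * T%:R * L) + H * T%:R * eps_app))%R))%E).
Proof.
have [c cE] : exists c : nat, forall R : realType, c%:R = scale ^+ 2 :> R.
  by exists (2 ^ 60)%N => R; rewrite natrX /scale; ring.
exists c, 4%N => R X A M I J F g W idef wf [F01 _] [W0 _] greedy [iQ FQ] Cfin H C.
have F01' i h x a : (h < horizon M)%N -> 0 <= F i h x a <= 1 by exact: F01.
have W0' j h x a : (h < horizon M)%N -> (0 <= W j h x a)%E by exact: W0.
have trivial T gamma delta hist : (horizon M == 0%N) || (T == 0%N) || (#|I| <= 1)%N ->
    regret M F g W T 1 gamma delta idef hist <= 0.
  move=> /orP[/orP[/eqP H0|/eqP T0]|I1].
  - exact: (regret_horizon0 wf W idef F01' greedy FQ Cfin).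
  - by have := regret_le wf W idef F01' greedy FQ T gamma delta hist; rewrite T0.
  - exact: (regret_singleton wf W idef F01' greedy FQ).
have nontrivial T : ~~ ((horizon M == 0%N) || (T == 0%N) || (#|I| <= 1)%N) ->
    [/\ (0 < horizon M)%N, (0 < T)%N & (1 < #|I|)%N].
  by rewrite !negb_or -ltnNge -!lt0n => /andP[/andP[]].
have H1 : (0 < horizon M)%N -> 1 <= H by rewrite /H ler1n.
have C1 : (0 < horizon M)%N -> 1 <= C by move=> H0; case: (C_ge1 wf idef Cfin H0).
split.
  move=> eps delta eps_app e0 d01 eapp L T0 T /andP[T0T TT0] real.
  cbv zeta; set gamma := Num.sqrt _.
  have [d0 _] := andP d01.
  have [triv|/nontrivial[H0 Tp I2]] := boolP ((horizon M == 0%N) || (T == 0%N) || (#|I| <= 1)%N).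
    apply: (glow_prob_sure_ge wf W idef F01' greedy FQ) => // hist.
    by apply: (le_trans _ (ltW e0)); rewrite mulr_le0_ge0 ?invr_ge0// trivial.
  have TR : (0 : R) < T%:R by rewrite ltr0n.
  (* The output is the uniform mixture of the policies, so suboptimality [eps] means regret
     [eps * T]. *)
  under [X in glow_prob _ _ _ _ _ _ _ _ _ X]eq_fun do rewrite ler_pdivrMr//.
  apply: (glow_high_probability wf idef F01' W0' greedy FQ Cfin d01 real) => //.
  apply: (@sample_size R scale); [by []|exact: H1|exact: C1| |exact: e0|exact: eapp| |].
  - exact: (L_ge_half wf iQ d01 real I2 H0 Tp).
  - by rewrite -cE.
  - by rewrite -cE.
move=> delta eps_app T d01 real; have [d0 _] := andP d01.
cbv zeta; set L := ln _; set gamma := Num.sqrt _.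
have scale1 : (128 * 128 : R) <= scale ^+ 2.
  rewrite /scale; set a := 128 * 128; have a1 : 1 <= a by rewrite /a; lra.
  rewrite (_ : _ ^+ 2 = a * (16 * (a * (a * a)))); last by ring.
  rewrite ler_peMr//; first lra.
  have : 1 <= a * (a * a) by rewrite -[leLHS]mulr1 ler_pM// -[leLHS]mulr1 ler_pM.
  lra.
have [triv|/nontrivial[H0 Tp I2]] := boolP ((horizon M == 0%N) || (T == 0%N) || (#|I| <= 1)%N).
  apply: (glow_prob_sure_ge wf W idef F01' greedy FQ) => // hist.
  apply: le_trans (trivial _ _ _ _ triv) _.
  (* If [T] or the horizon is 0, realizability is vacuous and [eps_app] may be negative, but its
     coefficient vanishes. *)
  have [->|T0] := eqVneq T 0%N; first by rewrite !(mulr0, mul0r, sqrtr0, addr0).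
  have [H0|H0] := eqVneq (horizon M) 0%N; first by rewrite /H H0 !(mulr0, mul0r, addr0).
  rewrite -!lt0n in T0 H0; have [_ ea0] := realizable_nontrivial wf iQ real H0 T0.
  have L0 := L_ge0 wf iQ d01 real H0 T0.
  have TR : (0 : R) <= T%:R by rewrite ler0n.
  have h1 := H1 H0; have c1 := C1 H0.
  rewrite mulr_ge0//; first rewrite mulr_ge0// exprn_ge0// ln_ge0//.
    by rewrite -/L in L0; lra.
  by rewrite addr_ge0// !mulr_ge0// ?sqrtr_ge0//; lra.
apply: (glow_high_probability wf idef F01' W0' greedy FQ Cfin d01 real) => //.
have [_ ea0] := realizable_nontrivial wf iQ real H0 Tp.
have Lh := L_ge_half wf iQ d01 real I2 H0 Tp; rewrite -/L in Lh *.
have TR : (1 : R) <= T%:R by rewrite ler1n.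
have h1 := H1 H0; have c1 := C1 H0; rewrite -/H -/C.
set ell := ln (3 + H + T%:R); set ell' := ln (3 + H + C + L + T%:R); set S := Num.sqrt _.
have l1 : 1 <= ell by apply: ln_ge1; lra.
have ll' : ell <= ell' by rewrite ler_ln ?posrE; lra.
(* The regret bound only has the square of the logarithm; the common exponent 4 comes from the
   sample size. *)
have e4 : ell ^+ 2 <= ell' ^+ 4.
  apply: (@le_trans _ _ (ell' ^+ 2)); first by rewrite lerXn2r ?nnegrE//; lra.
  by rewrite ler_weXn2l//; lra.
have e41 : 1 <= ell' ^+ 4 by rewrite exprn_ege1//; lra.
have S0 : 0 <= H * S by rewrite mulr_ge0 ?sqrtr_ge0//; lra.
have E0 : 0 <= H * T%:R * eps_app by rewrite !mulr_ge0//; lra.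
rewrite cE [leRHS]mulrDr; apply: lerD.
  rewrite (_ : H * (ell ^+ 2 * S) = ell ^+ 2 * (H * S)); last by ring.
  rewrite mulrA; apply: ler_wpM2r => //.
  by apply: ler_pM; [lra|exact: sqr_ge0|exact: scale1|exact: e4].
apply: ler_wpM2r => //; apply: (@le_trans _ _ (128 * 128 * 1)); first lra.
by apply: ler_pM; [lra|lra|exact: scale1|exact: e41].
Qed.
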